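(* Fix a finite alphabet $\Sigma$ and a monoid morphism $h:\Sigma^*\to M$ into a finite monoid. Let $\mathcal C$ be a class of $h$-substitutable context-free languages $L\subseteq\Sigma^*$ such that, for each $L\in\mathcal C$, $(L,h)$ is unit-separated, has a finite set of relative primes, and satisfies FSRP. Suppose $\mathcal C$ has a weakly behaviorally correct positive-data learner whose hypotheses are context-free grammars. Then there is a positive-data learner that, for every $L\in\mathcal C$, identifies in the strong Gold sense the canonical finite-state relative-prime presentation $\mathfrak G^{\mathrm{fs}}_{L,h}$, and hence also its fixed canonical CFG compilation.
   Context: Relative notions. $D_L(x)=\{(u,v):uxv\in L\}$; $x\equiv_L y$ iff $D_L(x)=D_L(y)$. $L$ is $h$-substitutable if $h(x)=h(y)$ and $D_L(x)\cap D_L(y)\ne\varnothing$ imply $x\equiv_L y$. The relative syntactic congruence $\theta$: $x\,\theta\,y$ iff $x\equiv_L y$ and $h(x)=h(y)$; its classes $[x]$ are relative classes. A class is live if $D_L(x)\ne\varnothing$ for its members; the unit class is $[\varepsilon]$; $(L,h)$ is unit-separated if $[\varepsilon]=\{\varepsilon\}$. $X\cdot Y=\{xy:x\in X,y\in Y\}$; $X*Y=[xy]$ for $x\in X,y\in Y$. A relative prime is a live class $P\ne[\varepsilon]$ such that $P=X\cdot Y$ (as sets) with relative classes $X,Y$ forces one of them to be $[\varepsilon]$; $\mathcal P$ is the set of relative primes. For a prime sequence $\alpha=P_1\cdots P_k$: $\overline\alpha=P_1\cdot\ldots\cdot P_k$, $[\overline\alpha]=P_1*\cdots*P_k$. $P\to\alpha$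 ($P\in\mathcal P$, $|\alpha|\ge2$) is correct if $[\overline\alpha]=P$, and valid if moreover no proper contiguous block $\beta$ of $\alpha$ with $|\beta|\ge2$ has $[\overline\beta]\in\mathcal P$; $\mathrm{Val}_P=\{\alpha:P\to\alpha\text{ valid}\}\subseteq\mathcal P^*$. FSRP: $\mathcal P$ is finite and every $\mathrm{Val}_P$ is regular over $\mathcal P$. A relative class $X$ is accepting if $X\subseteq L$. Canonical presentation. $\mathfrak G^{\mathrm{fs}}_{L,h}=(\mathcal P,\mathrm{Lex},\mathrm{Start},\mathcal Q_{L,h},\delta,\mathrm{Fin})$, where $\mathrm{Lex}(P)=P\cap\Sigma$; $\mathrm{Start}$ records all exact prime factorizations (sequences $\alpha\in\mathcal P^+$ with $\overline\alpha=X$) of the accepting non-unit relative classes $X$, and the empty start alternative when $\varepsilon\in L$; $\mathcal Q_{L,h}=\{u^{-1}\mathrm{Val}_P: P\in\mathcal P,u\in\mathcal P^*,u^{-1}\mathrm{Val}_P\ne\varnothing\}$ with $u^{-1}K=\{v:uv\in K\}$; $\delta(R,A)=A^{-1}R$ whenever nonempty; $\mathrm{Fin}$ is the set of $R\in\mathcal Q_{L,h}$ containing $\varepsilon$. As a finite object it is encoded canonically: each prime is named by its shortlex-least word and each residual language $R$ by its normalized minimal DFA. Its canonical CFG compilation has nonterminals a start symbol $S$, the primes, and a symbol $C_R$ for each $R\in\mathcal Q_{L,h}$; rules $C_R\to A\,C_{R'}$ if $A^{-1}R=R'\ne\varnothing$, $C_R\to A$ if $\varepsilon\in A^{-1}R$,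 $P\to C_{\mathrm{Val}_P}$ if $\mathrm{Val}_P\neq\varnothing$, lexical rules $P\to a$ for $a\in\mathrm{Lex}(P)$, and start rules $S\to\alpha$ for the sequences in $\mathrm{Start}$ (and $S\to\varepsilon$ if $\varepsilon\in L$). Learning. A positive text for $L$ is an infinite sequence $T=(w_0,w_1,\dots)$ of elements of $L$ in which every word of $L$ occurs; $T[n]$ is its length-$n$ prefix. A learner is a computable map from finite sequences of words to hypotheses. A CFG-valued learner $\mathcal W$ is weakly behaviorally correct on $L$ if for every positive text $T$ of $L$ there is $N$ with $L(\mathcal W(T[n]))=L$ for all $n\ge N$ (the hypotheses need not stabilize); it is so for $\mathcal C$ if it is so on every $L\in\mathcal C$. A learner $\mathcal A$ identifies a canonical representation $\mathrm{Can}(L,h)$ in the strong Gold sense if for every positive text $T$ of $L$ there is $N$ with $\mathcal A(T[n])=\mathrm{Can}(L,h)$ for all $n\ge N$. *)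

(* Defs.v *)
From HB Require Import structures.
From mathcomp Require Import all_boot all_order all_classical.

Set Implicit Arguments.
Unset Strict Implicit.
Unset Printing Implicit Defensive.

Local Open Scope classical_set_scope.

(* The total recursive functions of Kleene: minimization is only applied when
   it is regular, i.e. when the sought zero always exists.  No partial function
   is needed to generate all total computable functions. *)
Inductive recursive : forall k : nat, (k.-tuple nat -> nat) -> Prop :=
| rec_zero : @recursive 0 (fun _ => 0)
| rec_succ : @recursive 1 (fun v => (thead v).+1)
| rec_proj k (i : 'I_k) : @recursive k (fun v => tnth v i)
| rec_comp k m (f : m.-tuple nat -> nat) (g : 'I_m -> k.-tuple nat -> nat) :
    recursive f -> (forall i, recursive (g i)) ->
    @recursive k (fun v => f [tuple g i v | i < m])
| rec_prim k (f : k.-tuple nat -> nat) (g : k.+2.-tuple nat -> nat) :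
    recursive f -> recursive g ->
    @recursive k.+1 (fun v =>
      iteri (thead v) (fun n r => g [tuple of n :: r :: behead v])
            (f [tuple of behead v]))
| rec_mu k (f : k.+1.-tuple nat -> nat) (g : k.-tuple nat -> nat) :
    recursive f ->
    (forall v : k.-tuple nat, f [tuple of g v :: v] = 0 /\
       forall y, y < g v -> f [tuple of y :: v] <> 0) ->
    recursive g.

(* The coding of data by numbers is the library's [pickle]; for nat, finite
   types, sequences, pairs, sums and options it is effective, with a decidable
   image. *)
Definition computable (A B : countType) (f : A -> B) : Prop :=
  exists2 g : 1.-tuple nat -> nat, recursive g &
    forall a, g [tuple pickle a] = pickle (f a).

(* The elements of a finite set in increasing order of their codes (and [::] on
   an infinite set). *)
Definition listing (T : countType) (A : set T) : seq T :=
  sort (fun x y => pickle x <= pickle y) (finmap.enum_fset (fset_set A)).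

Fixpoint lex_le (T : eqType) (le : rel T) (u v : seq T) : bool :=
  match u, v with
  | [::], _ => true
  | _ :: _, [::] => false
  | x :: u', y :: v' => if x == y then lex_le le u' v' else le x y
  end.

Definition shortlex (T : eqType) (le : rel T) : rel (seq T) := fun u v =>
  (size u < size v) || (size u == size v) && lex_le le u v.

Definition shortlex_least (T : choiceType) (le : rel T) (X : set (seq T)) :
    seq T :=
  xget [::] [set w | X w /\ forall v, X v -> shortlex le w v].

Definition lquot (A : Type) (u : seq A) (K : set (seq A)) : set (seq A) :=
  [set v | K (u ++ v)].

Definition regular (A : Type) (K : set (seq A)) : Prop :=
  exists (Q : finType) (q0 : Q) (step : Q -> A -> Q) (F : pred Q),
    forall w, K w <-> F (foldl step q0 w).

(* The states of the minimal complete automaton of K over the alphabet listed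
   by A are represented by their shortlex-least access words, and are numbered
   in shortlex order of these, so that the initial state, reached by the empty
   word, is 0. *)
Definition access_word (T : choiceType) (le : rel T) (A : seq T)
    (K : set (seq T)) (u : seq T) : seq T :=
  shortlex_least le [set v | {subset v <= A} /\ lquot v K = lquot u K].

Definition access_words (T : choiceType) (le : rel T) (A : seq T)
    (K : set (seq T)) : seq (seq T) :=
  sort (shortlex le)
    (finmap.enum_fset
      (fset_set [set access_word le A K u | u in [set u | {subset u <= A}]])).

(* For each state: whether it is final, and its successors under the letters
   of A, in the order of A. *)
Definition dfa : Type := seq (bool * seq nat).
HB.instance Definition _ := Countable.on dfa.

Definition min_dfa (T : choiceType) (le : rel T) (A : seq T)
    (K : set (seq T)) : dfa :=
  let q := access_words le A K in
  [seq (`[< K u >], [seq index (access_word le A K (rcons u a)) q | a <- A])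
  | u <- q].

Definition word (S : finType) : countType := seq S.

Record cfg (N : countType) (S : finType) := CFG {
  cfg_start : N;
  cfg_rules : seq (N * seq (N + S)) }.

Definition cfg_pair (N : countType) (S : finType) (G : cfg N S) :=
  (cfg_start G, cfg_rules G).
Definition pair_cfg (N : countType) (S : finType)
  (p : N * seq (N * seq (N + S))) := CFG p.1 p.2.
Lemma cfg_pairK (N : countType) (S : finType) :
  cancel (@cfg_pair N S) (@pair_cfg N S).
Proof. by case. Qed.
HB.instance Definition _ (N : countType) (S : finType) :=
  Countable.copy (cfg N S) (can_type (@cfg_pairK N S)).

Inductive derives (N : countType) (S : finType) (G : cfg N S) :
    seq (N + S) -> seq (N + S) -> Prop :=
| derives_refl s : derives G s s
| derives_step l A rhs r t :
    (A, rhs) \in cfg_rules G -> derives G (l ++ rhs ++ r) t ->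
    derives G (l ++ inl A :: r) t.

Definition cfg_lang (N : countType) (S : finType) (G : cfg N S) :
    set (word S) :=
  [set w | derives G [:: inl (cfg_start G)] (map inr w)].

Definition context_free (S : finType) (L : set (word S)) : Prop :=
  exists (N : countType) (G : cfg N S), cfg_lang G = L.

Definition word_morphism (S : finType) (M : monoidType) (h : word S -> M) :=
  h [::] = 1%g /\ forall u v : word S, h (u ++ v) = (h u * h v)%g.

Definition contexts (S : finType) (L : set (word S)) (x : word S) :
    set (word S * word S) :=
  [set c | L (c.1 ++ x ++ c.2)].

Definition substitutable (S : finType) (M : monoidType) (h : word S -> M)
    (L : set (word S)) : Prop :=
  forall x y, h x = h y -> contexts L x `&` contexts L y !=set0 ->
    contexts L x = contexts L y.

Definition theta (S : finType) (M : monoidType) (h : word S -> M)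
    (L : set (word S)) (x y : word S) : Prop :=
  contexts L x = contexts L y /\ h x = h y.

Definition rclass (S : finType) (M : monoidType) (h : word S -> M)
    (L : set (word S)) (x : word S) : set (word S) :=
  [set y | theta h L x y].

Definition is_rclass (S : finType) (M : monoidType) (h : word S -> M)
    (L : set (word S)) (X : set (word S)) : Prop :=
  exists x, X = rclass h L x.

Definition unit_class (S : finType) (M : monoidType) (h : word S -> M)
    (L : set (word S)) : set (word S) := rclass h L [::].

Definition unit_separated (S : finType) (M : monoidType) (h : word S -> M)
    (L : set (word S)) : Prop :=
  unit_class h L = [set [::]].

Definition live (S : finType) (L X : set (word S)) : Prop :=
  forall x, X x -> contexts L x !=set0.

Definition setcat (S : finType) (X Y : set (word S)) : set (word S) :=
  [set x ++ y | x in X & y in Y].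

(* On relative classes this is the class of xy, for any x in X and y in Y. *)
Definition star (S : finType) (M : monoidType) (h : word S -> M)
    (L X Y : set (word S)) : set (word S) :=
  [set z | exists x y, [/\ X x, Y y & rclass h L (x ++ y) z]].

Definition is_prime (S : finType) (M : monoidType) (h : word S -> M)
    (L P : set (word S)) : Prop :=
  [/\ is_rclass h L P, live L P, P <> unit_class h L &
    forall X Y, is_rclass h L X -> is_rclass h L Y -> P = setcat X Y ->
      X = unit_class h L \/ Y = unit_class h L].

Definition rprime (S : finType) (M : monoidType) (h : word S -> M)
    (L : set (word S)) : Type := {P : set (word S) | is_prime h L P}.

Definition concat (S : finType) (M : monoidType) (h : word S -> M)
    (L : set (word S)) (alpha : seq (rprime h L)) : set (word S) :=
  foldr (fun P X => setcat (sval P) X) [set [::]] alpha.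

Definition eval (S : finType) (M : monoidType) (h : word S -> M)
    (L : set (word S)) (alpha : seq (rprime h L)) : set (word S) :=
  foldr (fun P X => star h L (sval P) X) (unit_class h L) alpha.

Definition correct (S : finType) (M : monoidType) (h : word S -> M)
    (L : set (word S)) (P : rprime h L) (alpha : seq (rprime h L)) : Prop :=
  2 <= size alpha /\ eval alpha = sval P.

Definition Val (S : finType) (M : monoidType) (h : word S -> M)
    (L : set (word S)) (P : rprime h L) : set (seq (rprime h L)) :=
  [set alpha | correct P alpha /\
    forall l beta r, alpha = l ++ beta ++ r ->
      2 <= size beta -> size beta < size alpha -> ~ is_prime h L (eval beta)].

Definition FSRP (S : finType) (M : monoidType) (h : word S -> M)
    (L : set (word S)) : Prop :=
  finite_set [set P | is_prime h L P] /\
  forall P : rprime h L, regular (Val P).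

Definition accepting (S : finType) (L X : set (word S)) : Prop := X `<=` L.

Definition residuals (S : finType) (M : monoidType) (h : word S -> M)
    (L : set (word S)) : set (set (seq (rprime h L))) :=
  [set R | exists P u, R = lquot u (Val P) /\ R !=set0].

Definition start_factorizations (S : finType) (M : monoidType)
    (h : word S -> M) (L : set (word S)) : set (seq (rprime h L)) :=
  [set alpha | (alpha <> [::] /\
      exists X, [/\ is_rclass h L X, accepting L X, X <> unit_class h L &
                 concat alpha = X])
    \/ (alpha = [::] /\ L [::])].

Arguments residuals {S M} h L.
Arguments start_factorizations {S M} h L.

Definition letter_le (S : finType) : rel S :=
  fun a b => enum_rank a <= enum_rank b.

Definition word_le (S : finType) : rel (word S) := shortlex (@letter_le S).

Definition name (S : finType) (M : monoidType) (h : word S -> M)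
    (L : set (word S)) (P : rprime h L) : word S :=
  shortlex_least (@letter_le S) (sval P).

Definition prime_names (S : finType) (M : monoidType) (h : word S -> M)
    (L : set (word S)) : seq (word S) :=
  sort (@word_le S) (finmap.enum_fset (fset_set (range (@name S M h L)))).

Definition residual_code (S : finType) (M : monoidType) (h : word S -> M)
    (L : set (word S)) (R : set (seq (rprime h L))) : dfa :=
  min_dfa (@word_le S) (prime_names h L)
    [set map (@name S M h L) alpha | alpha in R].

(* Presentations as finite objects: primes are words (their names), residual
   languages are automata over the alphabet pr_primes, and the sets and the
   (graph of the) partial function of the presentation are canonical listings. *)
Record presentation (S : finType) := Presentation {
  pr_primes : seq (word S);
  pr_lex : seq (word S * S);
  pr_start : seq (seq (word S));
  pr_states : seq dfa;
  pr_trans : seq (dfa * word S * dfa);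
  pr_final : seq dfa }.

Definition presentation_tuple (S : finType) (G : presentation S) :=
  (pr_primes G, pr_lex G, pr_start G, pr_states G, pr_trans G, pr_final G).
Definition tuple_presentation (S : finType)
    (t : seq (word S) * seq (word S * S) * seq (seq (word S)) * seq dfa *
         seq (dfa * word S * dfa) * seq dfa) :=
  let: (p, l, s, q, d, f) := t in Presentation p l s q d f.
Lemma presentation_tupleK (S : finType) :
  cancel (@presentation_tuple S) (@tuple_presentation S).
Proof. by case. Qed.
HB.instance Definition _ (S : finType) :=
  Countable.copy (presentation S) (can_type (@presentation_tupleK S)).

(* The empty sequence in [pr_start] is the empty start alternative. *)
Definition canonical_presentation (S : finType) (M : monoidType)
    (h : word S -> M) (L : set (word S)) : presentation S :=
  let nm := @name S M h L in
  let code := @residual_code S M h L in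
  {| pr_primes := prime_names h L;
     pr_lex := listing [set x | exists P a, sval P [:: a] /\ x = (nm P, a)];
     pr_start := listing [set map nm alpha | alpha in start_factorizations h L];
     pr_states := listing [set code R | R in residuals h L];
     pr_trans := listing [set x | exists R A,
       [/\ residuals h L R, lquot [:: A] R !=set0
         & x = (code R, nm A, code (lquot [:: A] R))]];
     pr_final := listing [set code R | R in [set R | residuals h L R /\ R [::]]]
  |}.

(* Nonterminals: the start symbol, the primes (by name), and one symbol for
   each residual language (by its automaton). *)
Definition nonterm (S : finType) : countType := option (word S + dfa).
Definition nt_start (S : finType) : nonterm S := None.
Definition nt_prime (S : finType) (P : word S) : nonterm S := Some (inl P).
Definition nt_state (S : finType) (R : dfa) : nonterm S := Some (inr R).

Definition canonical_rules (S : finType) (M : monoidType) (h : word S -> M)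
    (L : set (word S)) : set (nonterm S * seq (nonterm S + S)) :=
  let prime P := nt_prime (@name S M h L P) in
  let state R := nt_state S (@residual_code S M h L R) in
  [set x | exists R A, [/\ residuals h L R, lquot [:: A] R !=set0
    & x = (state R, [:: inl (prime A); inl (state (lquot [:: A] R))])]] `|`
  [set x | exists R A, [/\ residuals h L R, lquot [:: A] R [::]
    & x = (state R, [:: inl (prime A)])]] `|`
  [set x | exists P, Val P !=set0 /\ x = (prime P, [:: inl (state (Val P))])] `|`
  [set x | exists P a, sval P [:: a] /\ x = (prime P, [:: inr a])] `|`
  [set x | exists alpha, start_factorizations h L alpha /\
    x = (nt_start S, [seq inl (prime P) | P <- alpha])].

Definition canonical_cfg (S : finType) (M : monoidType) (h : word S -> M)
    (L : set (word S)) : cfg (nonterm S) S :=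
  CFG (nt_start S) (listing (canonical_rules h L)).

Definition positive_text (S : finType) (L : set (word S))
    (T : nat -> word S) : Prop :=
  range T = L.

Definition weakly_bc (S : finType) (W : seq (word S) -> cfg nat S)
    (L : set (word S)) : Prop :=
  forall T, positive_text L T ->
    exists N, forall n, N <= n -> cfg_lang (W (mkseq T n)) = L.

Definition gold_identifies (S : finType) (H : Type) (A : seq (word S) -> H)
    (L : set (word S)) (can : H) : Prop :=
  forall T, positive_text L T ->
    exists N, forall n, N <= n -> A (mkseq T n) = can.

(* Main.v *)
Require Import Defs.
From mathcomp Require Import all_boot all_order all_classical.
From mathcomp Require Import zify.

(* Being the canonical presentation of L(G) is a Sigma_2 property of the
   presentation, for grammars G of languages in the class: in the presence of a
   context of x, substitutability makes the relative congruence of x and y a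
   single membership test; a live class is composite iff one of the finitely
   many splittings of a given member extends to all the members; and the
   automata of the residual languages, being regular by FSRP, can be guessed
   and then verified by universally quantified tests.  Membership in L(G) is
   decidable, so a learner can search for the first candidate (grammar,
   presentation, witness) not yet refuted, where a grammar is refuted by a word
   on which it disagrees with the current hypothesis of the weak learner.  This
   evidence depends on the language of the hypothesis only, so the search
   converges although the hypotheses need not stabilize. *)

Local Open Scope classical_set_scope.
Set Implicit Arguments.
Unset Strict Implicit.
Unset Printing Implicit Defensive.

(** * Recursive functions on codes *)

(** The notions of the statement quantify over infinite objects: context sets, classes, sets of
    prime sequences. Each is replaced by finite data whose correctness can be tested. Only this
    verification has to be effective: the existence of correct data for a given language is shown
    classically, with choice, and the alphabet, the finite monoid and the values of h on letters are
    hard-wired in finite tables.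

    One bound is not visible in the definitions. The exact factorizations of accepting classes must
    be listed completely, although exactness is itself a universal property. Words of L with equal
    images under h share the empty context, so there are at most |M| accepting classes; and unit
    separation makes every prime factor consume a letter, so a factorization is no longer than any
    word of its class. Hence finitely many sequences come into question, and the status of each of
    them can be guessed.

    The coding by [pickle] is arithmetical, so recursive functions have to be developed as far as
    2^x(2m+1) and its inverses before data types can be handled abstractly. *)

Lemma rec_ext k (f g : k.-tuple nat -> nat) : f =1 g -> recursive f -> recursive g.
Proof. by move=> /funext ->. Qed.

Section NatLevel.
Variable k : nat.
Implicit Types f g : k.-tuple nat -> nat.

Lemma rec_app1 (o : nat -> nat) f :
  recursive (fun v : 1.-tuple nat => o (thead v)) -> recursive f ->
  recursive (fun v => o (f v)).
Proof.
move=> ro rf; apply: rec_ext (rec_comp ro (fun=> rf)) => v.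
by rewrite /thead tnth_mktuple.
Qed.

Lemma rec_app2 (o : nat -> nat -> nat) f g :
  recursive (fun v : 2.-tuple nat => o (tnth v ord0) (tnth v ord_max)) ->
  recursive f -> recursive g -> recursive (fun v => o (f v) (g v)).
Proof.
move=> ro rf rg.
pose G (i : 'I_2) := if i == ord0 then f else g.
have rG i : recursive (G i) by rewrite /G; case: ifP.
by apply: rec_ext (rec_comp ro rG) => v; rewrite !tnth_mktuple.
Qed.

Lemma rec_cst (n : nat) : recursive (fun _ : k.-tuple nat => n).
Proof.
elim: n => [|n IHn].
  (* Composition with the empty family of functions raises the arity of the nullary zero to k. *)
  have zero := rec_comp rec_zero (fun i : 'I_0 => match i with Ordinal _ l =>
    False_rect _ (notF l) end : recursive ((fun _ : 'I_0 => fun _ : k.-tuple nat =>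
      0) i)).
  exact: zero.
by apply: (rec_app1 (o := succn)) IHn; exact: rec_succ.
Qed.
End NatLevel.

Lemma thead_cons n (x : nat) (v : n.-tuple nat) : thead [tuple of x :: v] = x.
Proof. by rewrite theadE. Qed.

(** [rec_prim] recurses on the first entry of its argument; composing it with the map from v to
    [n v :: v] lets the number of rounds be any recursive function of v. *)
Lemma rec_iteri k (n a : k.-tuple nat -> nat) (b : k.+2.-tuple nat -> nat) :
  recursive n -> recursive a -> recursive b ->
  recursive (fun v => iteri (n v) (fun i r => b [tuple of i :: r :: v]) (a v)).
Proof.
move=> rn ra rb.
pose G (i : 'I_k.+1) v := tnth [tuple of n v :: v] i.
have rG i : recursive (G i).
  case: (unliftP ord0 i) => [j|] ->.
    by apply: rec_ext (rec_proj j) => v; rewrite /G tnthS.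
  by apply: rec_ext rn => v; rewrite /G.
apply: rec_ext (rec_comp (rec_prim ra rb) rG) => v.
have -> : [tuple G i v | i < k.+1] = [tuple of n v :: v].
  by apply: eq_from_tnth => i; rewrite tnth_mktuple.
rewrite thead_cons.
have eb : [tuple of behead [tuple of n v :: v]] = v by exact: val_inj.
congr (iteri _ _ _); last by rewrite eb.
by apply/funext => i; apply/funext => r; congr b; exact: val_inj.
Qed.

Lemma rec_fst : recursive (fun v : 2.-tuple nat => tnth v ord0).
Proof. exact: rec_proj. Qed.
Lemma rec_snd : recursive (fun v : 2.-tuple nat => tnth v ord_max).
Proof. exact: rec_proj. Qed.

Lemma rec_proj4 i (lt_i4 : i < 4) :
  recursive (fun v : 4.-tuple nat => nth 0 v i).
Proof.
by apply: rec_ext (rec_proj (Ordinal lt_i4)) => v; rewrite (tnth_nth 0).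
Qed.

Lemma rec_binary (o : nat -> nat -> nat) (a : nat -> nat) (b : nat -> nat -> nat) :
  (forall x y, o x y = iteri y (fun _ r => b x r) (a x)) ->
  recursive (fun v : 1.-tuple nat => a (thead v)) ->
  recursive (fun v : 2.-tuple nat => b (tnth v ord0) (tnth v ord_max)) ->
  recursive (fun v : 2.-tuple nat => o (tnth v ord0) (tnth v ord_max)).
Proof.
move=> oE ra rb.
have rb' := rec_app2 rb (rec_proj4 (i := 2) isT) (rec_proj4 (i := 1) isT).
apply: rec_ext (rec_iteri rec_snd (rec_app1 ra rec_fst) rb') => v.
rewrite oE; congr (iteri _ _ _); apply/funext => i; apply/funext => r.
by case/tupleP: v => x v.
Qed.

Lemma rec_add : recursive (fun v : 2.-tuple nat => tnth v ord0 + tnth v ord_max).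
Proof.
apply: (@rec_binary addn id (fun _ r => r.+1)).
- by move=> x; elim=> [|y IHy]; rewrite ?addn0 //= addnS IHy.
- exact: (rec_proj ord0).
- by apply: (rec_app1 (o := succn)); [exact: rec_succ | exact: rec_snd].
Qed.

Lemma rec_mul : recursive (fun v : 2.-tuple nat => tnth v ord0 * tnth v ord_max).
Proof.
apply: (@rec_binary muln (fun=> 0) addn).
- by move=> x; elim=> [|y IHy]; rewrite ?muln0 //= mulnS IHy.
- exact: rec_cst.
- exact: rec_add.
Qed.

Lemma rec_exp : recursive (fun v : 2.-tuple nat => tnth v ord0 ^ tnth v ord_max).
Proof.
apply: (@rec_binary expn (fun=> 1) muln).
- by move=> x; elim=> [|y IHy]; rewrite ?expn0 //= expnS IHy.
- exact: rec_cst.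
- exact: rec_mul.
Qed.

Lemma rec_pred : recursive (fun v : 1.-tuple nat => (thead v).-1).
Proof.
have r := rec_iteri (k := 1) (rec_proj ord0) (rec_cst 1 0)
  (b := fun v => tnth v ord0) (rec_proj ord0).
by apply: rec_ext r => v; rewrite /thead; case: (tnth v ord0).
Qed.

Lemma rec_sub : recursive (fun v : 2.-tuple nat => tnth v ord0 - tnth v ord_max).
Proof.
apply: (@rec_binary subn id (fun _ r => r.-1)).
- by move=> x; elim=> [|y IHy]; rewrite ?subn0 //= subnS IHy.
- exact: (rec_proj ord0).
- by apply: (rec_app1 (o := predn)); [exact: rec_pred | exact: rec_snd].
Qed.

(** The absolute difference, an arithmetical equality test in the form required by minimization,
    which looks for zeros. *)
Definition dist (x y : nat) := (x - y) + (y - x).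

Lemma dist_eq0 x y : (dist x y == 0) = (x == y).
Proof. by rewrite /dist addn_eq0 !subn_eq0 -eqn_leq. Qed.

Lemma rec_dist : recursive (fun v : 2.-tuple nat =>
  dist (tnth v ord0) (tnth v ord_max)).
Proof.
apply: rec_app2 rec_add _ _; first exact: rec_sub.
exact: (rec_app2 rec_sub rec_snd rec_fst).
Qed.

(** The cons operation of [CodeSeq.code]. The library codes sequences, pairs and options through it,
    so operations on data become arithmetic of this one function and its two inverses. *)
Definition ccons (x m : nat) := 2 ^ x * m.*2.+1.

Lemma rec_ccons : recursive (fun v : 2.-tuple nat =>
  ccons (tnth v ord0) (tnth v ord_max)).
Proof.
apply: rec_app2 rec_mul _ _.
  exact: (rec_app2 rec_exp (rec_cst _ 2) rec_fst).
apply: (rec_app1 (o := succn)); first exact: rec_succ.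
apply: rec_ext (rec_app2 rec_add rec_snd rec_snd) => v.
by rewrite addnn.
Qed.

Lemma ccons_gt x m : x < ccons x m /\ m < ccons x m.
Proof.
split; rewrite /ccons.
  by apply: (leq_trans (ltn_expl x (leqnn 2))); rewrite leq_pmulr.
by apply: (@leq_trans m.*2.+1);
  [rewrite ltnS -addnn leq_addr | rewrite leq_pmull ?expn_gt0].
Qed.

Definition chead (z : nat) := head 0 (CodeSeq.decode z).
Definition ctail (z : nat) := CodeSeq.code (behead (CodeSeq.decode z)).

Lemma chead_cons x m : chead (ccons x m) = x.
Proof.
have -> : ccons x m = CodeSeq.code
  (x :: CodeSeq.decode m) by rewrite /= CodeSeq.decodeK.
by rewrite /chead CodeSeq.codeK.
Qed.

Lemma ctail_cons x m : ctail (ccons x m) = m.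
Proof.
have -> : ccons x m = CodeSeq.code
  (x :: CodeSeq.decode m) by rewrite /= CodeSeq.decodeK.
by rewrite /ctail CodeSeq.codeK /= CodeSeq.decodeK.
Qed.

Lemma cconsE z : 0 < z -> z = ccons (chead z) (ctail z).
Proof.
rewrite -{1 2}[z]CodeSeq.decodeK /chead /ctail.
by case: (CodeSeq.decode z) => //= x s _.
Qed.

(** A product vanishes iff one of its factors does: this is bounded existential quantification for
    predicates expressed by zeros. *)
Lemma rec_prod k (n : k.-tuple nat -> nat) (b : k.+1.-tuple nat -> nat) :
  recursive n -> recursive b ->
  recursive (fun v => \prod_(i < n v) b [tuple of nat_of_ord i :: v]).
Proof.
move=> rn rb.
(* The argument of B is the counter, the product so far, and v; the call of b skips the second of
   them. *)
pose B (w : k.+2.-tuple nat) := tnth w (lift ord0 ord0) *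
   b [tuple (tnth w (if i == ord0 then ord0 else lift ord0 i)) | i < k.+1].
have rB : recursive B.
  apply: rec_app2 rec_mul _ _; first exact: rec_proj.
  exact: (rec_comp rb (fun i => rec_proj _)).
apply: rec_ext (rec_iteri rn (rec_cst _ 1) rB) => v.
elim: (n v) => [|i IHi]; first by rewrite big_ord0.
rewrite big_ord_recr /= IHi /B; congr (_ * b _).
apply: eq_from_tnth => j; rewrite tnth_mktuple.
case: (unliftP ord0 j) => [j'|] -> //=.
by rewrite !tnthS.
Qed.

(** The head of z is the y for which z = [ccons y i] with some i < z. Minimization must find a zero
    for every argument; the additional factor z in F provides the zero 0 when z is 0, the code of
    the empty sequence. *)
Lemma rec_chead : recursive (fun v : 1.-tuple nat => chead (thead v)).
Proof.
pose F (w : 2.-tuple nat) :=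
  tnth w ord_max * \prod_(y < tnth w ord_max) dist (ccons (tnth w ord0) y)
    (tnth w ord_max).
have rF : recursive F.
  apply: rec_app2 rec_mul rec_snd _.
  pose b (w : 3.-tuple nat) := dist (ccons (nth 0 w 1) (nth 0 w 0)) (nth 0 w 2).
  have rp i : i < 3 -> recursive (fun w : 3.-tuple nat => nth 0 w i).
    move=> lt_i3.
    by apply: rec_ext (rec_proj (Ordinal lt_i3)) => v; rewrite (tnth_nth 0).
  have rb : recursive b.
    apply: rec_app2 rec_dist _ (rp 2 isT).
    exact: rec_app2 rec_ccons (rp 1 isT) (rp 0 isT).
  apply: rec_ext (rec_prod rec_snd rb) => w.
  by apply: eq_bigr => i _; rewrite /b /= -!(tnth_nth 0 w ord0) -(tnth_nth 0 w ord_max).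
apply: (rec_mu rF) => v.
set z := thead v.
have FE y : F [tuple of y :: v] = z * \prod_(i < z) dist (ccons y i) z.
  by rewrite /F !(tnth_nth 0) /= -(tnth_nth 0 v ord0).
have [z0|z0] := posnP z; first by rewrite FE z0 mul0n.
split.
  rewrite FE; apply/eqP; rewrite muln_eq0; apply/orP; right.
  have lt_tz : ctail z < z by rewrite {2}(cconsE z0);
    case: (ccons_gt (chead z) (ctail z)).
  rewrite (bigD1 (Ordinal lt_tz)) //= muln_eq0 dist_eq0 -cconsE //.
  by rewrite eqxx.
move=> y lt_y; rewrite FE => /eqP; rewrite muln_eq0 gtn_eqF //=.
have: 0 < \prod_(i < z) dist (ccons y i) z; last by rewrite lt0n => /negPf ->.
apply: prodn_gt0 => i; rewrite lt0n dist_eq0; apply/eqP => e.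
by move: lt_y; rewrite -e chead_cons ltnn.
Qed.

Lemma rec_ctail : recursive (fun v : 1.-tuple nat => ctail (thead v)).
Proof.
pose F (w : 2.-tuple nat) := tnth w ord_max * dist (ccons (chead (tnth w ord_max))
  (tnth w ord0)) (tnth w ord_max).
have rF : recursive F.
  apply: rec_app2 rec_mul rec_snd _.
  apply: rec_app2 rec_dist _ rec_snd.
  apply: rec_app2 rec_ccons _ rec_fst.
  exact: rec_app1 rec_chead rec_snd.
apply: (rec_mu rF) => v.
set z := thead v.
have FE y : F [tuple of y :: v] = z * dist (ccons (chead z) y) z.
  by rewrite /F !(tnth_nth 0) /= -(tnth_nth 0 v ord0).
have [z0|z0] := posnP z; first by rewrite FE z0 mul0n.
split; first by rewrite FE -cconsE //; apply/eqP; rewrite muln_eq0 dist_eq0 eqxx orbT.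
move=> y lt_y; rewrite FE => /eqP; rewrite muln_eq0 gtn_eqF //= dist_eq0 => /eqP e.
by move: lt_y; rewrite -e ctail_cons ltnn.
Qed.

(** * Computable functions *)

Lemma pickle_nat (n : nat) : pickle n = n. Proof. by []. Qed.
Lemma pickle_bool (b : bool) : pickle b = b. Proof. by []. Qed.
Lemma pickle_pair (A B : countType) (a : A) (b : B) :
  pickle (a, b) = ccons (pickle a) (ccons (pickle b) 0).
Proof. by []. Qed.
Lemma pickle_cons (A : countType) (a : A) (s : seq A) :
  pickle (a :: s) = ccons (pickle a) (pickle s).
Proof. by []. Qed.
Lemma pickle_some (A : countType) (a : A) : pickle (Some a) = ccons (pickle a) 0.
Proof. by []. Qed.
Lemma pickle_none (A : countType) : pickle (None : option A) = 0.
Proof. by []. Qed.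
Lemma pickle_inl (A B : countType) (a : A) :
  pickle (inl a : A + B) = pickle (Some a, None : option B).
Proof. by []. Qed.
Lemma pickle_inr (A B : countType) (b : B) :
  pickle (inr b : A + B) = pickle (None : option A, Some b).
Proof. by []. Qed.

Lemma pickle_inj (T : countType) : injective (@pickle T).
Proof. exact: pcan_inj pickleK. Qed.

Section Basic.
Variables (T : countType).

Lemma computable_id : computable (fun t : T => t).
Proof. by exists (fun v => thead v) => //; exact: rec_proj. Qed.

Lemma computable_cst (A : countType) (a : A) : computable (fun _ : T => a).
Proof. by exists (fun _ => pickle a) => //; exact: rec_cst. Qed.

Lemma computable_ext (A : countType)
  (f g : T -> A) : f =1 g -> computable f -> computable g.
Proof. by move=> /funext ->. Qed.

Lemma computable_comp (A B : countType) (g : A -> B) (f : T -> A) :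
  computable g -> computable f -> computable (fun t => g (f t)).
Proof.
move=> [g' rg gE] [f' rf fE].
exists (fun v => g' [tuple f' v]).
  apply: rec_ext (rec_comp rg (fun=> rf)) => v; congr g'.
  by apply: eq_from_tnth => i; rewrite !ord1 tnth_mktuple.
by move=> a; rewrite fE gE.
Qed.

(** True by conversion, since [pickle] on [nat] is the identity. It turns computability of f into
    arithmetic on codes. *)
Lemma computable_pickle (A : countType) (f : T -> A) :
  computable f <-> computable (fun t => pickle (f t)).
Proof. by []. Qed.

Lemma computable_nat1 (o : nat -> nat) (f : T -> nat) :
  recursive (fun v : 1.-tuple nat => o (thead v)) -> computable f ->
  computable (fun t => o (f t)).
Proof.
move=> ro; apply: computable_comp.
by exists (fun v => o (thead v)).
Qed.

Lemma computable_nat2 (o : nat -> nat -> nat) (f g : T -> nat) :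
  recursive (fun v : 2.-tuple nat => o (tnth v ord0) (tnth v ord_max)) ->
  computable f -> computable g -> computable (fun t => o (f t) (g t)).
Proof.
move=> ro [f' rf fE] [g' rg gE].
exists (fun v => o (f' v) (g' v)); first exact: rec_app2.
by move=> a; rewrite fE gE.
Qed.

Lemma computable_pair (A B : countType) (f : T -> A) (g : T -> B) :
  computable f -> computable g -> computable (fun t => (f t, g t)).
Proof.
move=> /computable_pickle cf /computable_pickle cg; apply/computable_pickle.
apply: (computable_nat2 rec_ccons) => //.
apply: (computable_nat2 rec_ccons) => //; exact: computable_cst.
Qed.

Lemma computable_fst (A B : countType) (f : T -> A * B) :
  computable f -> computable (fun t => (f t).1).
Proof.
move=> /computable_pickle /(computable_nat1 rec_chead) cf; apply/computable_pickle;
  apply: computable_ext cf => t /=.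
by case: (f t) => a b; rewrite pickle_pair chead_cons.
Qed.

Lemma computable_snd (A B : countType) (f : T -> A * B) :
  computable f -> computable (fun t => (f t).2).
Proof.
move=> /computable_pickle /(computable_nat1 rec_ctail)/(computable_nat1 rec_chead)
  cf; apply/computable_pickle; apply: computable_ext cf => t /=.
by case: (f t) => a b; rewrite pickle_pair ctail_cons chead_cons.
Qed.

Lemma computable_cons (A : countType) (f : T -> A) (g : T -> seq A) :
  computable f -> computable g -> computable (fun t => f t :: g t).
Proof.
move=> /computable_pickle cf /computable_pickle cg; apply/computable_pickle.
exact: (computable_nat2 rec_ccons).
Qed.

Lemma computable_some (A : countType) (f : T -> A) :
  computable f -> computable (fun t => Some (f t)).
Proof.
move=> /computable_pickle cf; apply/computable_pickle.
apply: (computable_nat2 rec_ccons) => //; exact: computable_cst.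
Qed.

Lemma computable_inl (A B : countType) (f : T -> A) :
  computable f -> computable (fun t => inl (f t) : A + B).
Proof.
move=> cf; have /computable_pickle c := computable_pair (computable_some cf)
  (computable_cst (None : option B)).
by apply/computable_pickle; apply: computable_ext c => t.
Qed.

Lemma computable_inr (A B : countType) (f : T -> B) :
  computable f -> computable (fun t => inr (f t) : A + B).
Proof.
move=> cf; have /computable_pickle c := computable_pair (computable_cst
  (None : option A)) (computable_some cf).
by apply/computable_pickle; apply: computable_ext c => t.
Qed.

Lemma computable_addn (f g : T -> nat) :
  computable f -> computable g -> computable (fun t => f t + g t).
Proof. exact: (computable_nat2 rec_add). Qed.
Lemma computable_subn (f g : T -> nat) :
  computable f -> computable g -> computable (fun t => f t - g t).
Proof. exact: (computable_nat2 rec_sub). Qed.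
Lemma computable_muln (f g : T -> nat) :
  computable f -> computable g -> computable (fun t => f t * g t).
Proof. exact: (computable_nat2 rec_mul). Qed.
Lemma computable_succn (f : T -> nat) : computable f -> computable (fun t => (f t).+1).
Proof. by apply: computable_nat1; exact: rec_succ. Qed.

Lemma computable_leq (f g : T -> nat) :
  computable f -> computable g -> computable (fun t => f t <= g t).
Proof.
move=> cf cg; apply/computable_pickle.
have := computable_subn (computable_cst 1) (computable_subn cf cg);
  apply: computable_ext => t.
by rewrite pickle_bool; case: leqP; lia.
Qed.

Lemma computable_eq (A : countType) (f g : T -> A) :
  computable f -> computable g -> computable (fun t => f t == g t).
Proof.
move=> /computable_pickle cf /computable_pickle cg; apply/computable_pickle.
have := computable_subn (computable_cst 1) (computable_nat2 rec_dist cf cg);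
  apply: computable_ext => t.
rewrite pickle_bool -(inj_eq (@pickle_inj A)) -dist_eq0.
by case: (dist _ _).
Qed.

Lemma computable_if (A : countType) (b : T -> bool) (f g : T -> A) :
  computable b -> computable f -> computable g ->
  computable (fun t => if b t then f t else g t).
Proof.
move=> /computable_pickle cb /computable_pickle cf /computable_pickle cg;
  apply/computable_pickle.
have := computable_addn (computable_muln cb cf) (computable_muln (computable_subn
  (computable_cst 1) cb) cg).
apply: computable_ext => t; rewrite pickle_bool; case: (b t) => /=; lia.
Qed.

Lemma computable_case_seq (A B : countType) (s : T -> seq A) (f : T -> B)
    (g : T * (A * seq A) -> B) :
  computable s -> computable f -> computable g ->
  computable (fun t => if s t is x :: s' then g (t, (x, s')) else f t).
Proof.
move=> /computable_pickle cs /computable_pickle cf [g' rg gE]; apply/computable_pickle.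
(* If [s t] is x :: s', this is the code of (t, (x, s')). If [s t] is empty, it need not be a
   meaningful argument; the realizer g' is total and the conditional discards its value. *)
pose u t := let p := pickle (s t) in
  ccons (pickle t) (ccons (ccons (chead p) (ccons (ctail p) 0)) 0).
have cu : computable u.
  apply: (computable_nat2 rec_ccons); first exact/computable_pickle/computable_id.
  apply: (computable_nat2 rec_ccons); last exact: computable_cst.
  apply: (computable_nat2 rec_ccons); first exact: (computable_nat1 rec_chead).
  apply: (computable_nat2 rec_ccons); last exact: computable_cst.
  exact: (computable_nat1 rec_ctail).
have cgu : computable (fun t => g' [tuple u t]).
  apply: (computable_comp (g := fun n : nat => g' [tuple n])) cu.
  by exists g'.
have := computable_if (computable_eq cs (computable_cst 0)) cf cgu.
apply: computable_ext => t; rewrite /u.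
case: (s t) => [|x s'] //; rewrite pickle_cons chead_cons ctail_cons.
case: (ccons_gt (pickle x) (pickle s')) => ? ?; case: eqP => [|_]; first lia.
by rewrite -gE.
Qed.
End Basic.
Arguments computable_id {T}.
Arguments computable_cst {T A} a.

Lemma computable_iter (T A : countType) (n : T -> nat) (a : T -> A) (f : T * A -> A) :
  computable n -> computable a -> computable f ->
  computable (fun t => iter (n t) (fun x => f (t, x)) (a t)).
Proof.
move=> [n' rn nE] [a' ra aE] [f' rf fE].
pose b (v : 3.-tuple nat) := f' [tuple ccons (tnth v ord_max) (ccons (tnth v
  (lift ord0 ord0)) 0)].
have rb : recursive b.
  pose o x := f' [tuple x].
  apply: (rec_app1 (o := o)).
    apply: rec_ext rf => v; rewrite /o; congr f'.
    by case/tupleP: v => x v; rewrite tuple0; apply: val_inj.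
  apply: (rec_app2 rec_ccons); first exact: rec_proj.
  by apply: (rec_app2 rec_ccons); [exact: rec_proj | exact: rec_cst].
exists (fun v => iteri (n' v) (fun i r => b [tuple of i :: r :: v]) (a' v)).
  exact: rec_iteri.
move=> t; rewrite nE pickle_nat.
elim: (n t) => [|m IHm] /=; first exact: aE.
by rewrite IHm /b -fE; congr f'; apply: val_inj.
Qed.

(** * Folds and list operations *)

Section Lists.
Variable T : countType.

(** A fold is the iteration of a step on the pair of accumulator and unread rest. The code of a list
    bounds its length, so it serves as the number of rounds; surplus rounds leave an empty rest
    unchanged. *)
Lemma computable_foldl (A B : countType) (s : T -> seq A) (a : T -> B)
    (g : T * (B * A) -> B) :
  computable s -> computable a -> computable g ->
  computable (fun t => foldl (fun y x => g (t, (y, x))) (a t) (s t)).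
Proof.
move=> cs ca cg.
pose step (p : T * (B * seq A)) :=
  if p.2.2 is x :: s' then (g (p.1, (p.2.1, x)), s') else p.2.
have cstep : computable step.
  apply: (computable_case_seq (s := fun p : T * (B * seq A) => p.2.2)
     (f := fun p => p.2) (g := fun q => (g (q.1.1, (q.1.2.1, q.2.1)), q.2.2))).
  - exact/computable_snd/computable_snd/computable_id.
  - exact/computable_snd/computable_id.
  - apply: computable_pair; last exact/computable_snd/computable_snd/computable_id.
    apply: (computable_comp cg); apply: computable_pair;
      first exact/computable_fst/computable_fst/computable_id.
    by apply: computable_pair; [exact/computable_fst/computable_snd/computable_fst/computable_id | exact/computable_fst/computable_snd/computable_id].
have := computable_fst (computable_iter (proj1 (computable_pickle s) cs)
  (computable_pair ca cs) cstep).
apply: computable_ext => t; move: (s t) (a t) => l y {cs ca}.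
have: size l <= pickle l.
  elim: l => //= x l IHl; rewrite pickle_cons.
  by case: (ccons_gt (pickle x) (pickle l)) => _; apply: leq_ltn_trans.
set F := fun _ => step _.
have F0 n z : iter n F (z, [::]) = (z, [::]) by elim: n => //= n ->.
elim: l y (pickle l) => [|x l IHl] y n; first by rewrite F0.
by case: n => // n le_ln; rewrite iterSr /= [LHS]IHl.
Qed.
End Lists.

Ltac eta_head := lazymatch goal with
  | |- @computable ?T ?A ?f => lazymatch f with
      | fun _ => _ => idtac
      | _ => change (@computable T A (fun t => f t)) end
  end.
Ltac is_if f := lazymatch type of f with forall _ : ?T, _ =>
  let _ := constr:(fun t : T => ltac:(let b := eval cbv beta in (f t) in
    lazymatch b with (if _ then _ else _) => exact tt end)) in idtac end.
Ltac comp_step := eta_head; first [ assumption | lazymatch goal with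
  | |- computable (fun _ => ?c) => exact: computable_cst
  | |- computable (fun t => t) => exact: computable_id
  | |- computable (fun t => (@?f t, @?g t)) => apply: computable_pair
  | |- computable (fun t => fst (@?f t)) => apply: computable_fst
  | |- computable (fun t => snd (@?f t)) => apply: computable_snd
  | |- computable (fun t => (@?f t) :: (@?g t)) => apply: computable_cons
  | |- computable (fun t => Some (@?f t)) => apply: computable_some
  | |- computable (fun t => inl (@?f t)) => apply: computable_inl
  | |- computable (fun t => inr (@?f t)) => apply: computable_inr
  | |- computable (fun t => (@?f t) + (@?g t)) => apply: computable_addn
  | |- computable (fun t => (@?f t) - (@?g t)) => apply: computable_subn
  | |- computable (fun t => (@?f t) * (@?g t)) => apply: computable_muln
  | |- computable (fun t => (@?f t).+1) => apply: computable_succn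
  | |- computable (fun t => (@?f t) <= (@?g t)) => apply: computable_leq
  | |- computable (fun t => (@?f t) == (@?g t)) => apply: computable_eq
  | |- computable ?f => is_if f; apply: computable_if
  end ].
Ltac comp := repeat (cbv beta; comp_step).

Lemma computable_rev (T A : countType) (s : T -> seq A) :
  computable s -> computable (fun t => rev (s t)).
Proof.
move=> cs.
apply: (computable_ext (f := fun t => foldl (fun (y : seq A) x => x :: y) [::] (s t))).
  move=> t; rewrite /rev; move: [::].
  by elim: (s t) => //= x l IHl a; rewrite IHl.
by apply: (computable_foldl (g := fun p : T * (seq A * A) => p.2.2 :: p.2.1)); comp.
Qed.

Lemma computable_foldr (T A B : countType) (s : T -> seq A) (a : T -> B)
    (g : T -> A -> B -> B) :
  computable s -> computable a ->
  computable (fun p : T * (A * B) => g p.1 p.2.1 p.2.2) ->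
  computable (fun t => foldr (g t) (a t) (s t)).
Proof.
move=> cs ca cg.
apply: (computable_ext (f := fun t => foldl (fun y x => g t x y) (a t) (rev (s t)))).
  by move=> t; rewrite foldl_rev.
apply: (computable_foldl (g := fun p : T * (B * A) => g p.1 p.2.2 p.2.1)) => //.
  exact: computable_rev.
by apply: (computable_comp (f := fun p : T * (B * A) => (p.1, (p.2.2, p.2.1))) cg);
  comp.
Qed.

Lemma computable_map (T A B : countType) (s : T -> seq A) (f : T -> A -> B) :
  computable s -> computable (fun p : T * A => f p.1 p.2) ->
  computable (fun t => [seq f t x | x <- s t]).
Proof.
move=> cs cf.
apply: (@computable_foldr _ _ _ _ _ (fun t x l => f t x :: l)); comp.
by apply: (computable_comp (f := fun p : T * (A * seq B) => (p.1, p.2.1)) cf); comp.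
Qed.

Lemma computable_cat (T A : countType) (s1 s2 : T -> seq A) :
  computable s1 -> computable s2 -> computable (fun t => s1 t ++ s2 t).
Proof.
move=> c1 c2; apply: (computable_ext (f := fun t => foldr cons (s2 t) (s1 t))).
  by move=> t; elim: (s1 t) => //= x l ->.
by apply: computable_foldr; comp.
Qed.

Lemma computable_rcons (T A : countType) (s : T -> seq A) (x : T -> A) :
  computable s -> computable x -> computable (fun t => rcons (s t) (x t)).
Proof.
move=> cs cx; apply: (computable_ext (f := fun t => s t ++ [:: x t])).
  by move=> t; rewrite cats1.
by apply: computable_cat; comp.
Qed.

Lemma computable_flatten (T A : countType) (s : T -> seq (seq A)) :
  computable s -> computable (fun t => flatten (s t)).
Proof.
move=> cs; apply: (computable_ext (f := fun t => foldr cat [::] (s t))) => //.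
by apply: (computable_foldr (g := fun _ => cat) cs); comp; apply: computable_cat; comp.
Qed.

Lemma computable_size (T A : countType) (s : T -> seq A) :
  computable s -> computable (fun t => size (s t)).
Proof.
move=> cs; apply: (computable_ext (f := fun t => foldr (fun=> succn) 0 (s t))) => [t|].
  by elim: (s t) => //= x l ->.
by apply: computable_foldr; comp.
Qed.

Lemma computable_has (T A : countType) (s : T -> seq A) (p : T -> A -> bool) :
  computable s -> computable (fun q : T * A => p q.1 q.2) ->
  computable (fun t => has (p t) (s t)).
Proof.
move=> cs cp.
apply: (computable_ext (f := fun t => foldr (fun x b =>
  if p t x then true else b) false (s t))) => [t|].
  by elim: (s t) => //= x l ->; case: (p t x).
apply: (computable_foldr (g := fun t x b => if p t x then true else b)); comp.
by apply: (computable_comp (f := fun q : T * (A * bool) => (q.1, q.2.1)) cp); comp.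
Qed.

Lemma computable_mem (T A : countType) (s : T -> seq A) (x : T -> A) :
  computable x -> computable s -> computable (fun t => x t \in s t).
Proof.
move=> cx cs; apply: (computable_ext (f := fun t => has (eq_op^~ (x t)) (s t))) => [t|].
  by rewrite has_pred1.
apply: computable_has; comp.
by apply: (computable_comp cx); comp.
Qed.

Lemma computable_filter (T A : countType) (s : T -> seq A) (p : T -> A -> bool) :
  computable s -> computable (fun q : T * A => p q.1 q.2) ->
  computable (fun t => [seq x <- s t | p t x]).
Proof.
move=> cs cp.
apply: (computable_ext (f := fun t => foldr (fun x l =>
  if p t x then x :: l else l) [::] (s t))) => //.
apply: (computable_foldr (g := fun t x l => if p t x then x :: l else l)); comp.
by apply: (computable_comp (f := fun q : T * (A * seq A) => (q.1, q.2.1)) cp); comp.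
Qed.

Lemma computable_index (T A : countType) (s : T -> seq A) (x : T -> A) :
  computable x -> computable s -> computable (fun t => index (x t) (s t)).
Proof.
move=> cx cs.
apply: (computable_ext (f := fun t => foldr (fun y n =>
  if y == x t then 0 else n.+1) 0 (s t))) => [t|].
  by elim: (s t) => //= y l ->.
apply: (computable_foldr (g := fun t y n => if y == x t then 0 else n.+1)); comp.
by apply: (computable_comp cx); comp.
Qed.

Lemma computable_behead (T A : countType) (s : T -> seq A) :
  computable s -> computable (fun t => behead (s t)).
Proof.
move=> cs.
apply: (computable_ext (f := fun t => if s t is x :: s' then s' else [::])) => [t|].
  by case: (s t).
by apply: (@computable_case_seq _ _ _ s (fun=> [::]) (fun q => q.2.2)); comp.
Qed.

Lemma computable_drop (T A : countType) (n : T -> nat) (s : T -> seq A) :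
  computable n -> computable s -> computable (fun t => drop (n t) (s t)).
Proof.
move=> cn cs; apply: (computable_ext (f := fun t => iter (n t) behead (s t))) => [t|].
  elim: (n t) => [|m IHm]; first by rewrite drop0.
  by rewrite iterS IHm /= -!drop1 drop_drop.
by apply: (computable_iter (f := fun p => behead p.2));
  last apply: computable_behead; comp.
Qed.

Lemma computable_take (T A : countType) (n : T -> nat) (s : T -> seq A) :
  computable n -> computable s -> computable (fun t => take (n t) (s t)).
Proof.
move=> cn cs; apply: (computable_ext (f := fun t =>
  rev (drop (size (s t) - n t) (rev (s t))))) => [t|].
  by rewrite -[RHS](congr1 (take (n t)) (revK (s t))) take_rev size_rev.
by apply/computable_rev/computable_drop; [apply: computable_subn; last done;
  exact: computable_size | exact: computable_rev].
Qed.

Lemma computable_iota (T : countType) (n : T -> nat) : computable n -> computable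
  (fun t => iota 0 (n t)).
Proof.
move=> cn.
apply: (computable_ext (f := fun t => iter (n t) (fun s =>
  rcons s (size s)) [::])) => [t|].
  elim: (n t) => // m IHm.
  by rewrite iterS IHm size_iota -[in RHS]addn1 iotaD cats1.
apply: (computable_iter (f := fun p => rcons p.2 (size p.2))); comp.
by apply: computable_rcons; last apply: computable_size; comp.
Qed.

(** Quantifiers over decompositions s = x ++ y range over this finite list, which keeps them
    decidable. *)
Definition splits (A : Type) (s : seq A) : seq (seq A * seq A) :=
  [seq (take i s, drop i s) | i <- iota 0 (size s).+1].

Lemma mem_splits (A : eqType) (s x y : seq A) :
  ((x, y) \in splits s) = (s == x ++ y).
Proof.
apply/mapP/eqP => [[i _ [-> ->]]|->]; first by rewrite cat_take_drop.
exists (size x); first by rewrite mem_iota add0n /= ltnS size_cat leq_addr.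
by rewrite take_size_cat // drop_size_cat.
Qed.

Lemma computable_splits (T A : countType) (s : T -> seq A) :
  computable s -> computable (fun t => splits (s t)).
Proof.
move=> cs; apply: (computable_map (f := fun t i => (take i (s t), drop i (s t)))).
  exact/computable_iota/computable_succn/computable_size.
have cs' : computable (fun p : T * nat => s p.1) by apply: (computable_comp cs); comp.
by apply: computable_pair; [apply: computable_take|apply: computable_drop]; comp.
Qed.

Lemma computable_case_option (T A B : countType) (s : T -> option A) (f : T -> B)
    (g : T -> A -> B) :
  computable s -> computable f -> computable (fun p : T * A => g p.1 p.2) ->
  computable (fun t => if s t is Some x then g t x else f t).
Proof.
move=> cs cf cg.
have cs' : computable (fun t => if s t is Some x then [:: x] else [::] : seq A).
  by apply/computable_pickle; have /computable_pickle := cs;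
    apply: computable_ext => t; case: (s t).
apply: (computable_ext _ (@computable_case_seq _ _ _ _ f (fun q =>
  g q.1 q.2.1) cs' cf _)) => [t|].
  by case: (s t).
by apply: (computable_comp (f := fun q : T * (A * seq A) => (q.1, q.2.1)) cg); comp.
Qed.

Lemma computable_case_sum (T A B C : countType) (s : T -> A + B)
    (f : T -> A -> C) (g : T -> B -> C) :
  computable s -> computable (fun p : T * A => f p.1 p.2) ->
  computable (fun p : T * B => g p.1 p.2) ->
  computable (fun t => match s t with inl x => f t x | inr y => g t y end).
Proof.
move=> cs cf cg; apply/computable_pickle.
have cs' : computable (fun t => opair_of_sum (s t)).
  by apply/computable_pickle; have /computable_pickle := cs;
    apply: computable_ext => t; case: (s t).
have cg' := computable_case_option (g := fun t y =>
  pickle (g t y)) (computable_snd cs') (computable_cst 0) (proj1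
    (computable_pickle _) cg).
have := computable_case_option (g := fun t x =>
  pickle (f t x)) (computable_fst cs') cg' (proj1 (computable_pickle _) cf).
by apply: computable_ext => t; case: (s t).
Qed.

(** Finitely many equality tests. Through this lemma the nonuniform data enter: the functions on the
    alphabet and the multiplication by the images of letters in the monoid. *)
Lemma computable_table (T A : countType) (f : T -> A) (l : seq T) (a : A) :
  (forall t, t \notin l -> f t = a) -> computable f.
Proof.
elim: l f => [|x l IHl] f fE.
  by apply: computable_ext (computable_cst a) => t; rewrite fE.
pose f' t := if t \in l then f t else a.
have /IHl cf' : forall t, t \notin l -> f' t = a by move=> t /negPf; rewrite /f' => ->.
apply: (computable_ext (f := fun t => if t == x then f x else f' t)); last by comp.
move=> t; case: eqP => [-> //|/eqP/negPf tx].
by rewrite /f'; case: ifP => // tl; rewrite fE // inE tx tl.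
Qed.

Lemma computable_fin (S : finType) (A : countType) (f : S -> A) : computable f.
Proof.
apply/computable_pickle; apply: (@computable_table _ _ _ (enum S) 0) => s.
by rewrite mem_enum.
Qed.

(** The boolean is the classical truth value of P; what is asked is that it be computed by a
    recursive function. Predicates can thus be stated in logical form and transformed by
    equivalences. *)
Definition dec (T : countType) (P : T -> Prop) := computable (fun t => `[< P t >]).

(** Decidability of the set of codes. An unbounded search runs through all numbers and must
    recognize those that code an element. *)
Definition effective (T : countType) := dec (fun n : nat => exists t : T, pickle t = n).

Lemma dec_ext (T : countType) (P Q : T -> Prop) :
  (forall t, P t <-> Q t) -> dec P -> dec Q.
Proof. by move=> PQ; apply: computable_ext => t; apply: asbool_equiv_eq. Qed.

Lemma dec_bool (T : countType) (b : T -> bool) : computable b -> dec (fun t => b t).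
Proof. by apply: computable_ext => t; rewrite asboolb. Qed.

Lemma dec_comp (T A : countType) (P : A -> Prop) (f : T -> A) :
  dec P -> computable f -> dec (fun t => P (f t)).
Proof. exact: (computable_comp (g := fun a => `[< P a >])). Qed.

Lemma dec_cst (T : countType) (P : Prop) : dec (fun _ : T => P).
Proof. exact: computable_cst. Qed.

Lemma dec_not (T : countType) (P : T -> Prop) : dec P -> dec (fun t => ~ P t).
Proof.
move=> cP; have := computable_if cP (computable_cst false) (computable_cst true).
by apply: computable_ext => t; rewrite asbool_neg; case: asbool.
Qed.

Lemma dec_and (T : countType) (P Q : T -> Prop) : dec P -> dec Q -> dec (fun t =>
  P t /\ Q t).
Proof.
move=> cP cQ; have := computable_if cP cQ (computable_cst false).
by apply: computable_ext => t; rewrite asbool_and; case: asbool.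
Qed.

Lemma dec_or (T : countType) (P Q : T -> Prop) : dec P -> dec Q -> dec (fun t =>
  P t \/ Q t).
Proof.
move=> cP cQ; have := computable_if cP (computable_cst true) cQ.
by apply: computable_ext => t; rewrite asbool_or; case: asbool.
Qed.

Lemma dec_imp (T : countType) (P Q : T -> Prop) : dec P -> dec Q -> dec (fun t =>
  P t -> Q t).
Proof.
move=> cP cQ; apply: dec_ext (dec_or (dec_not cP) cQ) => t.
by split=> [[]//|PQ]; have [/PQ|] := pselect (P t); [right|left].
Qed.

Lemma dec_iff (T : countType) (P Q : T -> Prop) : dec P -> dec Q -> dec (fun t =>
  P t <-> Q t).
Proof. by move=> cP cQ; apply: dec_and; apply: dec_imp. Qed.

Lemma dec_eq (T A : countType) (f g : T -> A) :
  computable f -> computable g -> dec (fun t => f t = g t).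
Proof.
move=> cf cg; apply: dec_ext (dec_bool (computable_eq cf cg)) => t.
by split=> /eqP.
Qed.

Lemma dec_exin (T A : countType) (s : T -> seq A) (P : T -> A -> Prop) :
  computable s -> dec (fun p : T * A => P p.1 p.2) ->
  dec (fun t => exists x, x \in s t /\ P t x).
Proof.
move=> cs dP.
apply: dec_ext (dec_bool (computable_has (p := fun t x => `[< P t x >]) cs dP)) => t.
split=> [/hasP[x sx /asboolP px]|[x [sx px]]]; first by exists x.
by apply/hasP; exists x => //; apply/asboolP.
Qed.

Lemma dec_allin (T A : countType) (s : T -> seq A) (P : T -> A -> Prop) :
  computable s -> dec (fun p : T * A => P p.1 p.2) ->
  dec (fun t => forall x, x \in s t -> P t x).
Proof.
move=> cs dP.
apply: dec_ext (dec_not (dec_exin (P := fun t x => ~ P t x) cs (dec_not dP))) => t.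
split=> [nex x sx|all [x [/all]]]//.
by apply: contrapT => px; apply: nex; exists x.
Qed.

Lemma dec_ex_split (T A : countType) (s : T -> seq A)
  (P : T -> seq A -> seq A -> Prop) :
  computable s -> dec (fun p : T * (seq A * seq A) => P p.1 p.2.1 p.2.2) ->
  dec (fun t => exists x y, s t = x ++ y /\ P t x y).
Proof.
move=> cs dP.
apply: dec_ext (dec_exin (P := fun t x => P t x.1 x.2) (computable_splits cs) dP) => t.
split=> [[[x y]]|[x [y [e p]]]]; rewrite ?mem_splits.
  by move=> [/eqP ? ?]; exists x, y.
by exists (x, y); rewrite mem_splits e.
Qed.

Lemma dec_all_split (T A : countType) (s : T -> seq A)
  (P : T -> seq A -> seq A -> Prop) :
  computable s -> dec (fun p : T * (seq A * seq A) => P p.1 p.2.1 p.2.2) ->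
  dec (fun t => forall x y, s t = x ++ y -> P t x y).
Proof.
move=> cs dP.
apply: dec_ext (dec_allin (P := fun t x => P t x.1 x.2) (computable_splits cs) dP) => t.
split=> [all x y e|all [x y]]; first by apply: (all (x, y)); rewrite mem_splits e.
by rewrite mem_splits => /eqP; apply: all.
Qed.
Arguments dec_cst {T} P.

Lemma effective_nat : effective nat.
Proof. by rewrite /effective; apply: (dec_ext _ (dec_cst True)) => n; split=> // _;
  exists n. Qed.

Lemma effective_bool : effective bool.
Proof.
rewrite /effective; apply: dec_ext (dec_bool (computable_leq computable_id
  (computable_cst 1))) => n.
split=> [|[[] <-]]//; case: n => [|[|]]// _; [by exists false|by exists true].
Qed.

Lemma effective_fin (S : finType) : effective S.
Proof.
rewrite /effective; apply: dec_ext (dec_bool (computable_mem computable_id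
  (computable_cst [seq pickle x | x <- enum S]))) => n.
split=> [/mapP[x _ ->]|[x <-]]; first by exists x.
by apply: map_f; rewrite mem_enum.
Qed.

(** Realized by the identity: a number is already the code of the sequence of numbers that it
    decodes to. *)
Lemma computable_unseq : computable CodeSeq.decode.
Proof.
apply/computable_pickle; apply: computable_ext (@computable_id nat) => n.
by rewrite -[LHS]CodeSeq.decodeK; congr CodeSeq.code; rewrite map_id.
Qed.

Lemma pickle_seqE (A : countType) (s : seq A) :
  pickle s = CodeSeq.code (map pickle s).
Proof. by []. Qed.

Lemma effective_seq (A : countType) : effective A -> effective (seq A).
Proof.
move=> eA.
have := dec_allin (P := fun _ m =>
  exists x : A, pickle x = m) computable_unseq (dec_comp eA
    (computable_snd computable_id)).
apply: dec_ext => n; split=> [all|[s <-]].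
  suff [s e] : exists s : seq A, map pickle s = CodeSeq.decode n.
    by exists s; rewrite pickle_seqE e CodeSeq.decodeK.
  elim: CodeSeq.decode all => [|m l IHl] all; first by exists [::].
  have [x <-] := all m (mem_head _ _).
  have [|s <-] := IHl; first by move=> y yl; apply: all; rewrite inE yl orbT.
  by exists (x :: s).
move=> m; rewrite pickle_seqE CodeSeq.codeK => /mapP[x _ ->]; by exists x.
Qed.

Lemma effective_pair (A B : countType) : effective A -> effective B -> effective
  (A * B)%type.
Proof.
move=> eA eB.
rewrite /effective; have ch := computable_nat1 rec_chead (@computable_id nat).
have ct := computable_nat1 rec_chead (computable_nat1 rec_ctail (@computable_id nat)).
have c2 := dec_eq computable_id (computable_nat2 rec_ccons ch
  (computable_nat2 rec_ccons ct (computable_cst 0))).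
apply: dec_ext (dec_and c2 (dec_and (dec_comp eA ch) (dec_comp eB ct))) => n /=.
split=> [[nE [[a aE] [b bE]]]|[[a b] <-]].
  by exists (a, b); rewrite pickle_pair aE bE.
rewrite pickle_pair chead_cons ctail_cons chead_cons; split=> //.
by split; [exists a|exists b].
Qed.

Lemma effective_option (A : countType) : effective A -> effective (option A).
Proof.
move=> eA.
rewrite /effective; have ch := computable_nat1 rec_chead (@computable_id nat).
have c2 := dec_eq computable_id (computable_nat2 rec_ccons ch (computable_cst 0)).
apply: dec_ext (dec_or (dec_eq computable_id (computable_cst 0)) (dec_and c2
  (dec_comp eA ch))) => n /=.
split=> [[->|[nE [a aE]]]|[[a|] <-]].
- by exists None.
- by exists (Some a); rewrite pickle_some aE.
- by right; rewrite pickle_some chead_cons; split=> //; exists a.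
- by left.
Qed.

(** An element of a sum is coded as a pair of options exactly one of which is present, and an option
    is present iff its code is nonzero. *)
Lemma effective_sum (A B : countType) : effective A -> effective B -> effective
  (A + B)%type.
Proof.
move=> eA eB.
have e := effective_pair (effective_option eA) (effective_option eB).
rewrite /effective; have ch := computable_nat1 rec_chead (@computable_id nat).
have ct := computable_nat1 rec_chead (computable_nat1 rec_ctail (@computable_id nat)).
have n0 f (cf : computable f) : dec (fun n : nat =>
  f n = 0 :> nat) := dec_eq cf (computable_cst 0).
have nz x : ccons x 0 <> 0 by case: (ccons_gt x 0); lia.
have := dec_and e (dec_or (dec_and (n0 _ ch) (dec_not (n0 _ ct))) (dec_and (n0 _ ct)
  (dec_not (n0 _ ch)))).
apply: dec_ext => n; split=> [[[[oa ob] <-]]|[[a|b] <-]].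
- rewrite pickle_pair ctail_cons !chead_cons.
  case: oa ob => [a|] [b|]; rewrite ?pickle_some ?pickle_none.
  + by move=> [[/nz]|[/nz]].
  + by move=> _; exists (inl a).
  + by move=> _; exists (inr b).
  + by move=> [[_ []]|[_ []]].
- split; first by exists (Some a, None).
  right; rewrite pickle_inl pickle_pair ctail_cons !chead_cons pickle_none.
  by rewrite pickle_some; split; last exact: nz.
- split; first by exists (None, Some b).
  left; rewrite pickle_inr pickle_pair ctail_cons !chead_cons pickle_none.
  by rewrite pickle_some; split; last exact: nz.
Qed.

(** * Unbounded search *)

Section Search.
Variable T : countType.
Hypothesis eT : effective T.

(** [rec_mu] demands a zero for every number, also for those that code no element of T. The factor
    i, the characteristic function of the codes, makes F vanish identically there. *)
Lemma computable_mu (D : T -> nat -> Prop) :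
  dec (fun p : T * nat => D p.1 p.2) -> (forall t, exists n, D t n) ->
  exists f : T -> nat, [/\ computable f, forall t, D t (f t)
    & forall t m, m < f t -> ~ D t m].
Proof.
move=> [d rd dE] exD; have [i ri iE] := eT.
pose F (v : 2.-tuple nat) := i [tuple tnth v ord_max] *
   (1 - d [tuple ccons (tnth v ord_max) (ccons (tnth v ord0) 0)]).
have rF : recursive F.
  have r1 (o : 1.-tuple nat -> nat) (u : 2.-tuple nat -> nat) :
      recursive o -> recursive u -> recursive (fun v => o [tuple u v]).
    move=> ro ru; apply: rec_ext (rec_comp ro (fun=> ru)) => v; congr o.
    by apply: eq_from_tnth => j; rewrite !ord1 tnth_mktuple.
  apply: (rec_app2 rec_mul); first exact: r1 ri rec_snd.
  apply: (rec_app2 rec_sub); first exact: rec_cst.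
  apply: r1 rd _; apply: (rec_app2 rec_ccons); first exact: rec_snd.
  by apply: (rec_app2 rec_ccons); [exact: rec_fst | exact: rec_cst].
have FE (y : nat) (v : 1.-tuple nat) : F [tuple of y :: v] =
    i v * (1 - d [tuple ccons (thead v) (ccons y 0)]).
  case/tupleP: v => x v; rewrite tuple0 /F !(tnth_nth 0) /= thead_cons.
  by congr (i _ * _); exact: val_inj.
have FP (y : nat) (t : T) : F [tuple y; pickle t] = 0 <-> D t y.
  have -> : [tuple y; pickle t] = [tuple of y :: [tuple pickle t]] by exact: val_inj.
  rewrite FE; have := dE (t, y); rewrite pickle_pair => -> /=.
  have -> : i [tuple pickle t] = 1.
    have := iE (pickle t); rewrite pickle_nat => ->.
    by have /asboolP -> : exists t' : T, pickle t' = pickle t by exists t.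
  by rewrite pickle_bool; case: asboolP.
have /choice[g gP] (v : 1.-tuple nat) : exists n, F [tuple of n :: v] = 0 /\
    forall y, y < n -> F [tuple of y :: v] <> 0.
  have exn : exists n, F [tuple of n :: v] == 0.
    have [[t vE]|nim] := pselect (exists t : T, pickle t = thead v).
      have [n /FP Dn] := exD t; exists n.
      have <- // : [tuple n; pickle t] = [tuple of n :: v]; last by rewrite Dn.
      by apply: val_inj; case/tupleP: v vE => m v; rewrite tuple0 => ->.
    exists 0; rewrite FE.
    have -> : v = [tuple thead v].
      by case/tupleP: v {nim} => m v; rewrite tuple0; exact: val_inj.
    by rewrite iE asboolF.
  exists (ex_minn exn); case: ex_minnP => n /eqP Fn min; split=> // y lt_yn /eqP /min.
  by rewrite leqNgt lt_yn.
exists (fun t => g [tuple pickle t]); split.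
- by exists g => //; exact: rec_mu rF gP.
- move=> t; apply/FP; have [gt _] := gP [tuple pickle t].
  by rewrite -[RHS]gt; congr F; exact: val_inj.
move=> t m lt_m; have [_ /(_ _ lt_m) ne] := gP [tuple pickle t].
by move/FP => e; apply: ne; rewrite -[RHS]e; congr F; exact: val_inj.
Qed.

(** The realizer r of R is run on every number n, coding something or not; the test for codes
    discards its answer where that answer is meaningless. *)
Lemma dec_code (U : countType) (R : T -> U -> Prop) :
  effective U -> dec (fun p : T * U => R p.1 p.2) ->
  dec (fun p : T * nat => exists u, pickle u = p.2 /\ R p.1 u).
Proof.
move=> eU [r rr rE].
have cr : computable (fun p : T * nat => r [tuple pickle p]) by exists r.
have := dec_and (dec_comp eU (computable_snd computable_id)) (dec_eq cr
  (computable_cst 1)).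
apply: dec_ext => -[t n] /=; split=> [[[u <-]]|[u [<- Rtu]]].
  have := rE (t, u); rewrite !pickle_pair pickle_bool => -> /=.
  by case: asboolP => // Rtu _; exists u.
split; first by exists u.
have := rE (t, u); rewrite !pickle_pair pickle_bool => -> /=.
by case: asboolP.
Qed.

Lemma computable_search (U : countType) (R : T -> U -> Prop) :
  effective U -> dec (fun p : T * U => R p.1 p.2) -> (forall t, exists u, R t u) ->
  exists2 f : T -> U, computable f & forall t, R t (f t).
Proof.
move=> eU dR exR.
have [|f [cf fD _]] := @computable_mu (fun t n =>
  exists u, pickle u = n /\ R t u) (dec_code (R := R) eU dR).
  by move=> t; have [u Rtu] := exR t; exists (pickle u), u.
have /choice[g gP] := fD; exists g; last by move=> t; case: (gP t).
apply/computable_pickle; apply: computable_ext cf => t.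
by case: (gP t).
Qed.

(** The value is searched for. So a function with a set-theoretic definition, such as [listing], is
    computable as soon as its results can be checked. *)
Lemma computable_graph (U : countType) (f : T -> U) :
  effective U -> dec (fun p : T * U => p.2 = f p.1) -> computable f.
Proof.
move=> eU df.
have [|g cg gE] := computable_search (R := fun t u => u = f t) eU df.
  by move=> t; exists (f t).
exact: computable_ext gE cg.
Qed.

Lemma computable_unpickle (U : countType) :
  effective U -> computable (@pickle_inv U).
Proof.
move=> eU; apply/computable_pickle.
have := computable_if eU (computable_nat2 rec_ccons computable_id
  (computable_cst 0)) (computable_cst 0).
apply: computable_ext => n; case: asboolP => [[t <-]|nim]; first by rewrite pickleK_inv.
case E: pickle_inv => [u|] //; case: nim; exists u.
by have := @pickle_invK U n; rewrite E.
Qed.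
End Search.

(** * The arithmetical classes up to Sigma_2 *)

Ltac effective_step := first
  [ assumption | exact: effective_nat | exact: effective_bool | exact: effective_fin
  | apply: effective_pair | apply: effective_sum | apply: effective_option | apply:
    effective_seq ].

Ltac comp_app := match goal with
  | H : computable ?f |- @computable ?T _ _ =>
    lazymatch f with fun _ => _ => fail | _ => idtac end;
    apply: (@computable_comp T _ _ f _ H)
  end.

Ltac dec_app := match goal with
  | H : dec ?f |- @dec ?T _ =>
    lazymatch f with fun _ => _ => fail | _ => idtac end;
    apply: (@dec_comp T _ f _ H)
  end.

Ltac list_step := lazymatch goal with
  | |- computable (fun t => rev (@?s t)) => apply: computable_rev
  | |- computable (fun t => map (@?f t) (@?s t)) => apply: computable_map
  | |- computable (fun t => seq.filter (@?f t) (@?s t)) => apply: computable_filter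
  | |- computable (fun t => cat (@?f t) (@?s t)) => apply: computable_cat
  | |- computable (fun t => rcons (@?f t) (@?s t)) => apply: computable_rcons
  | |- computable (fun t => flatten (@?s t)) => apply: computable_flatten
  | |- computable (fun t => size (@?s t)) => apply: computable_size
  | |- computable (fun t => in_mem (@?x t) (mem (@?s t))) => apply: computable_mem
  | |- computable (fun t => index (@?x t) (@?s t)) => apply: computable_index
  | |- computable (fun t => behead (@?s t)) => apply: computable_behead
  | |- computable (fun t => drop (@?n t) (@?s t)) => apply: computable_drop
  | |- computable (fun t => take (@?n t) (@?s t)) => apply: computable_take
  | |- computable (fun t => splits (@?s t)) => apply: computable_splits
  end.

Ltac dec_step := first [ assumption | lazymatch goal with
  | |- dec (fun _ => ?c) => exact: dec_cst
  | |- dec (fun t => ~ (@?P t)) => apply: dec_not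
  | |- dec (fun t => (@?P t) /\ (@?Q t)) => apply: dec_and
  | |- dec (fun t => (@?P t) \/ (@?Q t)) => apply: dec_or
  | |- dec (fun t => (@?P t) <-> (@?Q t)) => apply: dec_iff
  | |- dec (fun t => is_true (@?b t)) => apply: dec_bool
  | |- dec (fun t => (@?f t) = (@?g t)) => apply: dec_eq
  | |- dec (fun t => @ex ?A (@?P t)) => first [apply: dec_ex_split | apply: dec_exin]
  | |- dec _ => first [dec_app | apply: dec_all_split | apply: dec_allin | apply:
    dec_imp]
  end ].

(** Syntax-directed proofs of computability, decidability and effectiveness. Predicates and
    functions with a name of their own are handled by hypotheses of the context, which is why such
    facts are put there before the definition at hand is unfolded. *)
Ltac decidability := repeat (cbv beta;
  lazymatch goal with
  | |- computable _ => eta_head; first [comp_step | list_step | comp_app]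
  | |- dec _ => dec_step
  | |- effective _ => effective_step
  end).

(** Witnesses range over any effective type. Closure properties then combine witness types by
    products, sums and lists, without explicit codings. *)
Definition Sigma1 (T : countType) (P : T -> Prop) :=
  exists (U : countType) (D : T -> U -> Prop),
    [/\ effective U, dec (fun p : T * U =>
      D p.1 p.2) & forall t, P t <-> exists u, D t u].

Definition Pi1 (T : countType) (P : T -> Prop) := Sigma1 (fun t => ~ P t).

Definition Sigma2 (T : countType) (P : T -> Prop) :=
  exists (U : countType) (Q : T -> U -> Prop),
    [/\ effective U, Pi1 (fun p : T * U =>
      Q p.1 p.2) & forall t, P t <-> exists u, Q t u].

Lemma sigma1_ext (T : countType) (P Q : T -> Prop) :
  (forall t, P t <-> Q t) -> Sigma1 P -> Sigma1 Q.
Proof. by move=> PQ [U [D [eU dD PE]]]; exists U, D; split=> // t; rewrite -PQ. Qed.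

Lemma sigma1_dec (T : countType) (P : T -> Prop) : dec P -> Sigma1 P.
Proof.
move=> dP; exists nat, (fun t _ => P t); split; first exact: effective_nat.
  by decidability.
by move=> t; split=> [|[_]] //; exists 0.
Qed.

Lemma sigma1_comp (T A : countType) (P : A -> Prop) (f : T -> A) :
  Sigma1 P -> computable f -> Sigma1 (fun t => P (f t)).
Proof.
move=> [U [D [eU dD PE]]] cf; exists U, (fun t u => D (f t) u); split=> //.
by apply: (dec_comp (f := fun p : T * U => (f p.1, p.2)) dD); decidability.
Qed.

Lemma sigma1_and (T : countType) (P Q : T -> Prop) :
  Sigma1 P -> Sigma1 Q -> Sigma1 (fun t => P t /\ Q t).
Proof.
move=> [U [D [eU dD PE]]] [V [D' [eV dD' QE]]].
exists (U * V)%type, (fun t p => D t p.1 /\ D' t p.2); split.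
- by decidability.
- apply: dec_and.
    by apply: (dec_comp (f := fun p : T * (U * V) => (p.1, p.2.1)) dD); decidability.
  by apply: (dec_comp (f := fun p : T * (U * V) => (p.1, p.2.2)) dD'); decidability.
move=> t; rewrite PE QE; split=> [[[u Du] [v Dv]]|[[u v] [Du Dv]]].
  by exists (u, v).
by split; [exists u|exists v].
Qed.

Lemma dec_sum (T U V : countType) (D : T -> U -> Prop) (D' : T -> V -> Prop) :
  dec (fun p : T * U => D p.1 p.2) -> dec (fun p : T * V => D' p.1 p.2) ->
  dec (fun p : T * (U + V) => match p.2 with inl u => D p.1 u | inr v => D' p.1 v end).
Proof.
move=> dD dD'.
have c : computable (fun p : T * (U + V) =>
    match p.2 with inl u => `[< D p.1 u >] | inr v => `[< D' p.1 v >] end).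
  apply: (computable_case_sum (f := fun p u => `[< D p.1 u >]) (g := fun p v =>
    `[< D' p.1 v >])).
  - by decidability.
  - by apply: (dec_comp (f := fun p : T * (U + V) * U => (p.1.1, p.2)) dD);
      decidability.
  - by apply: (dec_comp (f := fun p : T * (U + V) * V => (p.1.1, p.2)) dD');
      decidability.
by apply: computable_ext c => -[t []].
Qed.

Lemma sigma1_or (T : countType) (P Q : T -> Prop) :
  Sigma1 P -> Sigma1 Q -> Sigma1 (fun t => P t \/ Q t).
Proof.
move=> [U [D [eU dD PE]]] [V [D' [eV dD' QE]]].
exists (U + V)%type, (fun t s => match s with inl u => D t u | inr v => D' t v end);
  split.
- by decidability.
- exact: dec_sum.
move=> t; rewrite PE QE; split=> [[[u Du]|[v Dv]]|[[u|v] D0]].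
- by exists (inl u).
- by exists (inr v).
- by left; exists u.
- by right; exists v.
Qed.

Lemma sigma1_ex (T V : countType) (P : T -> V -> Prop) :
  effective V -> Sigma1 (fun p : T * V => P p.1 p.2) -> Sigma1 (fun t =>
    exists v, P t v).
Proof.
move=> eV [U [D [eU dD PE]]].
exists (V * U)%type, (fun t p => D (t, p.1) p.2); split; first by decidability.
  by apply: (dec_comp (f := fun p : T * (V * U) => ((p.1, p.2.1), p.2.2)) dD);
    decidability.
move=> t; split=> [[v /(PE (t, v)) [u Du]]|[[v u] Du]]; first by exists (v, u).
by exists v; apply/(PE (t, v)); exists u.
Qed.

(* The witnesses for the elements of the list are collected in one list. *)
Lemma sigma1_allin (T A : countType) (s : T -> seq A) (P : T -> A -> Prop) :
  computable s -> Sigma1 (fun p : T * A => P p.1 p.2) ->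
  Sigma1 (fun t => forall x, x \in s t -> P t x).
Proof.
move=> cs [U [D [eU dD PE]]].
exists (seq U), (fun t f => forall x, x \in s t -> exists u, u \in f /\ D (t, x) u);
  split.
- by decidability.
- decidability; apply: (dec_comp (f := fun p : T * seq U * A * U =>
    (p.1.1.1, p.1.2, p.2)) dD).
  by decidability.
move=> t; split=> [|[f fP] x /fP[u [_ Du]]]; last by apply/(PE (t, x)); exists u.
elim: (s t) => [|x l IHl] all; first by exists [::].
have [y yl|f fP] := IHl; first by apply: all; rewrite inE yl orbT.
have /(PE (t, x))[u Du] : P t x by apply: all; rewrite mem_head.
exists (u :: f) => y; rewrite inE => /orP[/eqP->|/fP[v [vf Dv]]].
  by exists u; rewrite mem_head.
by exists v; rewrite inE vf orbT.
Qed.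

(** Post's theorem: a search for a witness of P or of its negation always succeeds, and the side on
    which it succeeds decides P. *)
Lemma dec_of_sigma1 (T : countType) (P : T -> Prop) :
  effective T -> Sigma1 P -> Sigma1 (fun t => ~ P t) -> dec P.
Proof.
move=> eT [U [D [eU dD PE]]] [V [D' [eV dD' QE]]].
pose R t (s : U + V) := match s with inl u => D t u | inr v => D' t v end.
have [|t|f cf fR] := @computable_search _ eT (U + V)%type R (effective_sum eU eV).
- exact: dec_sum.
- have [/PE[u]|/QE[v]] := pselect (P t); first by exists (inl u).
  by exists (inr v).
have c : computable (fun t => match f t with inl _ => true | inr _ => false end).
  by apply: (computable_case_sum (f := fun _ _ => true) (g := fun _ _ => false) cf);
    decidability.
apply: computable_ext c => t; apply/esym; have := fR t; case: (f t) => [u Du|v Dv].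
  by apply/asboolP/PE; exists u.
by apply/asboolPn/QE; exists v.
Qed.

Lemma pi1_dec (T : countType) (P : T -> Prop) : dec P -> Pi1 P.
Proof. by move=> dP; apply/sigma1_dec/dec_not. Qed.

Lemma pi1_comp (T A : countType) (P : A -> Prop) (f : T -> A) :
  Pi1 P -> computable f -> Pi1 (fun t => P (f t)).
Proof. exact: (sigma1_comp (P := fun a => ~ P a)). Qed.

Lemma pi1_and (T : countType) (P Q : T -> Prop) :
  Pi1 P -> Pi1 Q -> Pi1 (fun t => P t /\ Q t).
Proof. by move=> pP pQ; apply: sigma1_ext (sigma1_or pP pQ) => t; rewrite not_andE. Qed.

Lemma pi1_or (T : countType) (P Q : T -> Prop) :
  Pi1 P -> Pi1 Q -> Pi1 (fun t => P t \/ Q t).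
Proof. by move=> pP pQ; apply: sigma1_ext (sigma1_and pP pQ) => t; rewrite not_orE. Qed.

Lemma pi1_imp (T : countType) (P Q : T -> Prop) :
  Sigma1 P -> Pi1 Q -> Pi1 (fun t => P t -> Q t).
Proof. by move=> pP pQ; apply: sigma1_ext (sigma1_and pP pQ) => t;
  rewrite not_implyE. Qed.

Lemma pi1_all (T V : countType) (P : T -> V -> Prop) :
  effective V -> Pi1 (fun p : T * V => P p.1 p.2) -> Pi1 (fun t => forall v, P t v).
Proof.
move=> eV pP; apply: sigma1_ext (sigma1_ex (P := fun t v => ~ P t v) eV pP) => t.
by rewrite -existsNE.
Qed.

(** After negation, the refutations for all members of the list are gathered into one list. *)
Lemma pi1_exin (T A : countType) (s : T -> seq A) (P : T -> A -> Prop) :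
  computable s -> Pi1 (fun p : T * A => P p.1 p.2) ->
  Pi1 (fun t => exists x, x \in s t /\ P t x).
Proof.
move=> cs pP; apply: sigma1_ext (sigma1_allin (P := fun t x => ~ P t x) cs pP) => t.
split=> [all [x [sx px]]|nex x sx px]; first exact: all px.
by apply: nex; exists x.
Qed.

Lemma pi1_allin (T A : countType) (s : T -> seq A) (P : T -> A -> Prop) :
  effective A -> computable s -> Pi1 (fun p : T * A => P p.1 p.2) ->
  Pi1 (fun t => forall x, x \in s t -> P t x).
Proof.
by move=> eA cs pP; apply: pi1_all => //; apply: pi1_imp pP; apply: sigma1_dec;
  decidability.
Qed.

Lemma sigma2_p1 (T : countType) (P : T -> Prop) : Pi1 P -> Sigma2 P.
Proof.
move=> pP; exists nat, (fun t _ => P t); split; first exact: effective_nat.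
  by apply: (pi1_comp pP); decidability.
by move=> t; split=> [|[_]] //; exists 0.
Qed.

Lemma sigma2_s1 (T : countType) (P : T -> Prop) : Sigma1 P -> Sigma2 P.
Proof.
move=> [U [D [eU dD PE]]]; exists U, D; split=> //.
exact: pi1_dec.
Qed.

Lemma sigma2_dec (T : countType) (P : T -> Prop) : dec P -> Sigma2 P.
Proof. by move=> dP; apply/sigma2_p1/pi1_dec. Qed.

Lemma sigma2_comp (T A : countType) (P : A -> Prop) (f : T -> A) :
  Sigma2 P -> computable f -> Sigma2 (fun t => P (f t)).
Proof.
move=> [U [D [eU dD PE]]] cf; exists U, (fun t u => D (f t) u); split=> //.
by apply: (pi1_comp (f := fun p : T * U => (f p.1, p.2)) dD); decidability.
Qed.

Lemma sigma2_and (T : countType) (P Q : T -> Prop) :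
  Sigma2 P -> Sigma2 Q -> Sigma2 (fun t => P t /\ Q t).
Proof.
move=> [U [D [eU dD PE]]] [V [D' [eV dD' QE]]].
exists (U * V)%type, (fun t p => D t p.1 /\ D' t p.2); split.
- by decidability.
- apply: pi1_and.
    by apply: (pi1_comp (f := fun p : T * (U * V) => (p.1, p.2.1)) dD); decidability.
  by apply: (pi1_comp (f := fun p : T * (U * V) => (p.1, p.2.2)) dD'); decidability.
move=> t; rewrite PE QE; split=> [[[u Du] [v Dv]]|[[u v] [Du Dv]]].
  by exists (u, v).
by split; [exists u|exists v].
Qed.

Lemma sigma2_or (T : countType) (P Q : T -> Prop) :
  Sigma2 P -> Sigma2 Q -> Sigma2 (fun t => P t \/ Q t).
Proof.
move=> [U [D [eU dD PE]]] [V [D' [eV dD' QE]]].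
(* With a pair of lists instead of a sum, the matrix is a disjunction of bounded existential
   quantifiers, under which Pi1 is closed. One of the lists may be empty. *)
exists (seq U * seq V)%type, (fun t p =>
  (exists u, u \in p.1 /\ D t u) \/ (exists v, v \in p.2 /\ D' t v)).
split; first by decidability.
  apply: pi1_or; apply: pi1_exin; try by decidability.
    by apply: (pi1_comp (f := fun p : T * (seq U * seq V) * U => (p.1.1, p.2)) dD);
      decidability.
  by apply: (pi1_comp (f := fun p : T * (seq U * seq V) * V => (p.1.1, p.2)) dD');
    decidability.
move=> t; rewrite PE QE; split=> [[[u Du]|[v Dv]]|[p [[u [_ Du]]|[v [_ Dv]]]]].
- by exists ([:: u], [::]); left; exists u; rewrite mem_head.
- by exists ([::], [:: v]); right; exists v; rewrite mem_head.
- by left; exists u.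
- by right; exists v.
Qed.

Lemma sigma2_ex (T V : countType) (P : T -> V -> Prop) :
  effective V -> Sigma2 (fun p : T * V => P p.1 p.2) -> Sigma2 (fun t =>
    exists v, P t v).
Proof.
move=> eV [U [D [eU dD PE]]].
exists (V * U)%type, (fun t p => D (t, p.1) p.2); split; first by decidability.
  by apply: (pi1_comp (f := fun p : T * (V * U) => ((p.1, p.2.1), p.2.2)) dD);
    decidability.
move=> t; split=> [[v /(PE (t, v)) [u Du]]|[[v u] Du]]; first by exists (v, u).
by exists v; apply/(PE (t, v)); exists u.
Qed.

Lemma sigma2_allin (T A : countType) (s : T -> seq A) (P : T -> A -> Prop) :
  effective A -> computable s -> Sigma2 (fun p : T * A => P p.1 p.2) ->
  Sigma2 (fun t => forall x, x \in s t -> P t x).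
Proof.
move=> eA cs [U [D [eU dD PE]]].
exists (seq U), (fun t f => forall x, x \in s t -> exists u, u \in f /\ D (t, x) u);
  split.
- by decidability.
- apply: pi1_allin => //; first by decidability.
  apply: pi1_exin => //; first by decidability.
  apply: (pi1_comp (f := fun p : T * seq U * A * U => (p.1.1.1, p.1.2, p.2)) dD).
  by decidability.
move=> t; split=> [|[f fP] x /fP[u [_ Du]]]; last by apply/(PE (t, x)); exists u.
elim: (s t) => [|x l IHl] all; first by exists [::].
have [y yl|f fP] := IHl; first by apply: all; rewrite inE yl orbT.
have /(PE (t, x))[u Du] : P t x by apply: all; rewrite mem_head.
exists (u :: f) => y; rewrite inE => /orP[/eqP->|/fP[v [vf Dv]]].
  by exists u; rewrite mem_head.
by exists v; rewrite inE vf orbT.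
Qed.

(** The form used for learning: u is guessed, and a single v outside the decidable matrix refutes
    the guess. *)
Lemma sigma2_matrix (T : countType) (P : T -> Prop) :
  Sigma2 P -> exists (U V : countType) (D : T -> U -> V -> Prop),
  [/\ effective U, effective V, dec (fun p : T * U * V => D p.1.1 p.1.2 p.2)
    & forall t, P t <-> exists u, forall v, D t u v].
Proof.
move=> [U [Q [eU [V [D [eV dD QE]]] PE]]].
exists U, V, (fun t u v => ~ D (t, u) v); split=> //.
  by apply: dec_not; apply: dec_ext dD => -[[t u] v].
move=> t; rewrite PE; split=> -[u uP]; exists u.
  by move=> v Dv; have /(QE (t, u)) : exists v, D (t, u) v; [exists v|].
apply: contrapT => /(QE (t, u))[v]; exact: uP.
Qed.

Lemma sigma1_not (T : countType) (P : T -> Prop) : Pi1 P -> Sigma1 (fun t => ~ P t).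
Proof. by []. Qed.

(** * Membership in context-free languages *)

Lemma effective_cfg (N : countType) (S : finType) : effective N -> effective (cfg N S).
Proof.
move=> eN.
have e : effective (N * seq (N * seq (N + S)))%type by decidability.
apply: dec_ext e => n; split=> [[p <-]|[G <-]]; first by exists (pair_cfg p); case: p.
by exists (cfg_pair G).
Qed.

Lemma computable_cfg_pair (T N : countType) (S : finType) (G : T -> cfg N S) :
  computable G -> computable (fun t => cfg_pair (G t)).
Proof. by move=> /computable_pickle cG; apply/computable_pickle;
  apply: computable_ext cG. Qed.

Lemma computable_cfg_start (T N : countType) (S : finType) (G : T -> cfg N S) :
  computable G -> computable (fun t => cfg_start (G t)).
Proof. by move=> /computable_cfg_pair cG; exact: (computable_fst cG). Qed.

Lemma computable_cfg_rules (T N : countType) (S : finType) (G : T -> cfg N S) :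
  computable G -> computable (fun t => cfg_rules (G t)).
Proof. by move=> /computable_cfg_pair cG; exact: (computable_snd cG). Qed.

Lemma finite_words_over (T : choiceType) (A : seq T) (n : nat) :
  finite_set [set w : seq T | {subset w <= A} /\ size w <= n].
Proof.
elim: n => [|n IHn].
  by apply: (sub_finite_set _ (finite_set1 [::])) => w /= [_];
    rewrite leqn0 => /nilP ->.
have fin : finite_set ([set [::]] `|` [set a :: w | a in [set` A] &
    w in [set w : seq T | {subset w <= A} /\ size w <= n]]).
  rewrite finite_setU; split; first exact: finite_set1.
  by apply: finite_image2 => //; exact: finite_seq.
apply: sub_finite_set fin => -[|a w] /= [wA le_w]; first by left.
right; exists a; first by apply: wA; rewrite mem_head.
by exists w => //; split=> // b bw; apply: wA; rewrite inE bw orbT.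
Qed.

Section Grammar.
Variables (N : countType) (S : finType) (G : cfg N S).
Implicit Types (s t l r : seq (N + S)).

Lemma derives_trans s t u : derives G s t -> derives G t u -> derives G s u.
Proof. by elim=> // l A rhs r t' inG _ IH /IH; apply: derives_step. Qed.

Lemma derives_ctx l r s t : derives G s t -> derives G (l ++ s ++ r) (l ++ t ++ r).
Proof.
elim=> [?|l' A rhs r' t' inG _ IH]; first exact: derives_refl.
have -> : l ++ (l' ++ inl A :: r') ++ r = (l ++ l') ++ inl A :: (r' ++ r).
  by rewrite -!catA.
by apply: derives_step inG _; move: IH; rewrite -!catA.
Qed.

Lemma derives_cat s s' t t' :
  derives G s s' -> derives G t t' -> derives G (s ++ t) (s' ++ t').
Proof.
move=> /(derives_ctx [::] t) ds /(derives_ctx s' [::]).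
by rewrite !cats0; apply: derives_trans.
Qed.

(** An instruction is a position with a rule, and it has no effect where the rule does not apply.
    Every list of instructions is then a derivation, and derivability becomes an existential
    statement about a computable fold. *)
Definition rewrite_at s (i : nat * (N * seq (N + S))) : seq (N + S) :=
  if (i.2 \in cfg_rules G) && (drop i.1 s == inl i.2.1 :: drop i.1.+1 s)
  then take i.1 s ++ i.2.2 ++ drop i.1.+1 s else s.

Lemma derives_foldl s t :
  derives G s t <-> exists ins, foldl rewrite_at s ins = t.
Proof.
split=> [|[ins <-]].
  elim=> [u|l A rhs r u inG _ [ins <-]]; first by exists [::].
  exists ((size l, (A, rhs)) :: ins) => /=; congr foldl.
  rewrite /rewrite_at /= inG drop_size_cat // take_size_cat //.
  by rewrite -cat_rcons drop_size_cat ?size_rcons // eqxx.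
elim: ins s => [|[n [A rhs]] ins IHis] s /=; first exact: derives_refl.
apply: derives_trans (IHis _).
rewrite /rewrite_at /=; case: andP => [[inG /eqP e]|_]; last exact: derives_refl.
rewrite -{1}(cat_take_drop n s) e.
exact: derives_step inG (derives_refl _ _).
Qed.

Definition item_words (R : seq (N * word S)) (X : N + S) : seq (word S) :=
  match X with
  | inl A => [seq e.2 | e <- [seq e <- R | e.1 == A]]
  | inr a => [:: [:: a]]
  end.

Definition yields (R : seq (N * word S)) s : seq (word S) :=
  foldr (fun X acc => flatten [seq [seq
    (y : word S) ++ z | z <- acc] | y <- item_words R X])
    [:: [::]] s.

(** An entry (A, y) of R reads: A derives y. Saturation is closure under bottom-up steps with
    results of length at most n. Every derivable fact up to that length with a word on the right
    then has to be in R, so a saturated R lacking a pair certifies that it is not derivable. *)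
Definition saturated (n : nat) (R : seq (N * word S)) : Prop :=
  forall rule, rule \in cfg_rules G -> forall x, x \in yields R rule.2 ->
    size x <= n -> (rule.1, x) \in R.

Lemma yields_cons R X s x :
  x \in yields R (X :: s) <->
  exists y z, [/\ x = y ++ z, y \in item_words R X & z \in yields R s].
Proof.
split=> [/flatten_mapP[y yX /mapP[z zs ->]]|[y [z [-> yX zs]]]]; first by exists y, z.
by apply/flatten_mapP; exists y => //; apply: map_f.
Qed.

Lemma mem_item_words R A x : (x \in item_words R (inl A)) = ((A, x) \in R).
Proof.
apply/mapP/idP => [[[B y]]|AxR].
  by rewrite mem_filter /= => /andP[/eqP -> ?] ->.
by exists (A, x) => //; rewrite mem_filter /= eqxx.
Qed.

Lemma yields_cat R s t x :
  x \in yields R (s ++ t) <->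
  exists y z, [/\ x = y ++ z, y \in yields R s & z \in yields R t].
Proof.
elim: s x => [|X s IHs] x.
  split=> [xt|[y [z [-> ]]]]; first by exists [::], x.
  by rewrite inE => /eqP ->.
rewrite cat_cons yields_cons; split.
  move=> [y [z [-> yX /IHs[y' [z' [-> ys zt]]]]]].
  exists (y ++ y'), z'; rewrite catA; split=> //.
  by apply/yields_cons; exists y, y'.
move=> [y [z [-> /yields_cons[y1 [y2 [-> yX ys]]] zt]]].
exists y1, (y2 ++ z); rewrite catA; split=> //.
by apply/IHs; exists y2, z.
Qed.

Lemma yields_terminals R (w : word S) : yields R (map inr w) = [:: w].
Proof. by elim: w => //= a w ->. Qed.

(** Induction on the derivation from its first step. The part of w produced by the rule of that step
    is no longer than w, hence saturation applies to it. *)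
Lemma derives_yields n R s t : saturated n R -> derives G s t ->
  forall w : word S, size w <= n -> t = map inr w -> w \in yields R s.
Proof.
move=> sat; elim=> [u|l A rhs r u inG _ IH] w le_wn.
  by move=> ->; rewrite yields_terminals mem_head.
move=> /(IH w le_wn) /yields_cat[x [y [wE xl /yields_cat[y1 [y2 [yE y1r y2r]]]]]].
apply/yields_cat; exists x, y; split=> //; apply/yields_cons.
exists y1, y2; split=> //; rewrite mem_item_words.
apply: (sat _ inG) => //.
by move: le_wn; rewrite wE yE !size_cat; lia.
Qed.

Lemma yields_derives R s x :
  (forall A y, (A, y) \in R -> derives G [:: inl A] (map inr y)) ->
  x \in yields R s -> derives G s (map inr x).
Proof.
move=> RG; elim: s x => [|X s IHs] x.
  by rewrite inE => /eqP ->; exact: derives_refl.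
move=> /yields_cons[y [z [-> yX zs]]]; rewrite map_cat -cat1s.
apply: derives_cat; last exact: IHs.
case: X yX => [A|a]; first by rewrite mem_item_words; apply: RG.
by rewrite inE => /eqP ->; exact: derives_refl.
Qed.

(** The set of all true facts of length at most n is saturated. It is finite because only left-hand
    sides of rules are recorded in it. *)
Lemma saturated_complete n : exists R, saturated n R /\
  forall A y, (A, y) \in R -> derives G [:: inl A] (map inr y).
Proof.
pose P := [set e : N * word S | [/\ e.1 \in map fst (cfg_rules G), size e.2 <= n
   & derives G [:: inl e.1] (map inr e.2)]].
have : finite_set P.
  apply: (@sub_finite_set _ _ ([set` map fst
    (cfg_rules G)] `*` [set w : word S | size w <= n])).
    by move=> [A y] [].
  apply: finite_setX; first exact: finite_seq.
  apply: sub_finite_set (finite_words_over (enum S) n) => w le_w; split=> // a _.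
  by rewrite mem_enum.
move=> /finite_seqP[R RP].
have inR e : (e \in R) <-> P e by rewrite RP.
exists R; split=> [[A rhs] inG x xy le_xn|A y /inR[]//].
have RG B y : (B, y) \in R -> derives G [:: inl B] (map inr y) by move=> /inR[].
apply/inR; split=> //=; first by apply/mapP; exists (A, rhs).
have := yields_derives RG xy.
move=> d; apply: (@derives_step _ _ G [::] A rhs [::]) => //.
by rewrite cats0.
Qed.
End Grammar.

(** By Post's theorem: a derivation witnesses membership, and a saturated table without the pair of
    the start symbol and w witnesses its failure. This covers arbitrary rules, erasing and unit
    rules included, without passing to a normal form. *)
Lemma dec_cfg_lang (N : countType) (S : finType) : effective N ->
  dec (fun p : cfg N S * word S => cfg_lang p.1 p.2).
Proof.
move=> eN; have eG := effective_cfg S eN; apply: dec_of_sigma1; first by decidability.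
  apply: (sigma1_ext (P := fun p : cfg N S * word S => exists ins,
    foldl (rewrite_at p.1) [:: inl (cfg_start p.1)] ins = map inr p.2)).
    by move=> p; rewrite /cfg_lang /= derives_foldl.
  apply: sigma1_ex; first by decidability.
  apply: sigma1_dec; apply: dec_eq; last by decidability.
  apply: (computable_foldl (g := fun q => rewrite_at q.1.1.1 q.2.1 q.2.2));
    first by decidability.
    by apply: computable_cons; [apply/computable_inl/computable_cfg_start|];
      decidability.
  rewrite /rewrite_at; apply: computable_if; last by decidability.
    apply: computable_if; last by decidability.
      by apply: computable_mem; last apply: computable_cfg_rules; decidability.
    by decidability.
  by decidability.
apply: (sigma1_ext (P := fun p : cfg N S * word S => exists R,
   saturated p.1 (size p.2) R /\ (cfg_start p.1, p.2) \notin R)).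
  move=> [G w] /=; split=> [[R [sat nR]] dw|nw].
    move/negP: nR; apply; rewrite -mem_item_words.
    have := derives_yields sat dw (leqnn _) erefl.
    move=> /yields_cons[y [z [-> yX]]].
    by rewrite inE => /eqP ->; rewrite cats0.
  have [R [sat RG]] := saturated_complete G (size w).
  by exists R; split=> //; apply/negP => /RG.
apply: sigma1_ex; first by decidability.
apply: sigma1_dec; apply: dec_and; last first.
  apply: dec_ext (dec_not (dec_bool (b := fun p : cfg N S * word S * seq (N * word S) =>
     (cfg_start p.1.1, p.1.2) \in p.2) _)) => [p|]; first by split=> /negP.
  by apply: computable_mem; [apply: computable_pair;
    first apply: computable_cfg_start|]; decidability.
rewrite /saturated; apply: dec_allin; first by apply: computable_cfg_rules;
  decidability.
apply: dec_allin; last first.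
  apply: dec_imp; first by decidability.
  by decidability.
rewrite /yields.
apply: (computable_foldr (g := fun (p : cfg N S * word S * seq (N * word S) *
  (N * seq (N + S))) (X : N + S) (acc : seq (word S)) =>
   flatten [seq [seq (y : word S) ++ z | z <- acc] | y <- item_words p.1.2 X]));
     try by decidability.
apply: computable_flatten; apply: computable_map; last by decidability.
rewrite /item_words; apply: computable_case_sum; try by decidability.
Qed.

(** * Orders and listings *)

Section Orders.
Variables (T : choiceType) (le : rel T).
Hypotheses (le_total : total le) (le_trans : transitive le)
  (le_anti : antisymmetric le).

Lemma lex_le_total : total (lex_le le).
Proof.
elim=> [|x u IHu] [|y v] //=; rewrite [y == x]eq_sym.
by case: eqP => // _; exact: IHu.
Qed.

Lemma lex_le_anti : antisymmetric (lex_le le).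
Proof.
elim=> [|x u IHu] [|y v] //=; rewrite [y == x]eq_sym.
by case: eqP => [->|ne] /=; [move=> /IHu -> | move=> /le_anti].
Qed.

Lemma lex_le_trans : transitive (lex_le le).
Proof.
move=> v u w; elim: u v w => [|x u IHu] [|y v] [|z w] //=.
case: eqP => [->|nxy]; first by case: eqP => // _; exact: IHu.
case: (y =P z) => [<-|nyz] le1; first by case: eqP.
move=> le2; case: eqP => [xz|_]; last exact: le_trans le1 le2.
by case: nxy; apply: le_anti; rewrite le1 xz.
Qed.

Lemma shortlex_total : total (shortlex le).
Proof.
move=> u v; rewrite /shortlex; case: ltngtP => //= _.
exact: lex_le_total.
Qed.

Lemma shortlex_anti : antisymmetric (shortlex le).
Proof.
move=> u v; rewrite /shortlex; case: ltngtP => //= _.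
exact: lex_le_anti.
Qed.

Lemma shortlex_trans : transitive (shortlex le).
Proof.
move=> v u w; rewrite /shortlex =>
  /orP[lt1|/andP[/eqP e1 l1]] /orP[lt2|/andP[/eqP e2 l2]].
- by rewrite (ltn_trans lt1).
- by rewrite -e2 lt1.
- by rewrite e1 lt2.
- by rewrite e1 e2 eqxx (lex_le_trans l1 l2) orbT.
Qed.

Lemma seq_least (s : seq T) : s != [::] -> exists2 m, m \in s & forall x, x \in s ->
  le m x.
Proof.
have le_refl x : le x x by have := le_total x x; rewrite orbb.
elim: s => // x s IHs _; case: (eqVneq s [::]) => [->|/IHs[m ms min]].
  by exists x; rewrite ?mem_head // => y; rewrite inE => /eqP ->.
have [le_xm|le_mx] := orP (le_total x m).
  exists x; rewrite ?mem_head // => y; rewrite inE => /orP[/eqP -> //|/min].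
  exact: le_trans.
exists m; rewrite ?inE ?ms ?orbT // => y; rewrite inE => /orP[/eqP -> //|].
exact: min.
Qed.

(** Sortedness without repetition, phrased with splittings and membership so that its decidability
    follows from the closure properties. *)
Definition increasing (s : seq T) : Prop :=
  forall u v, s = u ++ v -> forall x, x \in u -> forall y, y \in v -> le x y /\ x <> y.

Lemma increasingP s : increasing s <-> sorted le s /\ uniq s.
Proof.
split=> [inc|[]].
  elim: s inc => // x s IHs inc.
  have /IHs[ss us] : increasing s.
    move=> u v sE y yu z zv; apply: (inc (x :: u) v) => //; first by rewrite sE.
    by rewrite inE yu orbT.
  have xs y : y \in s -> le x y /\ x <> y.
    by move=> ys; apply: (inc [:: x] s) => //; rewrite mem_head.
  split.
    rewrite /= path_sortedE // ss andbT; apply/allP => y /xs[]//.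
  by rewrite /= us andbT; apply/negP => /xs[].
move=> ss us u v sE x xu y yv; move: ss us.
rewrite sE cat_uniq => ss /and3P[_ /hasPn uv _]; split; last first.
  by move=> xy; move: (uv y yv); rewrite -xy /= xu.
move: ss; rewrite sorted_pairwise // pairwise_cat => /and3P[/allrelP/(_ x y xu yv)] //.
Qed.

(** The sorted enumeration of a finite set is the only increasing list of its elements. Through this
    characterization a guessed list can be verified, and two canonical listings can be compared as
    sets. *)
Lemma sort_enumP (A : set T) s : finite_set A ->
  (sort le (finmap.enum_fset (fset_set A)) = s <-> increasing s /\ A = [set` s]).
Proof.
move=> finA; rewrite increasingP; split=> [<-|[[ss us] AE]].
  split; first by rewrite sort_sorted ?sort_uniq ?fset_uniq.
  by apply/seteqP; split=> x /=; rewrite mem_sort in_fset_set //;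
    [exact: mem_set|exact: set_mem].
apply: (@sorted_eq _ le) => //; first exact: sort_sorted.
apply: uniq_perm; rewrite ?sort_uniq ?fset_uniq // => x.
rewrite mem_sort in_fset_set // AE.
by apply/idP/idP => [/set_mem|xs]; [|exact: mem_set].
Qed.

End Orders.

(** The type of letters may be infinite, as it is when letters are names of primes. Over the finite
    list A, only finitely many words are no longer than a given member of X, and a least one among
    them is least in X. *)
Lemma shortlex_leastP (T : choiceType) (le : rel T) (A : seq T) (X : set (seq T)) :
  total le -> transitive le -> antisymmetric le ->
  X !=set0 -> (forall w, X w -> {subset w <= A}) ->
  X (shortlex_least le X) /\ forall v, X v -> shortlex le (shortlex_least le X) v.
Proof.
move=> tot tr anti [w Xw] XA.
have [s sE] : exists s : seq (seq T), X `&` [set v | size v <= size w] = [set` s].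
  apply/finite_seqP; apply: sub_finite_set (finite_words_over A (size w)).
  by move=> v [/XA ? ?].
have ws : w \in s by have : [set` s] w by rewrite -sE; split=> //=.
have s0 : s != [::] by case: (s) ws.
have [m ms min] := seq_least (shortlex_total tot) (shortlex_trans tr anti) s0.
have [Xm le_mw] : (X `&` [set v | size v <= size w]) m by rewrite sE.
have ex : [set w | X w /\ forall v, X v -> shortlex le w v] m.
  split=> // v Xv; have [le_vw|lt_wv] := leqP (size v) (size w).
    by apply: min; have : (X `&` [set v | size v <= size w]) v by []; rewrite sE.
  by rewrite /shortlex (leq_ltn_trans _ lt_wv).
by case: (xgetPex [::] (ex_intro _ m ex)).
Qed.

Lemma shortlex_least_unique (T : choiceType) (le : rel T) (X : set (seq T)) m :
  antisymmetric le -> X m -> (forall v, X v -> shortlex le m v) ->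
  shortlex_least le X = m.
Proof.
move=> anti Xm min.
have ex : [set w | X w /\ forall v, X v -> shortlex le w v] m by [].
have [Xl minl] := xgetPex [::] (ex_intro _ m ex).
by apply: (shortlex_anti anti); rewrite (minl _ Xm) (min _ Xl).
Qed.

Section LetterOrder.
Variable S : finType.

Lemma letter_le_total : total (@letter_le S).
Proof. by move=> a b; apply: leq_total. Qed.
Lemma letter_le_trans : transitive (@letter_le S).
Proof. by move=> a b c; apply: leq_trans. Qed.
Lemma letter_le_anti : antisymmetric (@letter_le S).
Proof. by move=> a b; rewrite /letter_le -eqn_leq => /eqP/val_inj/enum_rank_inj. Qed.

Lemma word_le_total : total (@word_le S).
Proof. exact: shortlex_total letter_le_total. Qed.
Lemma word_le_trans : transitive (@word_le S).
Proof. exact: shortlex_trans letter_le_trans letter_le_anti. Qed.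
Lemma word_le_anti : antisymmetric (@word_le S).
Proof. exact: shortlex_anti letter_le_anti. Qed.

Lemma computable_letter_le : computable (fun p : S * S => letter_le p.1 p.2).
Proof.
have cr : computable (fun a : S => nat_of_ord (enum_rank a)) by exact: computable_fin.
apply: computable_leq.
  by apply: (computable_comp (g := fun a : S => nat_of_ord (enum_rank a)) cr); comp.
by apply: (computable_comp (g := fun a : S => nat_of_ord (enum_rank a)) cr); comp.
Qed.
End LetterOrder.

Lemma computable_lex_le (T : countType) (le : rel T) :
  computable (fun p : T * T => le p.1 p.2) ->
  computable (fun p : seq T * seq T => lex_le le p.1 p.2).
Proof.
move=> cle.
(* The state holds the unread part of v and the verdict, which is [None] as long as the words agree.
   When u ends in that state it is a prefix of v, hence the default [true]. *)
pose step (st : seq T * option bool) (x : T) : seq T * option bool :=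
  if st.2 is Some b then st else
  if st.1 is y :: v then if x == y then (v, None) else (st.1, Some (le x y))
  else (st.1, Some false).
have stepE u v : lex_le le u v = odflt true (foldl step (v, None) u).2.
  have some b l v' : foldl step (v', Some b) l = (v', Some b) by elim: l.
  elim: u v => //= x u IHu [|y v]; rewrite /step /= ?some //.
  by case: eqP => _ //=; rewrite some.
apply: (computable_ext (f := fun p => odflt true (foldl step (p.2, None) p.1).2)) =>
  [p|].
  by rewrite stepE.
apply: (computable_case_option (g := fun _ b => b)); [|by comp|by comp].
apply: computable_snd; apply: (computable_foldl (g := fun q => step q.2.1 q.2.2));
  [by comp|by comp|].
apply: (computable_case_option (g := fun q _ => q.2.1)); [by comp| |by comp].
apply: (@computable_case_seq _ _ _ (fun q : seq T * seq T *
  (seq T * option bool * T) => q.2.1.1)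
  (fun q => (q.2.1.1, Some false))
  (fun r => if r.1.2.2 == r.2.1 then (r.2.2, None) else (r.1.2.1.1, Some
    (le r.1.2.2 r.2.1))));
  comp.
by apply: (computable_comp (g := fun p : T * T =>
  le p.1 p.2) (f := fun r : seq T * seq T * (seq T * option bool * T) *
    (T * seq T) => (r.1.2.2, r.2.1)) cle); comp.
Qed.

Lemma computable_shortlex (T : countType) (le : rel T) :
  computable (fun p : T * T => le p.1 p.2) ->
  computable (fun p : seq T * seq T => shortlex le p.1 p.2).
Proof.
move=> /computable_lex_le c; rewrite /shortlex; apply: computable_if.
- by decidability.
- by decidability.
by apply: computable_if => //; decidability.
Qed.

Lemma listingP (T : countType) (A : set T) s : finite_set A ->
  listing A = s <-> increasing (fun x y => pickle x <= pickle y) s /\ A = [set` s].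
Proof.
apply: sort_enumP.
- by move=> x y; apply: leq_total.
- by move=> x y z; apply: leq_trans.
- by move=> x y; rewrite -eqn_leq => /eqP /pickle_inj.
Qed.

Lemma dec_increasing (T : countType) (le : rel T) :
  computable (fun p : T * T => le p.1 p.2) -> dec (fun s => increasing le s).
Proof.
move=> cle; pose l := fun p : T * T => le p.1 p.2.
have cl : computable l by [].
apply: (dec_ext (P := fun s => forall u v, s = u ++ v -> forall x, x \in u -> forall
  y, y \in v -> l (x, y) /\ x <> y)) => //.
by decidability.
Qed.

Lemma computable_listing (T : countType) : effective T ->
  computable (fun s : seq T => listing [set` s]).
Proof.
move=> eT; apply: computable_graph; [by decidability|by decidability|].
pose le := fun x y : T => pickle x <= pickle y.
have dinc : dec (increasing le).
  by apply: dec_increasing; apply: computable_leq;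
    apply: (proj1 (computable_pickle _)); comp.
apply: (dec_ext (P := fun p : seq T * seq T => increasing le p.2 /\
   ((forall x, x \in p.1 -> x \in p.2) /\ (forall x, x \in p.2 -> x \in p.1))));
     last first.
  by decidability.
move=> [s l] /=; rewrite -/([set` s]); split.
  move=> [inc [sl ls]]; apply/esym/listingP; first exact: finite_seq.
  by split=> //; apply/seteqP; split.
move=> /esym/listingP [|inc /seteqP[sl ls]]; first exact: finite_seq.
by split=> //; split.
Qed.

Lemma dec_morphism (S : finType) (M : monoidType) (h : word S -> M) :
  finite_set [set: M] -> word_morphism h ->
  dec (fun p : word S * word S => h p.1 = h p.2).
Proof.
move=> /finite_seqP[ms msE] [h1 hM].
have mms m : m \in ms by have : [set: M] m by []; rewrite msE.
pose i (w : word S) := index (h w) ms.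
have ci : computable i.
  (* Reading a word from its end, a letter multiplies the value of h on the left. With elements of M
     replaced by their indices in [ms], this is a finite table; the value 0 outside it makes
     [computable_table] applicable. *)
  pose F (p : S * nat) := if p.2 < size ms then index
    (h [:: p.1] * nth 1%g ms p.2)%g ms else 0.
  have cF : computable F.
    apply: (@computable_table _ _ _ [seq (a, n) | a <- enum S, n <- iota 0
      (size ms)] 0) => -[a n] nin.
    rewrite /F /=; case: ifP => // lt_n; case/negP: nin.
    by apply: allpairs_f; rewrite ?mem_enum // mem_iota.
  apply: (computable_ext (f := foldr (fun a n => F (a, n)) (i [::]))) => [w|].
    elim: w => //= a w ->; rewrite /F /= index_mem mms nth_index //.
    by rewrite /i -[a :: w]cat1s hM.
  by apply: (computable_foldr (g := fun _ a n => F (a, n))); decidability.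
apply: (dec_ext (P := fun p => i p.1 = i p.2)) => [p|]; last by decidability.
split=> [e|e]; last by rewrite /i e.
rewrite -(nth_index 1%g (mms (h p.1))) -(nth_index 1%g (mms (h p.2))).
by congr nth.
Qed.

(** * Minimal automata *)

Lemma lquot_cat (T : Type) (u v : seq T) (K : set (seq T)) :
  lquot (u ++ v) K = lquot v (lquot u K).
Proof. by apply/funext => w; rewrite /lquot /= catA. Qed.

Section MinDfa.
Variables (T : choiceType) (le : rel T) (A : seq T) (K : set (seq T)).
Hypotheses (le_total : total le) (le_trans : transitive le)
  (le_anti : antisymmetric le).

Definition word_over (u : seq T) : Prop := {subset u <= A}.

(** A [dfa] contains state numbers only. A table keeps an access word for each state and for each
    successor, so that its correctness can be expressed by comparing residuals of K. *)
Definition table : Type := seq (seq T * bool * seq (T * seq T)).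

Definition table_states (g : table) : seq (seq T) := [seq x.1.1 | x <- g].

Definition table_dfa (g : table) : dfa :=
  [seq (x.1.2, [seq index y.2 (table_states g) | y <- x.2]) | x <- g].

(** Each residual has a listed representative below any given word reaching it, and listed
    representatives are pairwise inequivalent. Together this makes the states the shortlex-least
    access words, including that of the empty residual if it is reached. *)
Definition table_ok (g : table) : Prop :=
  [/\ increasing (shortlex le) (table_states g),
      forall v, v \in table_states g -> word_over v,
      forall u, word_over u -> exists v, v \in table_states g /\
        (lquot u K = lquot v K /\ shortlex le v u),
      forall v, v \in table_states g -> forall w, w \in table_states g ->
        v = w \/ lquot v K <> lquot w K &
      forall x, x \in g -> [/\ x.1.2 <-> K x.1.1, [seq y.1 | y <- x.2] = A &
        forall y, y \in x.2 -> y.2 \in table_states g /\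
          lquot (rcons x.1.1 y.1) K = lquot y.2 K]].

(** The Myhill-Nerode form of regularity, over the alphabet listed by A. *)
Definition finite_index : Prop := exists us : seq (seq T),
  forall u, word_over u -> exists2 v, v \in us & word_over v /\ lquot u K = lquot v K.

Let aw := access_word le A K.

Lemma access_wordP u : word_over u ->
  [/\ word_over (aw u), lquot (aw u) K = lquot u K &
    forall v, word_over v -> lquot v K = lquot u K -> shortlex le (aw u) v].
Proof.
move=> Au.
have [||[Aa aE] min] := @shortlex_leastP T le A [set v | word_over v /\ lquot v K =
  lquot u K]
    le_total le_trans le_anti; first by exists u.
  by move=> w [].
by split=> // v Av vE; apply: min.
Qed.

Lemma access_word_eq u v : lquot u K = lquot v K -> aw u = aw v.
Proof. by rewrite /aw /access_word => ->. Qed.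

Hypothesis fin : finite_index.

Lemma finite_access_words : finite_set [set aw u | u in word_over].
Proof.
have [us usP] := fin.
apply: (sub_finite_set _ (finite_image aw (finite_seq us))) => _ [u Au <-].
by have [v vus [_ uv]] := usP _ Au; exists v => //; apply: access_word_eq.
Qed.

Lemma access_wordsP : increasing (shortlex le) (access_words le A K) /\
  [set aw u | u in word_over] = [set` access_words le A K].
Proof.
apply/(sort_enumP _ _ _ _ finite_access_words) => //.
- exact: shortlex_total.
- exact: shortlex_trans.
- exact: shortlex_anti.
Qed.

(** A listed state is least in its class, hence its own access word. So the list of states and
    [access_words] are increasing lists of the same set and coincide, and the numberings agree. *)
Lemma table_min_dfa g : table_ok g -> table_dfa g = min_dfa le A K.
Proof.
move=> [inc qA qrep qdist rows]; set q := table_states g in inc qA qrep qdist rows *.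
have aw_id v : v \in q -> aw v = v.
  move=> vq; apply: shortlex_least_unique => //; first by split=> //; exact: qA.
  move=> w [Aw wE]; have [x [xq [wx le_xw]]] := qrep _ Aw.
  case: (qdist _ vq _ xq) => [-> //|[]].
  by rewrite -wx wE.
have qE : access_words le A K = q.
  apply/(sort_enumP _ _ _ _ finite_access_words) => //.
  - exact: shortlex_total.
  - exact: shortlex_trans.
  - exact: shortlex_anti.
  split=> //; apply/seteqP; split=> [_ [u Au <-]|v vq] /=.
    have [v [vq [uv _]]] := qrep _ Au.
    by rewrite (access_word_eq uv) aw_id.
  by exists v; [exact: qA | exact: aw_id].
rewrite /min_dfa qE /table_dfa -/q {1}/q /table_states -map_comp.
apply/eq_in_map => x xg /=; have [bK AE yP] := rows _ xg.
rewrite -(asboolb x.1.2) (asbool_equiv_eq bK) -{2}AE -map_comp; congr pair.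
apply/eq_in_map => y yx /=; have [yq e] := yP _ yx.
by rewrite -(aw_id y.2) // -(access_word_eq e).
Qed.

Lemma table_exists : exists2 g, table_ok g & table_dfa g = min_dfa le A K.
Proof.
have [inc qE] := access_wordsP.
set q := access_words le A K in inc qE.
have inq v : v \in q -> word_over v /\ aw v = v.
  move=> vq; have [u Au <-] : [set aw u | u in word_over] v by rewrite qE.
  have [Aa e _] := access_wordP Au; split=> //.
  by rewrite (access_word_eq e).
have awq u : word_over u -> aw u \in q.
  by move=> Au; have : [set aw u | u in word_over] (aw u) by [exists u]; rewrite qE.
pose g : table := [seq (u, `[< K u >], [seq (a, aw (rcons u a)) | a <- A]) | u <- q].
have gE : table_states g = q by rewrite /table_states -map_comp map_id.
suff ok : table_ok g by exists g => //; exact: table_min_dfa.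
split; rewrite ?gE //.
- by move=> v /inq[].
- move=> u Au; exists (aw u); split; first exact: awq.
  by have [_ e min] := access_wordP Au; split; [rewrite e | exact: min].
- move=> v /inq[_ vE] w /inq[_ wE].
  have [e|] := pselect (lquot v K = lquot w K); last by right.
  by left; rewrite -vE -wE (access_word_eq e).
- move=> _ /mapP[u uq ->] /=; have [Au _] := inq _ uq; split.
  + by split=> /asboolP.
  + by rewrite -map_comp map_id.
  move=> _ /mapP[a aA ->] /=.
  have Aua : word_over (rcons u a) by move=> b;
    rewrite mem_rcons inE => /orP[/eqP->//|/Au].
  by split; [exact: awq | have [_ ->] := access_wordP Aua].
Qed.

End MinDfa.

(** One access word is chosen for each reachable state. Residuals are compared on all words but the
    automaton is trusted over A only; the second hypothesis excludes other words from the
    residuals. *)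
Lemma regular_finite_index (T : choiceType) (A : seq T) (K : set (seq T)) :
  (exists (Q : finType) (q0 : Q) (step : Q -> T -> Q) (F : pred Q),
    forall w, {subset w <= A} -> (K w <-> F (foldl step q0 w))) ->
  (forall w, K w -> {subset w <= A}) ->
  finite_index A K.
Proof.
move=> [Q [q0 [step [F KF]]]] KA.
have /choice[r rP] (q : Q) : exists u : seq T,
    (exists2 v, {subset v <= A} & foldl step q0 v = q) ->
    {subset u <= A} /\ foldl step q0 u = q.
  have [[v vA vq]|no] := pselect (exists2 v, {subset v <= A} & foldl step q0 v = q).
    by exists v.
  by exists [::] => /no.
exists [seq r q | q <- enum Q] => u Au.
have [|Ar rE] := rP (foldl step q0 u); first by exists u.
exists (r (foldl step q0 u)); first by apply: map_f; rewrite mem_enum.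
split=> //; apply/seteqP.
have sub z x y : {subset x <= A} -> {subset y <= A} ->
    foldl step q0 x = foldl step q0 y -> K (x ++ z) -> K (y ++ z).
  move=> Ax Ay e Kxz; have Axz := KA _ Kxz.
  have Ayz : {subset y ++ z <= A}.
    move=> a; rewrite mem_cat => /orP[/Ay//|az].
    by apply: Axz; rewrite mem_cat az orbT.
  by apply/KF => //; rewrite foldl_cat -e -foldl_cat; apply/KF.
by split=> z /=; apply: sub.
Qed.

(** * Relative primes in terms of their names *)

Section Classes.
Variables (S : finType) (M : monoidType) (h : word S -> M) (L : set (word S)).
Hypothesis hm : word_morphism h.
Implicit Types x y z w p : word S.

Lemma theta_refl x : theta h L x x. Proof. by []. Qed.
Lemma theta_sym x y : theta h L x y -> theta h L y x.
Proof. by case=> cE hE. Qed.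
Lemma theta_trans x y z : theta h L x y -> theta h L y z -> theta h L x z.
Proof. by move=> [c1 h1] [c2 h2]; split; [rewrite c1|rewrite h1]. Qed.

Lemma contextsE x u v : contexts L x (u, v) = L (u ++ x ++ v).
Proof. by []. Qed.

Lemma theta_context x y u v : theta h L x y -> L (u ++ x ++ v) -> L (u ++ y ++ v).
Proof. by move=> [cE _]; rewrite -2!contextsE cE. Qed.

Lemma theta_in x y : theta h L x y -> L x -> L y.
Proof. by move=> xy; have := @theta_context x y [::] [::] xy; rewrite /= !cats0. Qed.

Lemma theta_cat x x' y y' :
  theta h L x x' -> theta h L y y' -> theta h L (x ++ y) (x' ++ y').
Proof.
move=> tx ty; split; last by rewrite !(proj2 hm) (proj2 tx) (proj2 ty).
have half a a' b b' (ta : theta h L a a') (tb : theta h L b b') :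
    contexts L (a ++ b) `<=` contexts L (a' ++ b').
  move=> [u v]; rewrite !contextsE -catA => /(theta_context ta).
  by rewrite catA => /(theta_context tb); rewrite -!catA.
by apply/seteqP; split; apply: half => //; exact: theta_sym.
Qed.

Lemma rclass_eq x y : theta h L x y -> rclass h L x = rclass h L y.
Proof.
move=> xy; apply/seteqP; split=> z; first exact: theta_trans (theta_sym xy).
exact: theta_trans.
Qed.

Lemma rclassP x y : (rclass h L x = rclass h L y) <-> theta h L x y.
Proof.
split=> [e|]; last exact: rclass_eq.
by have yy : rclass h L y y := theta_refl y; rewrite -e in yy.
Qed.

Lemma is_rclassP X x : is_rclass h L X -> X x -> X = rclass h L x.
Proof. by move=> [y ->] /rclass_eq. Qed.

Lemma star_rclass x y : star h L (rclass h L x) (rclass h L y) = rclass h L (x ++ y).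
Proof.
apply/seteqP; split=> [z [x' [y' [xx' yy']]]|z xyz].
  by apply: theta_trans; apply: theta_cat.
by exists x, y; split=> //; exact: theta_refl.
Qed.

Lemma live_theta x : live L (rclass h L x) <-> exists c, L (c.1 ++ x ++ c.2).
Proof.
split=> [/(_ x (theta_refl x))[[u v] Luv]|[[u v] Luv] y [xy _]]; first by exists (u, v).
by rewrite -xy; exists (u, v).
Qed.

Hypothesis sub : substitutable h L.

Definition similar (c : word S * word S) x y : Prop :=
  h x = h y /\ L (c.1 ++ y ++ c.2).

(** The known context c of x is also one of y, which is the common context that substitutability
    asks for. *)
Lemma similarP c x y : L (c.1 ++ x ++ c.2) -> similar c x y <-> theta h L x y.
Proof.
case: c => u v /= Lx; split=> [[hxy Ly]|xy].
  by split=> //; apply: sub => //; exists (u, v).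
by split; [exact: (proj2 xy) | exact: theta_context xy _].
Qed.

Hypothesis sep : unit_separated h L.

Lemma unit_theta x : theta h L [::] x <-> x = [::].
Proof. by move/seteqP: sep => [s1 _]; split=> [/s1|->] //; exact: theta_refl. Qed.

(** The list f is a finite certificate of primality, with a counterexample p' for each proper
    splitting of p. Contexts of the factors x and y arise from c by absorbing the other factor, so
    their classes are tested in the same way as that of p. *)
Definition irreducible (f : seq (word S)) c p : Prop :=
  p <> [::] /\ L (c.1 ++ p ++ c.2) /\
  forall x y, p = x ++ y -> x <> [::] -> y <> [::] ->
    exists p', p' \in f /\ (similar c p p' /\
      forall x' y', p' = x' ++ y' ->
        ~ (similar (c.1, y ++ c.2) x x' /\ similar (c.1 ++ x, c.2) y y')).

(** If [p] = X·Y, then p itself splits into some x in X and y in Y, so X = [x] and Y = [y]; the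
    counterexample stored for this splitting would have to split likewise. *)
Lemma irreducible_prime f c p : irreducible f c p -> is_prime h L (rclass h L p).
Proof.
move=> [p0 [Lp irr]]; split; first by exists p.
- by apply/live_theta; exists c.
- by move=> /rclassP/theta_sym/unit_theta.
move=> X Y cX cY PXY.
have [x Xx [y Yy xyE]] : setcat X Y p by rewrite -PXY; exact: theta_refl.
rewrite (is_rclassP cX Xx) (is_rclassP cY Yy).
case: (pselect (x = [::])) => [->|x0]; first by left.
case: (pselect (y = [::])) => [->|y0]; first by right.
have [p' [_ [sp' nsplit]]] := irr x y (esym xyE) x0 y0.
have := proj1 (similarP _ Lp) sp'.
rewrite -[theta h L p p']/(rclass h L p p') PXY => -[x' Xx' [y' Yy' e]].
have Lx : L (c.1 ++ x ++ (y ++ c.2)) by rewrite [x ++ _]catA xyE.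
have Ly : L ((c.1 ++ x) ++ y ++ c.2) by rewrite -catA [x ++ _]catA xyE.
exfalso; apply: (nsplit x' y' (esym e)); split.
  by apply/(similarP (c := (c.1, y ++ c.2)) x' Lx); rewrite (is_rclassP cX Xx) in Xx'.
by apply/(similarP (c := (c.1 ++ x, c.2)) y' Ly); rewrite (is_rclassP cY Yy) in Yy'.
Qed.

Lemma prime_nonempty p : is_prime h L (rclass h L p) -> p <> [::].
Proof. by move=> [_ _ nunit _] p0; apply: nunit; rewrite p0. Qed.

(** For nonempty x and y, unit separation keeps [x] and [y] apart from the unit class, so primality
    denies [p] = [x]·[y]. As [x]·[y] is contained in [p] by congruence, some p' in [p] is left
    over. *)
Lemma prime_irreducible c p : is_prime h L (rclass h L p) -> L (c.1 ++ p ++ c.2) ->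
  exists f, irreducible f c p.
Proof.
move=> pr Lp; have p0 := prime_nonempty pr; case: (pr) => _ _ _ irr.
pose good xy p' := similar c p p' /\ forall x' y', p' = x' ++ y' ->
  ~ (similar (c.1, xy.2 ++ c.2) xy.1 x' /\ similar (c.1 ++ xy.1, c.2) xy.2 y').
have ex (xy : word S * word S) : exists p', p = xy.1 ++ xy.2 -> xy.1 <> [::] -> xy.2
  <> [::] -> good xy p'.
  case: xy => x y /=.
  apply: contrapT => nex.
  have [pE x0 y0] : [/\ p = x ++ y, x <> [::] & y <> [::]].
    by split; apply: contrapT => no; apply: nex; exists [::] => *; case: no.
  have [] : rclass h L x = unit_class h L \/ rclass h L y = unit_class h L;
    last 2 first.
  - by move=> /rclassP/theta_sym/unit_theta.
  - by move=> /rclassP/theta_sym/unit_theta.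
  apply: irr; [by exists x|by exists y|].
  apply/seteqP; split=> [p' pp'|_ [x' xx' [y' yy' <-]]]; last first.
    by rewrite /rclass /= pE; apply: theta_cat.
  apply: contrapT => nsplit; apply: nex; exists p' => _ _ _.
  split=> [|x' y' p'E [sx sy]]; first exact/similarP.
  have Lx : L (c.1 ++ x ++ (y ++ c.2)) by rewrite [x ++ _]catA -pE.
  have Ly : L ((c.1 ++ x) ++ y ++ c.2) by rewrite -catA [x ++ _]catA -pE.
  apply: nsplit; exists x'; first exact/(similarP (c := (c.1, y ++ c.2)) x' Lx).
  by exists y'; first exact/(similarP (c := (c.1 ++ x, c.2)) y' Ly).
have [g gP] := choice ex.
exists [seq g xy | xy <- splits p]; split=> //; split=> // x y pE x0 y0.
exists (g (x, y)); split; last exact: (gP (x, y)).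
by apply: map_f; rewrite mem_splits pE.
Qed.

(** * Names of primes, valid sequences and their residuals *)

Hypothesis finP : finite_set [set P | is_prime h L P].

Let nm := @name S M h L.
Let names := prime_names h L.

Lemma nameP (P : rprime h L) :
  sval P (nm P) /\ forall v, sval P v -> word_le (nm P) v.
Proof.
apply: (@shortlex_leastP _ _ (enum S)).
- exact: letter_le_total.
- exact: letter_le_trans.
- exact: letter_le_anti.
- by have [[x Px] _ _ _] := svalP P; exists x; rewrite Px; exact: theta_refl.
- by move=> w _ a _; rewrite mem_enum.
Qed.

Lemma name_class P : sval P = rclass h L (nm P).
Proof. by apply: is_rclassP (proj1 (nameP P)); have [] := svalP P. Qed.

Lemma name_inj : injective nm.
Proof.
move=> P Q e; have : sval P = sval Q by rewrite !name_class e.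
by case: P Q {e} => P pP [Q pQ] /= e; subst Q; congr exist; exact: Prop_irrelevance.
Qed.

Lemma finite_names : finite_set (range nm).
Proof.
apply: sub_finite_set (finite_image (shortlex_least (@letter_le S)) finP).
by move=> _ [[P pP] _ <-]; exists P.
Qed.

Lemma mem_names w : w \in names <-> exists P, nm P = w.
Proof.
rewrite /names /prime_names mem_sort in_fset_set; last exact: finite_names.
split=> [/set_mem[P _ <-]|[P <-]]; first by exists P.
by apply: mem_set; exists P.
Qed.

Lemma names_prime p : p \in names -> is_prime h L (rclass h L p).
Proof. by move=> /mem_names[P <-]; rewrite -name_class; case: P. Qed.

Lemma prime_names_ex p : is_prime h L (rclass h L p) ->
  exists2 q, q \in names & theta h L q p.
Proof.
move=> pr; pose P : rprime h L := exist _ _ pr.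
exists (nm P); first by apply/mem_names; exists P.
by apply/theta_sym; have [] := nameP P.
Qed.

Lemma over_names (u : seq (word S)) : word_over names u <-> exists a, map nm a = u.
Proof.
split=> [|[a <-] w]; last first.
  elim: a => //= P a IHa; rewrite inE => /orP[/eqP ->|]; last exact: IHa.
  by apply/mem_names; exists P.
elim: u => [|p u IHu] ou; first by exists [::].
have /mem_names[P <-] := ou p (mem_head _ _).
have [|a <-] := IHu; first by move=> q qu; apply: ou; rewrite inE qu orbT.
by exists (P :: a).
Qed.

Lemma eval_names a : eval a = rclass h L (flatten (map nm a)).
Proof. by elim: a => //= P a ->; rewrite name_class star_rclass. Qed.

(** [Val] read through names. A block is reached by two successive splittings, because the bounded
    quantifiers treat one splitting at a time. *)
Definition valid p : set (seq (word S)) := [set a | word_over names a /\ (2 <= size a /\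
  (theta h L p (flatten a) /\
   forall l t, a = l ++ t -> forall b r, t = b ++ r -> 2 <= size b -> size b < size a ->
     ~ is_prime h L (rclass h L (flatten b))))].

Lemma Val_valid P a : Val P a <-> valid (nm P) (map nm a).
Proof.
rewrite /Val /correct /valid /= size_map eval_names name_class; split.
  move=> [[s2 /rclassP aP] blk]; split; first by apply/over_names; exists a.
  split=> //; split; first exact: theta_sym.
  move=> l t aE b r tE sb lt_b; rewrite -[b]/b.
  pose i := size l; pose j := size b.
  have bE : b = map nm (take j (drop i a)).
    by rewrite map_take map_drop aE drop_size_cat // tE take_size_cat.
  have aE' : a = take i a ++ take j (drop i a) ++ drop j (drop i a).
    by rewrite !cat_take_drop.
  rewrite bE -eval_names; apply: blk aE' _ _.
    by rewrite -(size_map nm) -bE.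
  by rewrite -(size_map nm) -bE.
move=> [_ [s2 [/theta_sym/rclassP aP blk]]]; split=> // l b r aE sb lt_b.
rewrite eval_names; apply: (blk (map nm l) (map nm b ++ map nm r) _ (map nm b)
  (map nm r)) => //.
- by rewrite aE !map_cat.
- by rewrite size_map.
- by rewrite size_map.
Qed.

Lemma valid_over p u v : valid p (u ++ v) -> word_over names u /\ word_over names v.
Proof.
move=> [o _]; split=> x xu; apply: o; rewrite mem_cat xu ?orbT //.
Qed.

Lemma image_lquot P u :
  [set map nm a | a in lquot u (Val P)] = lquot (map nm u) (valid (nm P)).
Proof.
apply/seteqP; split=> [_ [a /Val_valid Va <-]|a Va].
  by rewrite /lquot /= -map_cat.
have [_ /over_names[b bE]] := valid_over Va.
by exists b => //; apply/Val_valid; rewrite map_cat bE.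
Qed.

Lemma residual_nonempty P u :
  lquot u (Val P) !=set0 <-> lquot (map nm u) (valid (nm P)) !=set0.
Proof.
rewrite -image_lquot; split=> [[a Va]|[_ [a Va _]]]; last by exists a.
by exists (map nm a); exists a.
Qed.

Definition code p u : dfa := min_dfa (@word_le S) names (lquot u (valid p)).

Lemma residual_codeE P u : residual_code (lquot u (Val P)) = code (nm P) (map nm u).
Proof. by rewrite /residual_code image_lquot. Qed.

Lemma valid_finite_index p u : FSRP h L -> p \in names ->
  finite_index names (lquot u (valid p)).
Proof.
move=> [_ reg] /mem_names[P <-].
(* If u is not a sequence of names, the residual is empty and a single representative suffices.
   Otherwise the automaton of [Val P] is started in the state reached by u. *)
have [ou|nou] := pselect (word_over names u); last first.
  exists [:: [::]] => v _; exists [::]; rewrite ?mem_head //; split=> //.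
  apply/seteqP; split=> w; rewrite /lquot /=.
    by move=> /valid_over[].
  by move=> /valid_over[].
have [Q [q0 [step [F KF]]]] := reg P.
(* A partial inverse of naming lets the automaton over primes read words; a word that is no name
   leaves the state unchanged. *)
have /choice[g gP] (w : word S) : exists Po : option (rprime h L),
    forall P, nm P = w -> Po = Some P.
  have [[P' <-]|no] := pselect (exists P', nm P' = w).
    by exists (Some P') => P'' /name_inj ->.
  by exists None => P'' e; case: no; exists P''.
pose step' q w := if g w is Some P' then step q P' else q.
have stepE q a : foldl step' q (map nm a) = foldl step q a.
  by elim: a q => //= P' a IHa q; rewrite IHa /step' (gP _ P').
apply: regular_finite_index => [|w Vw]; last by have [] := valid_over Vw.
have /over_names[u' u'E] := ou.
exists Q, (foldl step' q0 u), step', F => w /over_names[a <-].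
by rewrite -foldl_cat -u'E -map_cat stepE -KF Val_valid map_cat.
Qed.

(** A nonempty residual forces u to consist of names, so letting u range over all sequences of words
    on the right gives the same set. *)
Lemma residual_codes :
  [set residual_code R | R in residuals h L] =
  [set c | exists p u, p \in names /\ (lquot u (valid p) !=set0 /\ c = code p u)].
Proof.
apply/seteqP; split=> [_ [_ [P [u [-> ne]]] <-]|c [p [u [/mem_names[P <-] [ne ->]]]]].
  exists (nm P), (map nm u); split; first by apply/mem_names; exists P.
  by split; [apply/residual_nonempty | exact: residual_codeE].
have [a Va] := ne; have [/over_names[u' u'E] _] := valid_over Va.
exists (lquot u' (Val P)); last by rewrite residual_codeE u'E.
by exists P, u'; split=> //; apply/residual_nonempty; rewrite u'E.
Qed.

Lemma residual_final_codes :
  [set residual_code R | R in [set R | residuals h L R /\ R [::]]] =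
  [set c | exists p u, p \in names /\ (valid p u /\ c = code p u)].
Proof.
apply/seteqP; split=> [_ [_ [[P [u [-> ne]]] e] <-]|c [p [u [/mem_names[P <-] [Vu
  ->]]]]].
  exists (nm P), (map nm u); split; first by apply/mem_names; exists P.
  split; last exact: residual_codeE.
  by move: e; rewrite /lquot /= cats0 => /Val_valid.
have [/over_names[u' u'E] _] : word_over names u /\ word_over names [::].
  by apply: (@valid_over (nm P)); rewrite cats0.
have Vu' : Val P u' by apply/Val_valid; rewrite u'E.
exists (lquot u' (Val P)); last by rewrite residual_codeE u'E.
split; last by rewrite /lquot /= cats0.
by exists P, u'; split=> //; exists [::]; rewrite /lquot /= cats0.
Qed.

Lemma lquot_rcons (T : Type) (u : seq T) a K : lquot (rcons u a) K = lquot [:: a]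
  (lquot u K).
Proof. by rewrite -cats1 lquot_cat. Qed.

(* [Z] stands for the shape of what is built from a transition, so that the
   presentation and the grammar rules are treated alike. *)
Lemma residual_transP (Z : dfa -> word S -> dfa -> Prop) :
  (exists R A, [/\ residuals h L R, lquot [:: A] R !=set0 &
     Z (residual_code R) (nm A) (residual_code (lquot [:: A] R))]) <->
  (exists p u a, p \in names /\ (lquot (rcons u a) (valid p) !=set0 /\
     Z (code p u) a (code p (rcons u a)))).
Proof.
split=> [[_ [A [[P [u [-> _]]]]]]|[p [u [a [/mem_names[P <-] [ne]]]]]].
  rewrite -lquot_rcons => ne; rewrite !residual_codeE map_rcons => z.
  exists (nm P), (map nm u), (nm A); split; first by apply/mem_names; exists P.
  by split=> //; rewrite -map_rcons; apply/residual_nonempty.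
have [b Vb] := ne; have [/over_names[u' u'E] _] := valid_over Vb.
case/lastP: u' u'E => [/(congr1 size)|u' A]; first by rewrite size_rcons.
rewrite map_rcons => /rcons_inj[uE aE]; subst u a => z.
exists (lquot u' (Val P)), A; rewrite -lquot_rcons !residual_codeE map_rcons.
have ne' : lquot (rcons u' A) (Val P) !=set0 by apply/residual_nonempty;
  rewrite map_rcons.
split=> //; exists P, u'; split=> //.
by have [c] := ne'; rewrite lquot_rcons => Vc; exists (A :: c).
Qed.

Lemma residual_stopP (Z : dfa -> word S -> Prop) :
  (exists R A, [/\ residuals h L R, lquot [:: A] R [::] & Z (residual_code R)
    (nm A)]) <->
  (exists p u a, p \in names /\ (valid p (rcons u a) /\ Z (code p u) a)).
Proof.
split=> [[_ [A [[P [u [-> _]]]]]]|[p [u [a [/mem_names[P <-] [Vu]]]]]].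
  rewrite -lquot_rcons /lquot /= cats0 => /Val_valid; rewrite map_rcons => Vu.
  rewrite -/(lquot u (Val P)) residual_codeE => z.
  by exists (nm P), (map nm u), (nm A); split; first by apply/mem_names; exists P.
have [/over_names[u' u'E] _] : word_over names (rcons u a) /\ word_over names [::].
  by apply: (@valid_over (nm P)); rewrite cats0.
case/lastP: u' u'E => [/(congr1 size)|u' A]; first by rewrite size_rcons.
rewrite map_rcons => /rcons_inj[uE aE]; subst u a => z.
have Vu' : Val P (rcons u' A) by apply/Val_valid; rewrite map_rcons.
exists (lquot u' (Val P)), A; rewrite -lquot_rcons !residual_codeE.
split=> //; last by rewrite /lquot /= cats0.
by exists P, u'; split=> //; exists [:: A]; rewrite /lquot /= cats1.
Qed.

Lemma lexP p a : (exists P, sval P [:: a] /\ p = nm P) <->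
  (p \in names /\ theta h L p [:: a]).
Proof.
split=> [[P [Pa ->]]|[/mem_names[P <-]] pa].
  by split; [apply/mem_names; exists P | move: Pa; rewrite name_class].
by exists P; rewrite name_class.
Qed.

Fixpoint factors (a : seq (word S)) (w : word S) : Prop :=
  if a is p :: a' then exists x y, w = x ++ y /\ (theta h L p x /\ factors a' y)
  else w = [::].

Lemma concatP a w : concat a w <-> factors (map nm a) w.
Proof.
elim: a w => //= P a IHa w; split.
  move=> [x Px [y /IHa Cy <-]]; exists x, y; split=> //; split=> //.
  by move: Px; rewrite name_class.
move=> [x [y [-> [Px /IHa Cy]]]]; exists x; first by rewrite name_class.
by exists y.
Qed.

Lemma factors_theta a w : factors a w -> theta h L (flatten a) w.
Proof.
elim: a w => [|p a IHa] w /=; first by move=> ->.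
by move=> [x [y [-> [px /IHa ay]]]]; exact: theta_cat.
Qed.

(** By unit separation the empty word is congruent to no name, hence each factor takes at least one
    letter of w. This bounds the search for exact factorizations. *)
Lemma factors_size a w : word_over names a -> factors a w -> size a <= size w.
Proof.
elim: a w => [|p a IHa] w //= oa [x [y [-> [px fy]]]].
have oa' : word_over names a by move=> q qa; apply: oa; rewrite inE qa orbT.
have /names_prime/prime_nonempty p0 := oa p (mem_head _ _).
have x0 : 0 < size x by case: x px => // /theta_sym/unit_theta.
by rewrite size_cat -add1n; apply: leq_add x0 (IHa _ oa' fy).
Qed.

(** The product of the named classes is always contained in the class of [flatten a], so exactness
    is the reverse inclusion; and a class meeting L lies in L, so acceptance is the membership of
    one word. The empty start alternative falls under the same clauses, the unit class being the
    singleton of the empty word. *)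
Definition starts : set (seq (word S)) := [set a | word_over names a /\ (L
  (flatten a) /\
  forall w, theta h L (flatten a) w -> factors a w)].

Lemma start_factorizationsE :
  [set map nm a | a in start_factorizations h L] = starts.
Proof.
have key a X : is_rclass h L X -> concat a = X ->
    X = rclass h L (flatten (map nm a)) /\ X (flatten (map nm a)).
  move=> cX aX; have Xf : X (flatten (map nm a)).
    rewrite -aX; apply/concatP; elim: (a) => //= P b IHb.
    by exists (nm P), (flatten (map nm b)); split=> //; split=> //; exact: theta_refl.
  by split=> //; exact: is_rclassP.
apply/seteqP; split=> [_ [a Sa <-]|a [/over_names[b <-] [La fa]]].
  split; first by apply/over_names; exists a.
  case: Sa => [[a0 [X [cX acc nu aX]]]|[-> L0]]; last first.
    by split=> //= w /unit_theta.
  have [XE Xf] := key _ _ cX aX; split; first exact: acc.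
  by move=> w; rewrite -[theta _ _ _ _]/(rclass h L _ w) -XE -aX => /concatP.
exists b => //; case: b La fa => [|P b] La fa; [right|left]; split=> //.
set c := P :: b in La fa *.
have cE : concat c = rclass h L (flatten (map nm c)).
  by apply/seteqP; split=> w; [move/concatP/factors_theta | move/fa/concatP].
exists (rclass h L (flatten (map nm c))); split=> //; first by eexists.
- by move=> w aw; exact: theta_in aw La.
move=> /rclassP/theta_sym/unit_theta /= /(congr1 size); rewrite size_cat.
have /names_prime/prime_nonempty : nm P \in names by apply/mem_names; exists P.
by case: (nm P).
Qed.

End Classes.

(** * A Sigma_2 description of the canonical presentation *)

Ltac pi1_app := match goal with
  | H : Pi1 ?f |- @Pi1 ?T _ =>
    lazymatch f with fun _ => _ => fail | _ => idtac end;
    apply: (@pi1_comp T _ f _ H)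
  end.
Ltac sigma1_app := match goal with
  | H : Sigma1 ?f |- @Sigma1 ?T _ =>
    lazymatch f with fun _ => _ => fail | _ => idtac end;
    apply: (@sigma1_comp T _ f _ H)
  | H : Pi1 ?f |- @Sigma1 ?T (fun t => ~ _) =>
    apply: sigma1_not; apply: (@pi1_comp T _ f _ H)
  end.
Ltac sigma2_app := match goal with
  | H : Sigma2 ?f |- @Sigma2 ?T _ =>
    lazymatch f with fun _ => _ => fail | _ => idtac end;
    apply: (@sigma2_comp T _ f _ H)
  end.
Ltac prove_pi1 := cbv beta; first
  [ solve [apply: pi1_dec; decidability]
  | pi1_app; solve [decidability]
  | apply: pi1_and; prove_pi1 | apply: pi1_or; prove_pi1
  | apply: pi1_allin; [solve [decidability]|solve [decidability]|prove_pi1]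
  | apply: pi1_exin; [solve [decidability]|prove_pi1]
  | apply: pi1_imp; [prove_sigma1|prove_pi1]
  | apply: pi1_all; [solve [decidability]|prove_pi1] ]
with prove_sigma1 := cbv beta; first
  [ solve [apply: sigma1_dec; decidability]
  | sigma1_app; solve [decidability]
  | apply: sigma1_and; prove_sigma1 | apply: sigma1_or; prove_sigma1
  | apply: sigma1_allin; [solve [decidability]|prove_sigma1]
  | apply: sigma1_ex; [solve [decidability]|prove_sigma1] ].
(** A formula is tried as a whole in Pi1 and in Sigma1 before its outer connective is opened: an
    unbounded universal quantifier has to end up inside a Pi1 part. *)
Ltac prove_sigma2 := cbv beta; first
  [ solve [apply: sigma2_dec; decidability]
  | sigma2_app; solve [decidability]
  | solve [apply: sigma2_p1; prove_pi1]
  | solve [apply: sigma2_s1; prove_sigma1]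
  | apply: sigma2_and; prove_sigma2 | apply: sigma2_or; prove_sigma2
  | apply: sigma2_allin; [solve [decidability]|solve [decidability]|prove_sigma2]
  | apply: sigma2_ex; [solve [decidability]|prove_sigma2] ].

(** * The certifying data and their tests *)

Section Data.
Variables (S : finType) (M : monoidType) (h : word S -> M).
Hypotheses (finM : finite_set [set: M]) (hm : word_morphism h).

Local Notation W := (word S).
Local Notation grammar := (cfg nat S).
(* A word naming a prime, a context of this word, and a list of words showing
   that its class is prime. *)
Definition prime_datum : countType := (W * (W * W) * seq W)%type.
(* A word naming a prime P, a sequence u, and the code of u^-1 Val_P. *)
Definition residual_datum : countType := (W * seq W * dfa)%type.
Definition trans_datum : countType := (residual_datum * W * residual_datum)%type.

(** The notions are restated as predicates of one tuple, the shape suited to the closure properties.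
    Classes are now accessed only through membership in the language of the grammar and through
    contexts carried by the data. *)
Definition lang_test (q : grammar * W) : Prop := cfg_lang q.1 q.2.
Definition morphism_test (q : W * W) : Prop := h q.1 = h q.2.
Definition word_le_test (q : W * W) : bool := word_le q.1 q.2.
Definition words_le_test (q : seq W * seq W) : bool := shortlex (@word_le S) q.1 q.2.

Definition similar_test (q : grammar * (W * W) * W * W) : Prop :=
  morphism_test (q.1.2, q.2) /\ lang_test (q.1.1.1, q.1.1.2.1 ++ q.2 ++ q.1.1.2.2).

Definition irreducible_test (q : grammar * prime_datum) : Prop :=
  q.2.1.1 <> [::] /\ (lang_test (q.1, q.2.1.2.1 ++ q.2.1.1 ++ q.2.1.2.2) /\
  forall x y, q.2.1.1 = x ++ y -> x <> [::] -> y <> [::] ->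
    exists p, p \in q.2.2 /\ (similar_test (q.1, q.2.1.2, q.2.1.1, p) /\
      forall x' y', p = x' ++ y' ->
        ~ (similar_test (q.1, (q.2.1.2.1, y ++ q.2.1.2.2), x, x') /\
           similar_test (q.1, (q.2.1.2.1 ++ x, q.2.1.2.2), y, y')))).

Definition data_names (s : seq prime_datum) : seq W := [seq e.1.1 | e <- s].

Definition class_test (q : grammar * seq prime_datum * W * W) : Prop :=
  exists e, e \in q.1.1.2 /\ (e.1.1 = q.1.2 /\ similar_test
    (q.1.1.1, e.1.2, q.1.2, q.2)).

Definition prime_test (q : grammar * seq prime_datum * W) : Prop :=
  exists e, e \in q.1.2 /\ similar_test (q.1.1, e.1.2, e.1.1, q.2).

Definition over_test (q : seq prime_datum * seq W) : Prop :=
  forall x, x \in q.2 -> x \in data_names q.1.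

Definition valid_test (q : grammar * seq prime_datum * W * seq W) : Prop :=
  over_test (q.1.1.2, q.2) /\ (2 <= size q.2 /\
  (class_test (q.1.1.1, q.1.1.2, q.1.2, flatten q.2) /\
  forall l t, q.2 = l ++ t -> forall b r, t = b ++ r -> 2 <= size b -> size b < size
    q.2 ->
    ~ prime_test (q.1.1.1, q.1.1.2, flatten b))).

(** A fold takes the place of the recursion with existential quantifiers in [factors]: it carries
    the list of all possible remainders of the word after the primes read so far. *)
Definition factors_step (q : grammar * seq prime_datum) (rs : seq W) (p : W) : seq W :=
  flatten [seq [seq xy.2 | xy <- splits r & `[< class_test
    (q.1, q.2, p, xy.1) >]] | r <- rs].

Definition factors_test (q : grammar * seq prime_datum * seq W * W) : Prop :=
  [::] \in foldl (factors_step q.1.1) [:: q.2] q.1.2.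

(** Primality of a word is witnessed by a certificate, so the completeness of the list can be stated
    as a Pi1 condition, by quantifying over all certificates e rather than over all primes. *)
Definition primes_ok (q : grammar * seq prime_datum) : Prop :=
  (forall e, e \in q.2 -> irreducible_test (q.1, e)) /\
  ((forall v, forall e, e \in q.2 -> similar_test (q.1, e.1.2, e.1.1, v) ->
      word_le_test (e.1.1, v)) /\
  ((forall e, irreducible_test (q.1, e) -> prime_test (q.1, q.2, e.1.1)) /\
  increasing (@word_le S) (data_names q.2))).

(** A pair (p, u) stands for the residual by u of the valid sequences of the prime named p. *)
Definition same_residual
    (q : grammar * seq prime_datum * (W * seq W) * (W * seq W)) : Prop :=
  forall z, valid_test (q.1.1, q.1.2.1, q.1.2.2 ++ z) <->
            valid_test (q.1.1, q.2.1, q.2.2 ++ z).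

(** [table_ok] for this residual. The inequivalence of different states is a Sigma1 condition while
    the equalities are Pi1, hence the level Sigma2. *)
Definition table_test (q : grammar * seq prime_datum * W * seq W *
    seq (seq W * bool * seq (W * seq W))) : Prop :=
  increasing (shortlex (@word_le S)) (table_states q.2) /\
  ((forall v, v \in table_states q.2 -> over_test (q.1.1.1.2, v)) /\
  ((forall u, over_test (q.1.1.1.2, u) -> exists v, v \in table_states q.2 /\
     (same_residual (q.1.1.1, (q.1.1.2, q.1.2 ++ u), (q.1.1.2, q.1.2 ++ v)) /\
      words_le_test (v, u))) /\
  ((forall v, v \in table_states q.2 -> forall w, w \in table_states q.2 ->
     v = w \/ ~ same_residual (q.1.1.1, (q.1.1.2, q.1.2 ++ v),
       (q.1.1.2, q.1.2 ++ w))) /\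
  (forall x, x \in q.2 ->
     (x.1.2 <-> valid_test (q.1.1.1, q.1.1.2, q.1.2 ++ x.1.1)) /\
     ([seq y.1 | y <- x.2] = data_names q.1.1.1.2 /\
     forall y, y \in x.2 -> y.2 \in table_states q.2 /\
       same_residual (q.1.1.1, (q.1.1.2, q.1.2 ++ rcons x.1.1 y.1),
         (q.1.1.2, q.1.2 ++ y.2))))))).

Definition code_test (q : grammar * seq prime_datum * W * seq W * dfa) : Prop :=
  exists g, table_test (q.1, g) /\ q.2 = table_dfa g.

(** Residuals are listed up to equality, with some pair (p, u) for each. The last clause asks for
    the literal pair with empty u, from which the rule leading from a prime P to the state of Val_P
    is read off. *)
Definition residuals_ok (q : grammar * seq prime_datum * seq residual_datum) : Prop :=
  (forall x, x \in q.2 -> (exists v, valid_test (q.1, x.1.1, x.1.2 ++ v)) /\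
     code_test (q.1, x.1.1, x.1.2, x.2)) /\
  ((forall p, forall u, forall v, valid_test (q.1, p, u ++ v) ->
      exists x, x \in q.2 /\ same_residual (q.1, (p, u), (x.1.1, x.1.2))) /\
  (forall p, forall v, valid_test (q.1, p, v) ->
      exists x, x \in q.2 /\ (x.1.1 = p /\ x.1.2 = [::]))).

Definition trans_ok (q : grammar * seq prime_datum * seq residual_datum * seq
  trans_datum) : Prop :=
  (forall y, y \in q.2 -> y.1.1 \in q.1.2 /\ (y.2 \in q.1.2 /\
     same_residual (q.1.1, (y.1.1.1.1, rcons y.1.1.1.2 y.1.2), (y.2.1.1, y.2.1.2)))) /\
  (forall a, forall v, forall x, x \in q.1.2 ->
     valid_test (q.1.1, x.1.1, x.1.2 ++ a :: v) ->
     exists y, y \in q.2 /\ (y.1.1 = x /\ y.1.2 = a)).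

Definition start_test (q : grammar * seq prime_datum * seq W) : Prop :=
  over_test (q.1.2, q.2) /\ (lang_test (q.1.1, flatten q.2) /\
  forall w, similar_test (q.1.1, ([::], [::]), flatten q.2, w) ->
    factors_test (q.1.1, q.1.2, q.2, w)).

(* [xs] has a word of each class contained in the language, and [ys] all the
   sequences of primes that are not longer than some word of [xs]. *)
Definition starts_ok (q : grammar * seq prime_datum * seq W * seq (seq W) * seq
  (seq W)) : Prop :=
  let xs := q.1.1.2 in let ys := q.1.2 in let st := q.2 in
  (forall x, x \in xs -> lang_test (q.1.1.1.1, x)) /\
  ((forall w, lang_test (q.1.1.1.1, w) -> exists x, x \in xs /\ morphism_test (x, w)) /\
  ((forall a, over_test (q.1.1.1.2, a) ->
    (exists x, x \in xs /\ size a <= size x) -> a \in ys) /\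
  ((forall a, a \in ys -> (a \in st /\ start_test (q.1.1.1, a)) \/
                          (~ a \in st /\ ~ start_test (q.1.1.1, a))) /\
  (forall a, a \in st -> a \in ys)))).

Lemma dec_lang_test : dec lang_test.
Proof. exact: dec_cfg_lang effective_nat. Qed.

Lemma dec_morphism_test : dec morphism_test.
Proof. exact: dec_morphism finM hm. Qed.

Lemma computable_word_le_test : computable word_le_test.
Proof. exact: computable_shortlex (computable_letter_le S). Qed.

Lemma computable_words_le_test : computable words_le_test.
Proof. exact: computable_shortlex computable_word_le_test. Qed.

Lemma dec_similar_test : dec similar_test.
Proof. have := dec_lang_test; have := dec_morphism_test; rewrite /similar_test => *;
  decidability. Qed.

Lemma dec_irreducible_test : dec irreducible_test.
Proof. have := dec_lang_test; have := dec_similar_test;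
  rewrite /irreducible_test => *; decidability. Qed.

Lemma computable_data_names : computable data_names.
Proof. rewrite /data_names; decidability. Qed.

Lemma dec_class_test : dec class_test.
Proof. have := dec_similar_test; rewrite /class_test => *; decidability. Qed.

Lemma dec_prime_test : dec prime_test.
Proof. have := dec_similar_test; rewrite /prime_test => *; decidability. Qed.

Lemma dec_over_test : dec over_test.
Proof. have := computable_data_names; rewrite /over_test => *; decidability. Qed.

Lemma dec_valid_test : dec valid_test.
Proof.
have := dec_class_test; have := dec_prime_test; have := dec_over_test.
rewrite /valid_test => *; decidability.
Qed.

Lemma dec_factors_test : dec factors_test.
Proof.
have dc := dec_class_test; apply: dec_bool; apply: computable_mem;
  first by decidability.
apply: (computable_foldl (g := fun q => factors_step q.1.1.1 q.2.1 q.2.2));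
  try by decidability.
rewrite /factors_step; apply: computable_flatten; apply: computable_map;
  first by decidability.
apply: computable_map; last by decidability.
apply: computable_filter; first by decidability.
rewrite -/(dec _); cbv beta.
by apply: (dec_comp dc); decidability.
Qed.

Lemma dec_increasing_words : dec (increasing (@word_le S)).
Proof. exact: dec_increasing computable_word_le_test. Qed.

Lemma dec_increasing_seqs : dec (increasing (shortlex (@word_le S))).
Proof. exact: dec_increasing computable_words_le_test. Qed.

Lemma effective_grammar : effective grammar.
Proof. exact: effective_cfg effective_nat. Qed.
Lemma effective_dfa : effective dfa.
Proof. by have e : effective (seq (bool * seq nat)) by decidability. Qed.
Lemma effective_prime_datum : effective prime_datum.
Proof. by rewrite /prime_datum; decidability. Qed.
Lemma effective_residual_datum : effective residual_datum.
Proof. by have e := effective_dfa; rewrite /residual_datum; decidability. Qed.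
Lemma effective_trans_datum : effective trans_datum.
Proof. by have e := effective_residual_datum; rewrite /trans_datum; decidability. Qed.

Lemma sigma2_primes_ok : Sigma2 primes_ok.
Proof.
have := dec_irreducible_test; have := dec_similar_test; have := dec_prime_test.
have := computable_word_le_test; have := dec_increasing_words;
  have := computable_data_names.
have := effective_prime_datum.
rewrite /primes_ok => *; prove_sigma2.
Qed.

Lemma pi1_same_residual : Pi1 same_residual.
Proof. have := dec_valid_test; rewrite /same_residual => *; prove_pi1. Qed.

Lemma computable_table_states : computable (@table_states W).
Proof. rewrite /table_states; decidability. Qed.

Lemma sigma2_table_test : Sigma2 table_test.
Proof.
have := computable_table_states; have := pi1_same_residual; have := dec_valid_test.
have := dec_over_test; have := computable_data_names; have := computable_words_le_test.
have := dec_increasing_seqs; rewrite /table_test => *.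
prove_sigma2.
Qed.

Lemma computable_table_dfa : computable (@table_dfa W).
Proof.
have := computable_table_states; rewrite /table_dfa => *.
apply: (computable_comp (g := fun s : seq (bool * seq nat) => (s : dfa)));
  first exact: computable_id.
decidability.
Qed.

Lemma sigma2_code_test : Sigma2 code_test.
Proof.
have := computable_table_dfa; have := sigma2_table_test; rewrite /code_test => *.
prove_sigma2.
Qed.

Lemma sigma2_residuals_ok : Sigma2 residuals_ok.
Proof.
have := sigma2_code_test; have := pi1_same_residual; have := dec_valid_test.
have := effective_residual_datum.
rewrite /residuals_ok => *; prove_sigma2.
Qed.

Lemma sigma2_trans_ok : Sigma2 trans_ok.
Proof.
have := pi1_same_residual; have := dec_valid_test.
have := effective_residual_datum; have := effective_trans_datum.
rewrite /trans_ok => *; prove_sigma2.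
Qed.

Lemma pi1_start_test : Pi1 start_test.
Proof.
have := dec_over_test; have := dec_lang_test; have := dec_similar_test.
have := dec_factors_test; rewrite /start_test => *; prove_pi1.
Qed.

(** [start_test] is Pi1, so on each member of the finite list [ys] the definition offers two cases,
    one Pi1 and one Sigma1, and Sigma2 is closed under their disjunction and under the bounded
    quantifier. *)
Lemma sigma2_starts_ok : Sigma2 starts_ok.
Proof.
have := pi1_start_test; have := dec_lang_test; have := dec_morphism_test.
have := dec_over_test; rewrite /starts_ok => *; prove_sigma2.
Qed.

Definition data : countType := (seq prime_datum * seq residual_datum *
  seq trans_datum * seq W * seq (seq W) * seq (seq W))%type.

Definition data_ok (q : grammar * data) : Prop :=
  primes_ok (q.1, q.2.1.1.1.1.1) /\
  (residuals_ok (q.1, q.2.1.1.1.1.1, q.2.1.1.1.1.2) /\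
  (trans_ok (q.1, q.2.1.1.1.1.1, q.2.1.1.1.1.2, q.2.1.1.1.2) /\
  starts_ok (q.1, q.2.1.1.1.1.1, q.2.1.1.2, q.2.1.2, q.2.2))).

Lemma sigma2_data_ok : Sigma2 data_ok.
Proof.
have := sigma2_primes_ok; have := sigma2_residuals_ok; have := sigma2_trans_ok.
have := sigma2_starts_ok; rewrite /data_ok => *; prove_sigma2.
Qed.

Definition data_lex (q : grammar * seq prime_datum) : seq (W * S) :=
  [seq x <- flatten [seq [seq (e.1.1, a) | a <- enum S] | e <- q.2]
  | `[< class_test (q.1, q.2, x.1, [:: x.2]) >]].

Definition data_final (q : grammar * seq prime_datum * seq residual_datum) :
    seq residual_datum :=
  [seq x <- q.2 | `[< valid_test (q.1.1, q.1.2, x.1.1, x.1.2) >]].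

Definition data_stop (q : grammar * seq prime_datum * seq trans_datum) :
    seq trans_datum :=
  [seq y <- q.2 | `[< valid_test (q.1.1, q.1.2, y.1.1.1.1, rcons y.1.1.1.2 y.1.2) >]].

Definition data_presentation (q : grammar * data) :=
  (data_names q.2.1.1.1.1.1,
   listing [set` data_lex (q.1, q.2.1.1.1.1.1)],
   listing [set` q.2.2],
   listing [set` [seq x.2 | x <- q.2.1.1.1.1.2]],
   listing [set` [seq (y.1.1.2, y.1.2, y.2.2) | y <- q.2.1.1.1.2]],
   listing [set` [seq x.2 | x <- data_final (q.1, q.2.1.1.1.1.1, q.2.1.1.1.1.2)]]).

Definition data_rules (q : grammar * data) : seq (nonterm S * seq (nonterm S + S)) :=
  [seq (nt_state S y.1.1.2, [:: inl (nt_prime y.1.2); inl (nt_state S y.2.2)])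
  | y <- q.2.1.1.1.2] ++
  [seq (nt_state S y.1.1.2, [:: inl (nt_prime y.1.2)])
  | y <- data_stop (q.1, q.2.1.1.1.1.1, q.2.1.1.1.2)] ++
  [seq (nt_prime x.1.1, [:: inl (nt_state S x.2)])
  | x <- [seq x <- q.2.1.1.1.1.2 | x.1.2 == [::]]] ++
  [seq (nt_prime x.1, [:: inr x.2]) | x <- data_lex (q.1, q.2.1.1.1.1.1)] ++
  [seq (nt_start S, [seq inl (nt_prime p) | p <- a]) | a <- q.2.2].

Definition data_output (q : grammar * data) :=
  (data_presentation q, (nt_start S, listing [set` data_rules q])).

Lemma computable_listing_of (T A : countType) (s : T -> seq A) : effective A ->
  computable s -> computable (fun t => listing [set` s t]).
Proof.
by move=> eA; apply: (computable_comp (g := fun s : seq A => listing [set` s]));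
  exact: computable_listing.
Qed.

Lemma computable_filter_dec (T A : countType) (s : T -> seq A) (P : T -> A -> Prop) :
  computable s -> dec (fun q : T * A => P q.1 q.2) ->
  computable (fun t => [seq x <- s t | `[< P t x >]]).
Proof. by move=> cs dP; apply: computable_filter. Qed.

Lemma computable_data_lex : computable data_lex.
Proof.
have := dec_class_test; rewrite /data_lex => *.
by apply: computable_filter_dec; decidability.
Qed.

Lemma computable_data_final : computable data_final.
Proof.
have := dec_valid_test; rewrite /data_final => *.
by apply: computable_filter_dec; decidability.
Qed.

Lemma computable_data_stop : computable data_stop.
Proof.
have := dec_valid_test; rewrite /data_stop => *.
by apply: computable_filter_dec; decidability.
Qed.

Lemma effective_nonterm : effective (nonterm S).
Proof. by have := effective_dfa; rewrite /nonterm => *; decidability. Qed.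

Lemma computable_data_rules : computable data_rules.
Proof.
have := computable_data_lex; have := computable_data_stop;
  rewrite /data_rules /nt_state /nt_prime => *.
decidability.
Qed.

Lemma computable_data_output : computable data_output.
Proof.
have := computable_data_lex; have := computable_data_final;
  have := computable_data_rules; have := computable_data_names.
have := effective_dfa; have := effective_nonterm.
rewrite /data_output /data_presentation => *.
repeat (first [apply: computable_pair | apply: computable_listing_of]); decidability.
Qed.

Lemma sigma2_output : Sigma2 (fun q : (grammar * (seq W * seq (W * S) * seq
  (seq W) * seq dfa *
         seq (dfa * W * dfa) * seq dfa * (nonterm S * seq (nonterm S * seq
           (nonterm S + S))))) =>
   exists d, data_ok (q.1, d) /\ q.2 = data_output (q.1, d)).
Proof.
have := computable_data_output; have := sigma2_data_ok;
  have := effective_residual_datum.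
have := effective_trans_datum; have := effective_prime_datum => *.
apply: sigma2_ex; first by rewrite /data; decidability.
prove_sigma2.
Qed.

End Data.

(** Presentation and grammar form one value, so a single search identifies both. They are kept as
    tuples, which have the same codes as the records. *)
Definition canonical_output (S : finType) (M : monoidType) (h : word S -> M)
    (L : set (word S)) :=
  (presentation_tuple (canonical_presentation h L),
   (nt_start S, cfg_rules (canonical_cfg h L))).

(** * Soundness and existence of the certifying data *)

Section Correctness.
Variables (S : finType) (M : monoidType) (h : word S -> M) (G : cfg nat S).
Local Notation L := (cfg_lang G).
Local Notation W := (word S).
Hypotheses (finM : finite_set [set: M]) (hm : word_morphism h).
Hypotheses (sub : substitutable h L) (sep : unit_separated h L).
Hypotheses (finP : finite_set [set P | is_prime h L P]) (reg : FSRP h L).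
Local Notation names := (prime_names h L).
Local Notation theta := (theta h L).
Local Notation valid := (valid h L).
Local Notation code := (code h L).

(** What the analysis of the remaining tests retains of [primes_ok]; the primality certificates are
    forgotten. *)
Definition primes_faithful (s : seq (prime_datum S)) : Prop :=
  data_names s = names /\ forall e, e \in s -> L (e.1.2.1 ++ e.1.1 ++ e.1.2.2).

Lemma least_name p : is_prime h L (rclass h L p) ->
  (forall v, theta p v -> word_le p v) -> p \in names.
Proof.
move=> pr min; apply/(mem_names finP); exists (exist _ _ pr).
have [pn le] := nameP (exist [eta is_prime h L] (rclass h L p) pr).
apply: (@word_le_anti S); rewrite min ?andbT //; apply: le; exact: theta_refl.
Qed.

Lemma names_eqP l : names = l <->
  increasing (@word_le S) l /\ range (@name S M h L) = [set` l].
Proof.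
apply: sort_enumP (finite_names finP); [exact: word_le_total|exact: word_le_trans|].
exact: word_le_anti.
Qed.

Lemma names_increasing : increasing (@word_le S) names.
Proof. by have /names_eqP[] : names = names by []. Qed.

(** A listed word is prime and least in its class, hence a name. Conversely a name has a
    certificate, so by completeness it is congruent to a listed word; both are least in the same
    class and therefore equal. *)
Lemma primes_ok_good s : primes_ok h (G, s) -> primes_faithful s.
Proof.
move=> [irr [min [cplt inc]]]; split; last by move=> e /irr[_ []].
have sE e v : e \in s -> similar h L e.1.2 e.1.1 v <-> theta e.1.1 v.
  by move=> /irr[_ [Le _]]; exact: similarP.
apply/esym/names_eqP; split=> //; apply/seteqP;
  split=> [w [P _ <-]|_ /mapP[e es ->]] /=; last first.
  have : e.1.1 \in names.
    apply: least_name; first exact: irreducible_prime (irr _ es).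
    by move=> v /(sE _ _ es); apply: (min v e es).
  by move=> /(mem_names finP)[P <-]; exists P.
set p := name P; have pr : is_prime h L (rclass h L p) by rewrite -name_class;
  exact: svalP.
have [_ lv _ _] := pr; have /live_theta[c Lp] := lv.
have [f irrp] := prime_irreducible hm sub sep pr Lp.
have [e [es /(sE _ _ es) ep]] := cplt (p, c, f) irrp.
suff <- : e.1.1 = p by apply/mapP; exists e.
have [_ le] := nameP P; apply: (@word_le_anti S); apply/andP; split.
  by apply: (min p e es); apply/sE.
by apply: le; rewrite name_class; exact: theta_sym.
Qed.

Lemma primes_ok_exists : exists s, primes_ok h (G, s).
Proof.
have /choice[g gP] (p : W) : exists cf : W * W * seq W,
    p \in names -> irreducible h L cf.2 cf.1 p.
  have [pn|] := boolP (p \in names); last by exists ([::], [::], [::]).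
  have pr := names_prime finP pn; have [_ lv _ _] := pr; have /live_theta[c Lp] := lv.
  by have [f irrp] := prime_irreducible hm sub sep pr Lp; exists (c, f).
pose s : seq (prime_datum S) := [seq (p, (g p).1, (g p).2) | p <- names].
have sE : data_names s = names by rewrite /data_names -map_comp map_id.
exists s; split; [|split; [|split]].
- by move=> _ /mapP[p pn ->]; exact: gP.
- move=> v _ /mapP[p pn ->] /= sim; have [_ [Lp _]] := gP _ pn.
  move: pn => /(mem_names finP)[P PE]; rewrite /word_le_test /= -PE.
  by have [_] := nameP P; apply; rewrite name_class PE; apply/(similarP sub _ Lp).
- move=> e /(irreducible_prime sub sep) pr.
  have [q qn qe] := prime_names_ex finP pr.
  exists (q, (g q).1, (g q).2); split; first by apply: map_f.
  by have [_ [Lq _]] := gP _ qn; exact/(similarP sub _ Lq).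
by rewrite sE; exact: names_increasing.
Qed.

Section Good.
Variable s : seq (prime_datum S).
Hypothesis gs : primes_faithful s.

Lemma class_testP p x : class_test h (G, s, p, x) <-> p \in names /\ theta p x.
Proof.
have [<- ctx] := gs; split=> [[e /= [es [<- sx]]]|[/mapP[e es ->]]].
  by split; [apply/mapP; exists e | exact: (proj1 (similarP sub _ (ctx _ es)) sx)].
by move=> px; exists e; split=> //; split=> //; apply/similarP => //; exact: ctx.
Qed.

Lemma prime_testP x : prime_test h (G, s, x) <-> is_prime h L (rclass h L x).
Proof.
have [sE ctx] := gs; split=> [[e [es sx]]|].
  rewrite -(rclass_eq (proj1 (similarP sub _ (ctx _ es)) sx)); apply: names_prime => //.
  by rewrite -sE; apply/mapP; exists e.
move=> /(prime_names_ex finP)[q]; rewrite -sE => /mapP[e es ->] ex.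
by exists e; split=> //; apply/similarP => //; exact: ctx.
Qed.

Lemma over_testP a : over_test (s, a) <-> word_over names a.
Proof. by have [<- _] := gs. Qed.

Lemma valid_testP p a : valid_test h (G, s, p, a) <-> p \in names /\ valid p a.
Proof.
rewrite /valid_test /=; split.
  move=> [/over_testP oa [s2 [/class_testP[pn pa] blk]]]; split=> //; split=> //;
    split=> //.
  split=> // l t aE b r tE sb lt_b /prime_testP; exact: (blk l t aE b r).
move=> [pn [/over_testP oa [s2 [pa blk]]]]; split=> //; split=> //; split.
  exact/class_testP.
by move=> l t aE b r tE sb lt_b /prime_testP; exact: (blk l t aE b r).
Qed.

Lemma factors_testP a w : word_over names a ->
  factors_test h (G, s, a, w) <-> factors h L a w.
Proof.
move=> oa; rewrite /factors_test /=.
have key rs : word_over names a -> [::] \in foldl (factors_step h (G, s)) rs a <->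
    exists r, r \in rs /\ factors h L a r.
  elim: a rs {oa} => [|p a IHa] rs oa /=.
    by split=> [nrs|[r [rrs <-]]] //; exists [::].
  rewrite IHa; last by move=> q qa; apply: oa; rewrite inE qa orbT.
  have pn := oa p (mem_head _ _); split.
    move=> [y [/flatten_mapP[r rrs /mapP[[x z]]]]].
    rewrite mem_filter /= mem_splits => /andP[/asboolP/class_testP[_ px] /eqP rE] -> az.
    by exists r; split=> //; exists x, z.
  move=> [r [rrs [x [y [rE [px ay]]]]]]; exists y; split=> //.
  apply/flatten_mapP; exists r => //; apply/mapP; exists (x, y) => //.
  rewrite mem_filter mem_splits /= rE eqxx andbT; apply/asboolP/class_testP.
  by [].
rewrite key //; split=> [[r []]|]; first by rewrite inE => /eqP ->.
by exists w; rewrite mem_head.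
Qed.

Lemma same_residualP p u p' u' : p \in names -> p' \in names ->
  same_residual h (G, s, (p, u), (p', u')) <-> lquot u (valid p) = lquot u' (valid p').
Proof.
move=> pn pn'; split=> [sr|e z].
  by apply/seteqP; split=> z Vz; have [sr1 sr2] := sr z;
   [have /valid_testP[] := sr1 (proj2 (valid_testP p _) (conj pn Vz))
   |have /valid_testP[] := sr2 (proj2 (valid_testP p' _) (conj pn' Vz))].
rewrite /= !valid_testP.
have : lquot u (valid p) z <-> lquot u' (valid p') z by rewrite e.
by rewrite /lquot /=; tauto.
Qed.

Lemma table_testP p u g : p \in names ->
  table_test h (G, s, p, u, g) <-> table_ok (@word_le S) names (lquot u (valid p)) g.
Proof.
move=> pn; have [sE _] := gs; rewrite /table_test /=.
have srE v w : same_residual h (G, s, (p, u ++ v), (p, u ++ w)) <->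
    lquot v (lquot u (valid p)) = lquot w (lquot u (valid p)).
  by rewrite same_residualP // !lquot_cat.
split=> [[inc [ov [rep [dst rows]]]]|[inc ov rep dst rows]].
  split=> //.
  - by move=> v /ov/over_testP.
  - move=> w /over_testP/rep[v [vg [/srE e le]]]; exists v; split=> //.
  - move=> v vg w wg; case: (dst v vg w wg) => [->|nsr]; first by left.
    by right=> /srE.
  move=> x xg; have [bE [nE yP]] := rows x xg; split=> //.
  - by rewrite bE valid_testP; split=> [[]|].
  - by rewrite nE.
  by move=> y /yP[yg /srE].
split=> //; split; first by move=> v /ov/over_testP.
split; first by move=> w /over_testP/rep[v [vg [/srE e le]]]; exists v.
split.
  move=> v vg w wg; case: (dst v vg w wg) => [->|ne]; first by left.
  by right=> /srE.
move=> x xg; have [bE nE yP] := rows x xg; split; last split.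
- by rewrite bE valid_testP; split=> [|[]].
- by rewrite sE.
by move=> y /yP[yg /srE].
Qed.

(** All correct tables yield the same automaton, and FSRP enters through the finite index that
    guarantees a correct table to exist. *)
Lemma code_testP p u c : p \in names ->
  code_test h (G, s, p, u, c) <-> c = code p u.
Proof.
move=> pn.
have fin := valid_finite_index hm finP u reg pn.
have tot := @word_le_total S; have tr := @word_le_trans S; have anti := @word_le_anti S.
split=> [[g [/(table_testP _ _ pn) ok /= ->]]|->].
  exact: table_min_dfa.
have [g ok gE] := table_exists tot tr anti fin.
by exists g; split; [apply/table_testP | rewrite /= gE].
Qed.

Definition residuals_spec (El : seq (residual_datum S)) : Prop :=
  [/\ forall x, x \in El -> [/\ x.1.1 \in names, lquot x.1.2 (valid x.1.1) !=set0 &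
        x.2 = code x.1.1 x.1.2],
      forall p u, p \in names -> lquot u (valid p) !=set0 ->
        exists2 x, x \in El & lquot u (valid p) = lquot x.1.2 (valid x.1.1) &
      forall p, p \in names -> valid p !=set0 ->
        exists2 x, x \in El & x.1.1 = p /\ x.1.2 = [::]].

Lemma residuals_okP El : residuals_ok h (G, s, El) <-> residuals_spec El.
Proof.
split=> [[own [cplt init]]|[own cplt init]].
  have ownP x : x \in El -> [/\ x.1.1 \in names, lquot x.1.2 (valid x.1.1) !=set0 &
      x.2 = code x.1.1 x.1.2].
    move=> /own /= [[v /valid_testP[pn Vv]] /(code_testP _ _ pn) cE].
    by split=> //; exists v.
  split=> // [p u pn [v Vv]|p pn [v Vv]].
    have [|x [xEl sr]] := cplt p u v; first exact/valid_testP.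
    have [xn _ _] := ownP _ xEl; exists x => //.
    exact: (proj1 (same_residualP u x.1.2 pn xn) sr).
  by have [|x [xEl xE]] := init p v; [exact/valid_testP | exists x].
split; [|split].
- move=> x /own[pn [v Vv] cE]; split; first by exists v; apply/valid_testP.
  exact/code_testP.
- move=> p u v /valid_testP[pn Vv].
  have [|x xEl e] := cplt p u pn; first by exists v.
  have [xn _ _] := own _ xEl; exists x; split=> //.
  exact: (proj2 (same_residualP u x.1.2 pn xn) e).
move=> p v /valid_testP[pn Vv].
by have [|x xEl e] := init p pn; [exists v | exists x].
Qed.

Lemma residuals_ok_exists : exists El, residuals_ok h (G, s, El).
Proof.
have tot := @word_le_total S; have tr := @word_le_trans S; have anti := @word_le_anti S.
have /choice[us usP] (p : W) : exists us : seq (seq W), p \in names ->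
    forall u, word_over names u ->
      exists2 v, v \in us & word_over names v /\ lquot u (valid p) = lquot v (valid p).
  have [pn|] := boolP (p \in names); last by exists [::].
  have [us usP] := valid_finite_index hm finP [::] reg pn.
  by exists us.
(* The empty sequence is put in front of the representatives to provide the literal entry for
   Val_P. *)
pose El := [seq x <- flatten [seq [seq
  (p, u, code p u) | u <- [::] :: us p] | p <- names]
  | `[< lquot x.1.2 (valid x.1.1) !=set0 >]] : seq (residual_datum S).
have inEl p u : p \in names -> u \in [::] :: us p -> lquot u (valid p) !=set0 ->
    (p, u, code p u) \in El.
  move=> pn uu ne; rewrite mem_filter; apply/andP; split; first exact/asboolP.
  by apply/flatten_mapP; exists p => //; apply: (map_f (fun u => (p, u, code p u))).
exists El; apply/residuals_okP; split.
- move=> x; rewrite mem_filter => /andP[/asboolP ne /flatten_mapP[p pn /mapP[u _ xE]]].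
  by subst x.
- move=> p u pn [v Vv]; have [ou _] := valid_over Vv.
  have [w wus [_ uw]] := usP p pn u ou.
  exists (p, w, code p w) => //; apply: inEl => //; first by rewrite inE wus orbT.
  by rewrite -uw; exists v.
move=> p pn [v Vv]; exists (p, [::], code p [::]) => //; apply: inEl => //.
by exists v.
Qed.

Section Residuals.
Variable El : seq (residual_datum S).
Hypothesis rEl : residuals_spec El.

Lemma code_eq p u p' u' : lquot u (valid p) = lquot u'
  (valid p') -> code p u = code p' u'.
Proof. by rewrite /code => ->. Qed.

Definition trans_spec (Tr : seq (trans_datum S)) : Prop :=
  (forall y, y \in Tr -> [/\ y.1.1 \in El, y.2 \in El &
     lquot (rcons y.1.1.1.2 y.1.2) (valid y.1.1.1.1) = lquot y.2.1.2
       (valid y.2.1.1)]) /\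
  (forall x a, x \in El -> lquot (rcons x.1.2 a) (valid x.1.1) !=set0 ->
     exists2 y, y \in Tr & y.1.1 = x /\ y.1.2 = a).

Lemma trans_okP Tr : trans_ok h (G, s, El, Tr) <-> trans_spec Tr.
Proof.
have [own _ _] := rEl; split=> [[snd cplt]|[snd cplt]]; split.
- move=> y /snd[/= xEl [zEl sr]]; split=> //.
  have [xn _ _] := own _ xEl; have [zn _ _] := own _ zEl.
  exact: (proj1 (same_residualP _ _ xn zn) sr).
- move=> x a xEl [v Vv]; have [pn _ _] := own _ xEl.
  have [|y [yTr yE]] := cplt a v x xEl; last by exists y.
  by apply/valid_testP; split=> //; rewrite -cat_rcons.
- move=> y /snd[/= xEl zEl e]; split=> //; split=> //.
  have [xn _ _] := own _ xEl; have [zn _ _] := own _ zEl.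
  exact: (proj2 (same_residualP _ _ xn zn) e).
move=> a v x xEl /valid_testP[pn Vv].
have [|y yTr yE] := cplt x a xEl; last by exists y.
by exists v; rewrite /lquot /= cat_rcons.
Qed.

Lemma trans_ok_exists : exists Tr, trans_ok h (G, s, El, Tr).
Proof.
have [own cplt _] := rEl.
have /choice[z zP] (q : residual_datum S * W) : exists z : residual_datum S,
    q.1 \in El -> lquot (rcons q.1.1.2 q.2) (valid q.1.1.1) !=set0 ->
    z \in El /\ lquot (rcons q.1.1.2 q.2) (valid q.1.1.1) = lquot z.1.2 (valid z.1.1).
  have [xEl|] := boolP (q.1 \in El); last by exists q.1.
  have [ne|] := pselect (lquot (rcons q.1.1.2 q.2) (valid q.1.1.1) !=set0);
    last by exists q.1.
  have [pn _ _] := own _ xEl.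
  by have [x' ? ?] := cplt _ _ pn ne; exists x'.
pose Tr := [seq y <- flatten [seq [seq (x, a, z (x, a)) | a <- names] | x <- El]
  | `[< lquot (rcons y.1.1.1.2 y.1.2) (valid y.1.1.1.1) !=set0 >]] : seq
    (trans_datum S).
exists Tr; apply/trans_okP; split.
  move=> y; rewrite mem_filter => /andP[/asboolP ne /flatten_mapP[x xEl /mapP[a an
    yE]]].
  by subst y; have [zEl e] := zP (x, a) xEl ne.
move=> x a xEl ne; exists (x, a, z (x, a)) => //.
rewrite mem_filter; apply/andP; split; first exact/asboolP.
apply/flatten_mapP; exists x => //; apply: (map_f (fun a => (x, a, z (x, a)))).
have [v /valid_over[oa _]] := ne; apply: oa.
by rewrite mem_rcons mem_head.
Qed.

Variable Tr : seq (trans_datum S).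
Hypothesis tTr : trans_spec Tr.

Lemma state_codes :
  [set c | exists p u, p \in names /\ (lquot u (valid p) !=set0 /\ c = code p u)] =
  [set` [seq x.2 | x <- El]].
Proof.
have [own cplt _] := rEl; apply/seteqP;
  split=> [c [p [u [pn [ne ->]]]]|c /mapP[x xEl ->]] /=.
  have [x xEl e] := cplt p u pn ne; apply/mapP; exists x => //.
  by rewrite (code_eq e); have [] := own _ xEl.
by have [pn ne ->] := own _ xEl; exists x.1.1, x.1.2.
Qed.

Lemma final_codes :
  [set c | exists p u, p \in names /\ (valid p u /\ c = code p u)] =
  [set` [seq x.2 | x <- data_final h (G, s, El)]].
Proof.
have [own cplt _] := rEl; apply/seteqP; split=> [c [p [u [pn [Vu ->]]]]|c /mapP[x]] /=.
  have [|x xEl e] := cplt p u pn; first by exists [::]; rewrite /lquot /= cats0.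
  have [xn _ xE] := own _ xEl; apply/mapP; exists x; last by rewrite (code_eq e).
  rewrite mem_filter xEl andbT; apply/asboolP/valid_testP; split=> //.
  have : lquot u (valid p) [::] by rewrite /lquot /= cats0.
  by rewrite e /lquot /= cats0.
rewrite mem_filter => /andP[/asboolP/valid_testP[pn Vu] xEl] ->.
by have [_ _ ->] := own _ xEl; exists x.1.1, x.1.2.
Qed.

(** A residual may come from several pairs (p, u) while only some are listed. Quotients of equal
    residuals are equal and codes depend on the residual only, so a transition can be moved to a
    listed pair. *)
Lemma trans_codes (Z : dfa -> W -> dfa -> Prop) :
  (exists p u a, p \in names /\ (lquot (rcons u a) (valid p) !=set0 /\
     Z (code p u) a (code p (rcons u a)))) <->
  exists2 y, y \in Tr & Z y.1.1.2 y.1.2 y.2.2.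
Proof.
have [own cplt _] := rEl; have [snd tot] := tTr; split.
  move=> [p [u [a [pn [ne z]]]]].
  have [|x xEl e] := cplt p u pn.
    by have [v Vv] := ne; exists (a :: v); rewrite /lquot /= -cat_rcons.
  have e' : lquot (rcons u a) (valid p) = lquot (rcons x.1.2 a) (valid x.1.1).
    by rewrite !lquot_rcons e.
  have [|y yTr [yx ya]] := tot x a xEl; first by rewrite -e'.
  have [_ zEl ez] := snd _ yTr; exists y => //.
  have [_ _ ->] := own _ zEl; rewrite yx ya.
  have [_ _ ->] := own _ xEl.
  by rewrite yx ya in ez; rewrite -(code_eq ez) -(code_eq e') -(code_eq e).
move=> [y yTr z]; have [xEl zEl e] := snd _ yTr.
have [pn _ xE] := own _ xEl; have [_ [v Vv] zE] := own _ zEl.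
exists y.1.1.1.1, y.1.1.1.2, y.1.2; split=> //; split; first by rewrite e; exists v.
by rewrite (code_eq e) -zE -xE.
Qed.

Lemma stop_codes (Z : dfa -> W -> Prop) :
  (exists p u a, p \in names /\ (valid p (rcons u a) /\ Z (code p u) a)) <->
  exists2 y, y \in data_stop h (G, s, Tr) & Z y.1.1.2 y.1.2.
Proof.
have [own cplt _] := rEl; have [snd tot] := tTr; split.
  move=> [p [u [a [pn [Vu z]]]]].
  have [|x xEl e] := cplt p u pn.
    by exists [:: a]; rewrite /lquot /= cats1.
  have [xn _ xE] := own _ xEl.
  have Vx : valid x.1.1 (rcons x.1.2 a).
    have : lquot u (valid p) [:: a] by rewrite /lquot /= cats1.
    by rewrite e /lquot /= cats1.
  have [|y yTr [yx ya]] := tot x a xEl; first by exists [::]; rewrite /lquot /= cats0.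
  exists y; last by rewrite yx ya xE -(code_eq e).
  by rewrite mem_filter yTr andbT; apply/asboolP/valid_testP; rewrite yx ya.
move=> [y]; rewrite mem_filter => /andP[/asboolP/valid_testP[pn Vy] yTr] z.
have [xEl _ _] := snd _ yTr; have [_ _ xE] := own _ xEl.
by exists y.1.1.1.1, y.1.1.1.2, y.1.2; split=> //; split=> //; rewrite -xE.
Qed.
End Residuals.

Lemma lex_codes p a : (p, a) \in data_lex h (G, s) <-> p \in names /\ theta p [:: a].
Proof.
rewrite mem_filter /=; split=> [/andP[/asboolP/class_testP//]|pa].
apply/andP; split; first exact/asboolP/class_testP.
have [sE _] := gs; have := pa.1; rewrite -sE => /mapP[e es ->].
by apply/flatten_mapP; exists e => //; apply: (map_f (fun a => (e.1.1, a)));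
  rewrite mem_enum.
Qed.

(** For a word of L the empty context serves in [similarP], so classes inside L call for no stored
    context. *)
Lemma start_testP a : start_test h (G, s, a) <-> starts h L a.
Proof.
have sim w : L (flatten a) ->
    similar_test h (G, ([::], [::]), flatten a, w) <-> theta (flatten a) w.
  by move=> La; apply: (similarP (c := ([::], [::])) sub); rewrite /= cats0.
split=> [[/over_testP oa [/= La fa]]|[oa [La fa]]]; split; rewrite /= ?over_testP //.
  by split=> // w /(sim w La)/fa/(factors_testP _ oa).
by split=> // w /(sim w La)/fa/(factors_testP _ oa).
Qed.

(** Let a be an exact factorization of an accepting class. Some x in [xs] has the image of
    [flatten a] under h; both lie in L and share the empty context, so they are congruent. Hence a
    also factors x, and its length is at most that of x, which puts a into [ys]. *)
Lemma starts_ok_spec xs ys st :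
  starts_ok h (G, s, xs, ys, st) -> [set` st] = starts h L.
Proof.
move=> [/= xsL [xsM [ysP [stP stys]]]].
have inst a : a \in ys -> (a \in st <-> starts h L a).
  by move=> /stP[[ast /start_testP sa]|[nast /start_testP nsa]]; split.
apply/seteqP; split=> a /= Sa; first exact/inst/Sa/stys.
apply/inst => //; have [oa [La fa]] := Sa.
apply: ysP; first exact/over_testP.
have [x [xxs /esym hx]] := xsM _ La; exists x; split=> //.
apply: (factors_size sep finP oa); apply: fa.
apply/(similarP (c := ([::], [::])) sub); first by rewrite /= cats0.
by split=> //=; rewrite cats0; exact: xsL.
Qed.

(** [xs] takes one word of L for each value of h on L, finitely many as M is finite; [ys] takes all
    sequences of names up to the greatest length in [xs]. *)
Lemma starts_ok_exists : exists xs ys st, starts_ok h (G, s, xs, ys, st).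
Proof.
have /finite_seqP[ms msE] := finM.
have /choice[g gP] (m : M) : exists w : option W,
    (forall x, w = Some x -> L x) /\
      (forall x, L x -> h x = m -> exists2 y, w = Some y & h y = m).
  have [[x [Lx hx]]|no] := pselect (exists x, L x /\ h x = m).
    by exists (Some x); split=> [_ [<-]//|_ _ _]; exists x.
  by exists None; split=> // x Lx hx; case: no; exists x.
pose xs := pmap g ms.
have inxs x : x \in xs <-> exists2 m, m \in ms & g m = Some x.
  rewrite /xs mem_pmap; split=> [/mapP[m mm e]|[m mm e]]; first by exists m.
  by apply/mapP; exists m.
have /finite_seqP[ys ysE] := finite_words_over names (\max_(x <- xs) size x).
exists xs, ys, [seq a <- ys | `[< starts h L a >]].
split; [|split; [|split; [|split]]] => /=.
- by move=> x /inxs[m _]; apply: (proj1 (gP m)).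
- move=> w Lw; have [y yE hy] := proj2 (gP (h w)) w Lw erefl.
  exists y; split=> //; apply/inxs; exists (h w) => //.
  by have : [set: M] (h w) by []; rewrite msE.
- move=> a /over_testP oa [x [xxs le_ax]].
  have : [set w | {subset w <= names} /\ size w <= \max_(x <- xs) size x] a.
    by split=> //; apply: leq_trans le_ax _; exact: leq_bigmax_seq.
  by rewrite ysE.
- move=> a ays; rewrite mem_filter ays andbT.
  by case: asboolP => Sa; [left|right]; split=> //; rewrite start_testP.
by move=> a; rewrite mem_filter => /andP[].
Qed.
End Good.

(** Every component is the listing of a finite set, so only sets have to be compared. They meet in
    the description of residuals by pairs of a name and a sequence of names. *)
Lemma data_ok_output d : data_ok h (G, d) -> data_output h
  (G, d) = canonical_output h L.
Proof.
case: d => [[[[[s El] Tr] xs] ys] st] [/primes_ok_good gs [/= rEl [tTr ok]]].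
move: rEl => /(residuals_okP gs) rEl; move: tTr => /(trans_okP gs rEl) tTr.
have stE := starts_ok_spec gs ok.
have lexE : [set x | exists P a, sval P [:: a] /\ x = (@name S M h L P, a)] =
    [set` data_lex h (G, s)].
  apply/seteqP; split=> [_ [P [a [Pa ->]]]|[p a] /(lex_codes gs)[pn pa]] /=.
    by apply/(lex_codes gs); apply/(lexP finP); exists P.
  have /(lexP finP)[P [Pa ->]] : p \in names /\ theta p [:: a] by [].
  by exists P, a.
rewrite /data_output /canonical_output /=; congr (_, (_, _)).
  rewrite /data_presentation /presentation_tuple /= lexE.
  rewrite (residual_codes hm finP) (state_codes rEl).
  rewrite (residual_final_codes hm finP) (final_codes gs rEl).
  rewrite (start_factorizationsE hm sep finP) -stE.
  have [-> _] := gs; congr (_, _, _, _, listing _, _).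
  apply/seteqP; split=> [x /mapP[y yTr ->]|x] /=.
    pose Z c a c' := (y.1.1.2, y.1.2, y.2.2) = (c, a, c') :> dfa * W * dfa.
    by apply/(residual_transP hm finP Z)/(trans_codes rEl tTr Z); exists y.
  pose Z c a c' := x = (c, a, c').
  by move=> /(residual_transP hm finP Z)/(trans_codes rEl tTr Z)[y yTr ->];
    apply/mapP; exists y.
congr listing; apply/seteqP; split=> x; rewrite /= !mem_cat.
  move=> /orP[/mapP[y yTr ->]|/orP[/mapP[y yTr ->]|/orP[/mapP[y]|/orP[/mapP[[p a] pa
    ->]|/mapP[a ast ->]]]]].
  - left; left; left; left.
    pose Z c a c' := (nt_state S y.1.1.2, [:: inl (nt_prime y.1.2);
      inl (nt_state S y.2.2)]) =
      (nt_state S c, [:: inl (nt_prime a); inl (nt_state S c')])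
      :> nonterm S * seq (nonterm S + S).
    by apply/(residual_transP hm finP Z)/(trans_codes rEl tTr Z); exists y.
  - left; left; left; right.
    pose Z c a := (nt_state S y.1.1.2, [:: inl (nt_prime y.1.2)]) =
      (nt_state S c, [:: inl (nt_prime a)]) :> nonterm S * seq (nonterm S + S).
    by apply/(residual_stopP hm finP Z)/(stop_codes gs rEl tTr Z); exists y.
  - rewrite mem_filter => /andP[/eqP yu yEl] ->; left; left; right.
    have [own _ _] := rEl; have [/(mem_names finP)[P PE] ne ->] := own _ yEl.
    rewrite yu -PE in ne *; exists P; split.
      by have [v Vv] := proj2 (residual_nonempty hm finP P [::]) ne; exists v.
    by rewrite -[Val P]/(lquot [::] (Val P)) (residual_codeE hm finP).
  - by left; right; move: pa => /(lex_codes gs)/(lexP finP)[P [Pa ->]]; exists P, a.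
  right; have : [set` st] a by []; rewrite stE -(start_factorizationsE hm sep finP).
  by move=> [b Sb <-]; exists b; split=> //; rewrite -map_comp.
move=> [[[[|]|]|]|].
- pose Z c a c' := x = (nt_state S c, [:: inl (nt_prime a); inl (nt_state S c')]).
  move=> /(residual_transP hm finP Z)/(trans_codes rEl tTr Z)[y yTr ->].
  by apply/orP; left; apply/mapP; exists y.
- pose Z c a := x = (nt_state S c, [:: inl (nt_prime a)]).
  move=> /(residual_stopP hm finP Z)/(stop_codes gs rEl tTr Z)[y yTr ->].
  apply/orP; right; apply/orP; left.
  by apply/mapP; exists y.
- move=> [P [neP ->]]; have [v Vv] := neP.
  have ne : valid (name P) !=set0 by exists (map (@name S M h L) v);
    apply/(Val_valid hm finP).
  have pn : name P \in names by apply/(mem_names finP); exists P.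
  have [own _ /(_ _ pn ne)[y yEl [yp yu]]] := rEl; have [_ _ yE] := own _ yEl.
  do 2![apply/orP; right]; apply/orP; left; apply/mapP; exists y.
    by rewrite mem_filter yu eqxx.
  by rewrite -[Val P]/(lquot [::] (Val P)) (residual_codeE hm finP) yE yp yu.
- move=> [P [a [Pa ->]]]; do 3![apply/orP; right]; apply/orP; left.
  apply/mapP; exists (name P, a) => //.
  by apply/(lex_codes gs)/(lexP finP); exists P.
move=> [b [Sb ->]]; do 4![apply/orP; right]; apply/mapP; exists (map (@name S M h L) b).
  have : [set` st] (map (@name S M h L) b); last by [].
  by rewrite stE -(start_factorizationsE hm sep finP); exists b.
by rewrite -map_comp.
Qed.

Lemma data_ok_exists : exists d, data_ok h (G, d).
Proof.
have [s ps] := primes_ok_exists; have gs := primes_ok_good ps.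
have [El rEl] := residuals_ok_exists gs; have rEl' := proj1 (residuals_okP gs El) rEl.
have [Tr tTr] := trans_ok_exists gs rEl'.
have [xs [ys [st ok]]] := starts_ok_exists gs.
by exists (s, El, Tr, xs, ys, st).
Qed.

(** Correct data are far from unique, as contexts, certificates and representatives can vary, but
    their output does not. This uniqueness allows any surviving candidate to be trusted. *)
Lemma canonical_outputP H :
  (exists d, data_ok h (G, d) /\ H = data_output h (G, d)) <-> H = canonical_output h L.
Proof.
split=> [[d [/data_ok_output e ->]]//|->].
by have [d ok] := data_ok_exists; exists d; rewrite data_ok_output.
Qed.
End Correctness.

(** * Learning in the limit *)

Definition upto (T : countType) (n : nat) : seq T :=
  flatten [seq seq_of_opt (pickle_inv m) | m <- iota 0 n].

Lemma mem_upto (T : countType) n (x : T) : (x \in upto T n) = (pickle x < n).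
Proof.
apply/flatten_mapP/idP => [[m]|lt_xn].
  rewrite mem_iota => /= lt_mn; have := @pickle_invK T m.
  by case: (pickle_inv m) => //= y yE; rewrite inE => /eqP ->; rewrite yE.
exists (pickle x); first by rewrite mem_iota.
by rewrite pickleK_inv mem_head.
Qed.

(** Raising the bound only appends elements, so the order in which candidates are tried does not
    depend on the stage. *)
Lemma uptoD (T : countType) m n : exists s, upto T (m + n) = upto T m ++ s.
Proof. by rewrite /upto iotaD map_cat flatten_cat; eexists. Qed.

Lemma computable_upto (A T : countType) (n : A -> nat) : effective T ->
  computable n -> computable (fun a => upto T (n a)).
Proof.
move=> eT cn; apply: computable_flatten; apply: computable_map;
  first exact: computable_iota.
have c1 : computable (@seq_of_opt T).
  apply: (computable_ext (f := fun o : option T =>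
    if o is Some x then [:: x] else [::])) => //.
  by apply: (computable_case_option (g := fun _ x => [:: x])); decidability.
by have c2 := computable_unpickle eT; decidability.
Qed.

Lemma eventually_all (T : eqType) (s : seq T) (P : T -> nat -> Prop) :
  (forall x, x \in s -> exists N, forall n, N <= n -> P x n) ->
  exists N, forall n, N <= n -> forall x, x \in s -> P x n.
Proof.
elim: s => [|x s IHs] ev; first by exists 0.
have [N1 N1P] := ev x (mem_head _ _).
have [|N2 N2P] := IHs; first by move=> y ys; apply: ev; rewrite inE ys orbT.
exists (maxn N1 N2) => n; rewrite geq_max => /andP[le1 le2] y.
by rewrite inE => /orP[/eqP ->|/(N2P n le2)//]; exact: N1P.
Qed.

Lemma computable_recode (T A B : countType) (g : A -> B) (f : T -> A) :
  (forall a, pickle (g a) = pickle a) -> computable f -> computable (fun t => g (f t)).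
Proof. by move=> gE [f' rf fE]; exists f' => // t; rewrite fE gE. Qed.

Lemma pickle_presentation (S : finType) t :
  pickle (tuple_presentation t : presentation S) = pickle t.
Proof. by rewrite -[in RHS](_ : presentation_tuple (tuple_presentation t) = t) //;
  case: t => [[[[[? ?] ?] ?] ?] ?]. Qed.

Lemma pickle_cfg (N : countType) (S : finType) (t : N * seq (N * seq (N + S))) :
  pickle (pair_cfg t) = pickle t.
Proof. by case: t. Qed.

(* A candidate is a grammar with a value and a witness; it is refuted by a word
   on which its grammar disagrees with the current hypothesis, or by an instance
   of the universal quantifier.  The learner outputs the first candidate not
   refuted within the first n tests. *)
Lemma limit_learner (S : finType) (H : countType) (a0 : H)
    (Phi : cfg nat S * H -> Prop) (W : seq (word S) -> cfg nat S) :
  effective H -> Sigma2 Phi -> computable W ->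
  exists2 A : seq (word S) -> H, computable A &
    forall L can, weakly_bc W L ->
      (forall G a, cfg_lang G = L -> Phi (G, a) <-> a = can) ->
      gold_identifies A L can.
Proof.
move=> eH /sigma2_matrix[U [V [D [eU eV dD PhiE]]]] cW.
have eG := effective_grammar S; have dL := @dec_lang_test S.
pose X := (cfg nat S * H * U)%type.
have eX : effective X by rewrite /X; decidability.
(* The length of the text serves as the clock for both kinds of tests; its words are consulted only
   through the hypothesis [W s]. *)
pose check (s : seq (word S)) (c : X) :=
  (forall w, w \in upto (word S) (size s) ->
     (lang_test (c.1.1, w) <-> lang_test (W s, w))) /\
  (forall v, v \in upto V (size s) -> D c.1 c.2 v).
have dcheck : dec (fun p : seq (word S) * X => check p.1 p.2).
  apply: dec_and; apply: dec_allin; try by apply: computable_upto; decidability.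
    by decidability.
  by apply: (dec_comp (f := fun q : seq (word S) * X * V =>
    (q.1.2.1, q.1.2.2, q.2)) dD); decidability.
pose cand (s : seq (word S)) := [seq c <- upto X (size s) | `[< check s c >]].
(* The value [a0] is returned at stages where no candidate survives. *)
exists (fun s => if cand s is c :: _ then c.1.2 else a0).
  apply: (computable_case_seq (f := fun=> a0) (g := fun q => q.2.1.1.2));
    try by decidability.
  by apply: (computable_filter_dec (P := check) _ dcheck); apply: computable_upto;
    decidability.
move=> L can bc PhiL T Tpos; have [N NP] := bc T Tpos.
have sizeT n : size (mkseq T n) = n by rewrite size_mkseq.
pose sound (c : X) := cfg_lang c.1.1 = L /\ forall v, D c.1 c.2 v.
have sound_can c : sound c -> c.1.2 = can.
  by case: c => [[G a] u] [/= LG Duv]; apply/(PhiL G a LG)/PhiE; exists u.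
(* A hypothesis of the weak learner past N generates L and so gives a sound candidate. Only finitely
   many candidates have a smaller code and can be tried before it. *)
pose G0 := W (mkseq T N).
have LG0 : cfg_lang G0 = L by exact: NP.
have /PhiE[u0 Du0] : Phi (G0, can) by apply/(PhiL _ _ LG0).
pose c0 : X := (G0, can, u0); pose k := (pickle c0).+1.
have sound_check c n : N <= n -> sound c -> check (mkseq T n) c.
  by move=> le_Nn [Lc Dc]; split=> [w _|v _] //; rewrite /lang_test /= Lc NP.
(* Past N the hypotheses generate L, so a word separating the candidate from L remains a refutation
   once its code is below the stage; so does a failing instance v. *)
have check_sound c : exists N', forall n, N' <= n -> check (mkseq T n) c -> sound c.
  have [sc|nsc] := pselect (sound c); first by exists 0.
  have [[w nw]|agree] := pselect (exists w, ~ (cfg_lang c.1.1 w <-> L w)).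
    exists (maxn N (pickle w).+1) => n; rewrite geq_max => /andP[le_Nn lt_wn] [chk _].
    have := chk w; rewrite mem_upto sizeT => /(_ lt_wn).
    by rewrite /lang_test /= NP.
  have Lc : cfg_lang c.1.1 = L.
    apply/seteqP; split=> w; apply: contraPP => nw; move: agree;
      apply: contra_not => Lw;
      by exists w; tauto.
  have [v nv] : exists v, ~ D c.1 c.2 v by apply/existsNP => Dc; apply: nsc.
  exists (pickle v).+1 => n lt_vn [_ chk]; case: nv; apply: chk.
  by rewrite mem_upto sizeT.
have [N' N'P] := eventually_all (s := upto X k) (fun c _ => check_sound c).
(* From k on the sound candidate is among those tested, from N on it survives, and from N' on no
   unsound candidate with code below k does. *)
exists (maxn k (maxn N N')) => n; rewrite !geq_max => /and3P[le_kn le_Nn le_N'n].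
rewrite /cand sizeT; have [s ->] : exists s, upto X n = upto X k ++ s.
  by rewrite -(subnKC le_kn); exact: uptoD.
rewrite filter_cat.
have : c0 \in [seq c <- upto X k | `[< check (mkseq T n) c >]].
  by rewrite mem_filter mem_upto leqnn andbT; apply/asboolP/sound_check.
case E: [seq c <- upto X k | _] => [|c l] // _ /=.
have : c \in [seq c <- upto X k | `[< check (mkseq T n) c >]] by rewrite E mem_head.
rewrite mem_filter => /andP[/asboolP chk ck].
exact/sound_can/(N'P n le_N'n c ck chk).
Qed.

Unset Implicit Arguments.
Set Strict Implicit.

Theorem theorem15p21 (S : finType) (M : monoidType) (h : word S -> M)
    (C : set (set (word S))) :
  finite_set [set: M] ->
  word_morphism h ->
  (forall L, C L ->
     [/\ context_free L, substitutable h L, unit_separated h L,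
         finite_set [set P | is_prime h L P] & FSRP h L]) ->
  (exists2 W : seq (word S) -> cfg nat S,
     computable W & forall L, C L -> weakly_bc W L) ->
  (exists2 A : seq (word S) -> presentation S,
     computable A &
     forall L, C L -> gold_identifies A L (canonical_presentation h L)) /\
  (exists2 B : seq (word S) -> cfg (nonterm S) S,
     computable B &
     forall L, C L -> gold_identifies B L (canonical_cfg h L)).
Proof.
move=> finM hm Cprop [W cW bcW].
have eD := effective_dfa; have eN := effective_nonterm S.
pose empty : seq (word S) * seq (word S * S) * seq (seq (word S)) * seq dfa *
    seq (dfa * word S * dfa) * seq dfa := ([::], [::], [::], [::], [::], [::]).
(* The Sigma2 description depends on h but not on L, so one learner is obtained before L is chosen
   in the class. *)
have [|A cA idA] := limit_learner (empty, (nt_start S, [::])) _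
  (sigma2_output finM hm) cW.
  by decidability.
have idL L : C L -> gold_identifies A L (canonical_output h L).
  move=> CL; have [_ sub sep finP reg] := Cprop L CL; apply: idA; first exact: bcW.
  by move=> G a LG; subst L; exact: canonical_outputP.
split.
  exists (fun s => tuple_presentation (A s).1).
    by apply: (computable_recode (@pickle_presentation S)); exact: computable_fst.
  move=> L CL T Tpos; have [N NP] := idL L CL T Tpos.
  by exists N => n /NP ->.
exists (fun s => pair_cfg (A s).2).
  by apply: (computable_recode (@pickle_cfg _ S)); exact: computable_snd.
move=> L CL T Tpos; have [N NP] := idL L CL T Tpos.
by exists N => n /NP ->.
Qed.
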